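(* Let $1\leq p<2$. There exists a constant $C_p>0$ such that \[\left(\int_{\mathbb{R}}\int_{1/2}^\infty |f(\sigma+it)|^2\, \left(\sigma-\tfrac{1}{2}\right)^{\frac{2}{p}-2}\frac{d\sigma\, dt}{|\sigma+it+1/2|^{4/p}}\right)^{1/2}\leq C_p \|f\|_{\mathcal{H}^p}\] for every $f\in\mathcal{H}^p$. Moreover, the exponent $\frac{2}{p}-2$ is the smallest possible, in the following sense: if $0<\beta<\frac 2p-1$, then there is no constant $C>0$ such that \[\int_{\mathbb{R}}\int_{1/2}^\infty |f(\sigma+it)|^2\, \left(\sigma-\tfrac{1}{2}\right)^{\beta-1}\frac{d\sigma\, dt}{|\sigma+it+1/2|^{2\beta+2}}\leq C \|f\|_{\mathcal{H}^p}^2\] for every $f\in\mathcal{H}^p$.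
   Context: For $1\leq p<\infty$, the Hardy space $\mathcal{H}^p$ of Dirichlet series is the Banach space completion of the Dirichlet polynomials $P(s)=\sum_{n=1}^N a_n n^{-s}$ with respect to the norm $\|P\|_{\mathcal{H}^p}=\lim_{T\to\infty}\left(\frac{1}{2T}\int_{-T}^T|P(it)|^p\,dt\right)^{1/p}$. Its elements are Dirichlet series $f(s)=\sum_{n\ge1}a_nn^{-s}$ converging absolutely in the half-plane $\{s=\sigma+it:\sigma>1/2\}$, where they define holomorphic functions. *)

(* Defs.v *)
From HB Require Import structures.
From mathcomp Require Import all_boot all_order all_algebra.
From mathcomp Require Import all_classical all_reals all_analysis.
From mathcomp Require Import complex.
Set Implicit Arguments. Unset Strict Implicit. Unset Printing Implicit Defensive.
Import Order.TTheory GRing.Theory Num.Theory.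
Import numFieldNormedType.Exports.
Local Open Scope classical_set_scope.
Local Open Scope ring_scope.

Section HardyDirichlet.
Variable R : realType.

Definition cabs (z : R[i]) : R := Num.sqrt (complex.Re z ^+ 2 + complex.Im z ^+ 2).

(* n^{-s} for s = sigma + i t, i.e. exp(-(sigma + i t) log n), n >= 1 *)
Definition npow_s (n : nat) (sigma t : R) : R[i] :=
  Complex (n%:R `^ (- sigma) * cos (t * ln n%:R))
          (- (n%:R `^ (- sigma) * sin (t * ln n%:R))).

(* A Dirichlet polynomial sum_{n=1}^N a_n n^{-s} is given by its length N
   and its coefficients a (only a_1, ..., a_N are used). *)
Definition dpoly := (nat * (nat -> R[i]))%type.

Definition dcoef (P : dpoly) (n : nat) : R[i] :=
  if (0 < n <= P.1)%N then P.2 n else 0.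

Definition deval (P : dpoly) (sigma t : R) : R[i] :=
  \sum_(1 <= n < P.1.+1) dcoef P n * npow_s n sigma t.

Definition dsub (P Q : dpoly) : dpoly :=
  (maxn P.1 Q.1, fun n => dcoef P n - dcoef Q n).

Definition dmean (p : R) (P : dpoly) (T : R) : R :=
  (2 * T)^-1 * Rintegral lebesgue_measure `[- T, T] (fun t => cabs (deval P 0 t) `^ p).

Definition Hp_norm_poly (p : R) (P : dpoly) : R :=
  lim (dmean p P T `^ p^-1 @[T --> +oo]).

Definition Hp_cauchy (p : R) (Ps : nat -> dpoly) : Prop :=
  forall e : R, 0 < e -> exists K : nat,
    forall k l : nat, (K <= k)%N -> (K <= l)%N -> Hp_norm_poly p (dsub (Ps k) (Ps l)) < e.

(* The element f of H^p (completion of the Dirichlet polynomials) represented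
   by the Cauchy sequence Ps is the Dirichlet series with coefficients b,
   where b n = lim_k (n-th coefficient of Ps k). *)
Definition Hp_approx (p : R) (b : nat -> R[i]) (Ps : nat -> dpoly) : Prop :=
  Hp_cauchy p Ps /\
  forall n : nat, (0 < n)%N ->
    ((fun k => complex.Re (dcoef (Ps k) n)) @ \oo --> complex.Re (b n)) /\
    ((fun k => complex.Im (dcoef (Ps k) n)) @ \oo --> complex.Im (b n)).

Definition Hp_norm_lim (p : R) (Ps : nat -> dpoly) : R :=
  lim (Hp_norm_poly p (Ps k) @[k --> \oo]).

Definition dseries (b : nat -> R[i]) (sigma t : R) : R[i] :=
  Complex (limn (fun N => \sum_(1 <= n < N) complex.Re (b n * npow_s n sigma t)))
          (limn (fun N => \sum_(1 <= n < N) complex.Im (b n * npow_s n sigma t))).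

Definition weighted_int (b : nat -> R[i]) (gamma delta : R) : \bar R :=
  (\int[lebesgue_measure]_(t in [set: R])
     \int[lebesgue_measure]_(sigma in `]((2 : R)^-1)%R, +oo[%classic)
       ((cabs (dseries b sigma t) ^+ 2 * (sigma - 2^-1) `^ gamma
         / cabs (Complex (sigma + 2^-1) t) `^ delta)%R%:E))%E.

End HardyDirichlet.

(* Main.v *)
(** Put [s = 2 / p].  The embedding rests on the inequality
    [sum_n |a_n|^2 / w n <= C * ||f||_p^2] with a multiplicative weight [w] such that
    [w q = s] and [w (q ^ k) = O(q ^ (k / 3))] for [q] prime.  Since the functions [q ^ (- i t)]
    behave like independent variables, it can be proved one prime at a time: a one-variable
    inequality follows by duality against truncated binomial series, and the slices of [f]
    are put together by Minkowski's inequality.  An Euler product bounds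
    [sum_(n <= x) w n] by [O(x * (1 + ln x) ^ (s - 1))].  On a vertical line the kernel
    [1 / (1 + t ^ 2)] almost decouples the blocks [k <= ln n < k + 1]; the Cauchy-Schwarz
    inequality in each block and an integration in [sigma] give the embedding for
    partial sums, and Fatou's lemma gives it in general.

    For the sharpness, [f = prod_q (1 + s * q ^ (- 1 / 2 - e - z))] over the primes
    [400 <= q <= N] has [||f||_p^2 = O(exp (s * S))] with [S = sum_q q ^ (- 1 - 2 e)], while
    [|f|^2] is about [exp (2 * s * S)] on a box of side comparable to [e] next to the point
    [1 / 2].  As [exp S] can be made at least [c / e], the reverse estimate would bound
    [e ^ (1 + beta - s)] as [e] tends to [0]. *)

Require Import Defs.
From mathcomp Require Import all_boot all_order all_algebra.
From mathcomp Require Import all_classical all_reals all_analysis.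
From mathcomp Require Import measurable_realfun.
From mathcomp Require Import complex.
From mathcomp Require Import ring lra zify.
Import Order.TTheory GRing.Theory Num.Theory.
Import numFieldNormedType.Exports.
Local Open Scope classical_set_scope.
Local Open Scope ring_scope.
Set Implicit Arguments. Unset Strict Implicit. Unset Printing Implicit Defensive.

(** * Complex moduli and unimodular exponentials *)

(** The constants of the one-variable inequalities are multiplied over all primes, so the one at [q]
    may lose only a factor [exp (O (q ^ (- a)))] with [a > 1]. Admitting the coefficients of index
    [k >= 2] with weights of order [q ^ (- k / 3)] costs [S = O (q ^ (- 2 / 3))] at first order, and
    these costs have a divergent sum over the primes. The way out is a strict gain in the inequality
    for two coefficients, a quartic [surplus] which is positive because [s > 1], that is [p < 2]: it
    lowers the cost to [S ^ 2 = O (q ^ (- 4 / 3))]. The exponent [1 / 3] balances this against the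
    Euler product of the weight, where the squares of primes contribute
    [q ^ (2 / 3 - 2) = q ^ (- 4 / 3)] as well.

    Independence enters as the invariance of the mean of [|f| ^ p] under twists by completely
    multiplicative unimodular functions. It is proved by comparing moments, so that neither the
    infinite torus nor an ergodic theorem is used.

    For the sharpness, a box of height [kap * e] costs [O (kap ^ 2 * ln (1 / e))] in the exponent;
    hence [kap] is fixed small in terms of the gap [s - 1 - beta]. *)

Section ComplexBasics.
Variable R : realType.
Implicit Types (z w : R[i]) (x y : R).

Lemma Re_add z w : complex.Re (z + w) = complex.Re z + complex.Re w.
Proof. by case: z w => [a b] [c d]. Qed.

Lemma Re_mul z w :
  complex.Re (z * w) = complex.Re z * complex.Re w - complex.Im z * complex.Im w.
Proof. by case: z w => [a b] [c d]. Qed.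

Lemma Re_sum I (r : seq I) (P : pred I) (F : I -> R[i]) :
  complex.Re (\sum_(i <- r | P i) F i) = \sum_(i <- r | P i) complex.Re (F i).
Proof. exact: (big_morph _ Re_add). Qed.

Lemma Im_add z w : complex.Im (z + w) = complex.Im z + complex.Im w.
Proof. by case: z w => [a b] [c d]. Qed.

Lemma Im_sum I (r : seq I) (P : pred I) (F : I -> R[i]) :
  complex.Im (\sum_(i <- r | P i) F i) = \sum_(i <- r | P i) complex.Im (F i).
Proof. exact: (big_morph _ Im_add). Qed.

Lemma conj_sum I (r : seq I) (P : pred I) (F : I -> R[i]) :
  conjc (\sum_(i <- r | P i) F i) = \sum_(i <- r | P i) conjc (F i).
Proof. exact: rmorph_sum. Qed.

Lemma conjM z w : conjc (z * w) = conjc z * conjc w.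
Proof. exact: rmorphM. Qed.

Lemma conjD z w : conjc (z + w) = conjc z + conjc w.
Proof. exact: rmorphD. Qed.

Lemma conj1 : conjc (1 : R[i]) = 1.
Proof. exact: rmorph1. Qed.

Lemma real_complexD x y : ((x + y)%:C)%C = (x%:C)%C + (y%:C)%C :> R[i].
Proof. exact: rmorphD. Qed.

Lemma real_complexM x y : ((x * y)%:C)%C = (x%:C)%C * (y%:C)%C :> R[i].
Proof. exact: rmorphM. Qed.

Lemma real_complexX x n : ((x ^+ n)%:C)%C = (x%:C)%C ^+ n :> R[i].
Proof. exact: rmorphXn. Qed.

Lemma conjX z n : conjc (z ^+ n) = conjc z ^+ n.
Proof. exact: rmorphXn. Qed.

Lemma Re_scale x z : complex.Re (x%:C * z)%C = x * complex.Re z.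
Proof. by case: z => a b /=; rewrite mul0r subr0. Qed.

Lemma cabs_normc z : cabs z = Normc.normc z.
Proof. by case: z. Qed.

Lemma cabs_ge0 z : 0 <= cabs z.
Proof. exact: sqrtr_ge0. Qed.

Lemma cabs_sqr z : cabs z ^+ 2 = complex.Re z ^+ 2 + complex.Im z ^+ 2.
Proof. by rewrite sqr_sqrtr // addr_ge0 // sqr_ge0. Qed.

Lemma mul_conj_cabs z : z * conjc z = ((cabs z ^+ 2)%:C)%C.
Proof.
rewrite cabs_sqr; case: z => a b; apply/eqP; rewrite eq_complex /=.
by apply/andP; split; apply/eqP; ring.
Qed.

Lemma cabsM z w : cabs (z * w) = cabs z * cabs w.
Proof. by rewrite !cabs_normc Normc.normcM. Qed.

Lemma cabsD z w : cabs (z + w) <= cabs z + cabs w.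
Proof. by rewrite !cabs_normc le_normcD. Qed.

Lemma cabs0 : cabs (0 : R[i]) = 0.
Proof. by rewrite cabs_normc Normc.normc0. Qed.

Lemma cabs1 : cabs (1 : R[i]) = 1.
Proof. by rewrite cabs_normc Normc.normc1. Qed.

Lemma cabsN z : cabs (- z) = cabs z.
Proof. by rewrite !cabs_normc normcN. Qed.

Lemma cabs_conj z : cabs (conjc z) = cabs z.
Proof. by case: z => a b; rewrite /cabs /= sqrrN. Qed.

Lemma cabs_real x : cabs (x%:C)%C = `|x|.
Proof. by rewrite /cabs /= expr0n addr0 sqrtr_sqr. Qed.

Lemma cabs_eq0 z : cabs z = 0 -> z = 0.
Proof. by rewrite cabs_normc => /Normc.eq0_normc. Qed.

Lemma cabsX z n : cabs (z ^+ n) = cabs z ^+ n.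
Proof. by elim: n => [|n IH]; rewrite ?expr0 ?cabs1 // !exprS cabsM IH. Qed.

Lemma cabs_sum I (r : seq I) (P : pred I) (F : I -> R[i]) :
  cabs (\sum_(i <- r | P i) F i) <= \sum_(i <- r | P i) cabs (F i).
Proof.
apply: (big_ind2 (fun z (x : R) => cabs z <= x)); rewrite ?cabs0 // => z1 x1 z2 x2 h1 h2.
exact: le_trans (cabsD _ _) (lerD h1 h2).
Qed.

Lemma cabs_prod I (r : seq I) (P : pred I) (F : I -> R[i]) :
  cabs (\prod_(i <- r | P i) F i) = \prod_(i <- r | P i) cabs (F i).
Proof. exact: (big_morph _ cabsM cabs1). Qed.

Lemma normr_Re_le z : `|complex.Re z| <= cabs z.
Proof.
by rewrite -[X in X <= _]sqrtr_sqr ler_sqrt ?lerDl ?sqr_ge0 // addr_ge0 ?sqr_ge0.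
Qed.

Lemma normr_Im_le z : `|complex.Im z| <= cabs z.
Proof.
by rewrite -[X in X <= _]sqrtr_sqr ler_sqrt ?lerDr ?sqr_ge0 // addr_ge0 ?sqr_ge0.
Qed.

Lemma cabs_powR z p : cabs z `^ p = (cabs z ^+ 2) `^ (p / 2).
Proof. by rewrite -powR_mulrn ?cabs_ge0 // -powRrM mulrC divfK // pnatr_eq0. Qed.

Lemma cabsB_ge z w : cabs z - cabs w <= cabs (z - w).
Proof. by rewrite lerBlDr; have := cabsD (z - w) w; rewrite subrK. Qed.

Definition cis x : R[i] := Complex (cos x) (sin x).

Lemma cisD x y : cis (x + y) = cis x * cis y.
Proof.
apply/eqP; rewrite eq_complex /= cosD sinD.
by apply/andP; split => //; apply/eqP; ring.
Qed.

Lemma cis0 : cis 0 = 1.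
Proof. by rewrite /cis cos0 sin0. Qed.

Lemma cisN x : cis (- x) = conjc (cis x).
Proof. by rewrite /cis cosN sinN. Qed.

Lemma cabs_cis x : cabs (cis x) = 1.
Proof. by rewrite /cabs /= cos2Dsin2 sqrtr1. Qed.

Lemma cisX x n : cis x ^+ n = cis (n%:R * x).
Proof.
elim: n => [|n IH]; first by rewrite expr0 mul0r cis0.
by rewrite exprS IH -cisD mulrS mulrDl mul1r.
Qed.

Lemma cis_sum I (r : seq I) (P : pred I) (F : I -> R) :
  cis (\sum_(i <- r | P i) F i) = \prod_(i <- r | P i) cis (F i).
Proof. exact: (big_morph _ cisD cis0). Qed.

Lemma npow_sE n sigma t :
  npow_s n sigma t = ((n%:R `^ (- sigma))%:C)%C * cis (- (t * ln n%:R)) :> R[i].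
Proof.
rewrite /npow_s /cis cosN sinN; apply/eqP; rewrite eq_complex /=.
by apply/andP; split; apply/eqP; ring.
Qed.

Lemma npow0E n t : npow_s n 0 t = cis (- (t * ln n%:R)) :> R[i].
Proof. by rewrite npow_sE oppr0 powRr0 mul1r. Qed.

Lemma lnX (n k : nat) : ln ((n ^ k)%N%:R) = k%:R * ln n%:R :> R.
Proof.
case: n => [|n]; last by rewrite natrX lnXn ?ltr0Sn // mulr_natl.
by case: k => [|k]; rewrite ?expn0 ?ln1 ?mul0r // exp0n // ln0 // mulr0.
Qed.

Lemma lnM_nat (m n : nat) : (0 < m)%N -> (0 < n)%N ->
  ln ((m * n)%N%:R) = ln m%:R + ln n%:R :> R.
Proof. by move=> m0 n0; rewrite natrM lnM // posrE ltr0n. Qed.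

End ComplexBasics.

(** * Truncated binomial series *)

Section TruncatedBinomial.
Variable R : realType.
Implicit Types (z w : R[i]) (g r th : R).

(** The generalized binomial coefficients: [binpoly] below is the Taylor polynomial at 0 of the
    branch of [(1 + w) ^ g] that equals 1 there. *)
Definition gbin g (k : nat) : R := \prod_(i < k) ((g - i%:R) / i.+1%:R).

Lemma gbin0 g : gbin g 0 = 1.
Proof. by rewrite /gbin big_ord0. Qed.

Lemma gbinS g k : k.+1%:R * gbin g k.+1 = (g - k%:R) * gbin g k.
Proof.
rewrite /gbin big_ord_recr /= mulrCA mulrC; congr (_ * _).
by rewrite mulrC divfK // pnatr_eq0.
Qed.

Lemma gbin1 g : gbin g 1 = g.
Proof. by have := gbinS g 0; rewrite gbin0 mul1r mulr1 subr0. Qed.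

Lemma normr_gbin_le1 g k : `|g| <= 1 -> `|gbin g k| <= 1.
Proof.
move=> g1; rewrite /gbin normr_prod; apply: prodr_ile1 => i _.
rewrite normr_ge0 normrM normfV normr_nat ler_pdivrMr ?ltr0Sn // mul1r.
rewrite (le_trans (ler_normB _ _)) // normr_nat mulrS lerD2r //.
Qed.

Definition binpoly g K w : R[i] := \sum_(k < K.+1) ((gbin g k)%:C)%C * w ^+ k.

Lemma geom_le th n : 0 <= th -> th < 1 -> \sum_(k < n) th ^+ k <= (1 - th)^-1.
Proof.
move=> t0 t1; have ht : 0 < 1 - th by rewrite subr_gt0.
rewrite -(ler_pM2l ht) divff ?gt_eqF //.
have -> : (1 - th) * (\sum_(k < n) th ^+ k) = 1 - th ^+ n.
  by rewrite -subrX1' || (have := subrX1 th n; lra).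
by rewrite gerBl exprn_ge0.
Qed.

Lemma cabs_binpoly_le g K w th : `|g| <= 1 -> cabs w <= th -> th < 1 ->
  cabs (binpoly g K w) <= (1 - th)^-1.
Proof.
move=> g1 wt t1; have t0 : 0 <= th by exact: le_trans (cabs_ge0 w) wt.
apply: le_trans (cabs_sum _ _ _) (le_trans _ (geom_le K.+1 t0 t1)).
apply: ler_sum => k _; rewrite cabsM cabs_real cabsX.
rewrite -[X in _ <= X]mul1r; apply: ler_pM => //.
- by rewrite exprn_ge0 // cabs_ge0.
- exact: normr_gbin_le1.
- by apply: lerXn2r; rewrite ?nnegrE ?cabs_ge0.
Qed.

Let dbin g K w r : R[i] :=
  \sum_(k < K.+1) ((gbin g k * (r ^+ k.-1 *+ k))%:C)%C * w ^+ k.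

(* [Q_K] solves [(1 + z) Q' = g Q] up to its last term, and [(1 + z)^g] solves it exactly. *)
Let binpoly_ode g K w r :
  (1 + (r%:C)%C * w) * dbin g K w r - (g%:C)%C * w * binpoly g K ((r%:C)%C * w) =
  (((K%:R - g) * gbin g K * r ^+ K)%:C)%C * w ^+ K.+1.
Proof.
rewrite /dbin /binpoly; elim: K => [|K IH].
  rewrite !big_ord_recl !big_ord0 /= !expr0 gbin0 mulr0n.
  by rewrite !rmorphM !rmorphB /= !rmorph1 rmorph0; ring.
rewrite big_ord_recr [X in _ - _ * X]big_ord_recr /=.
set a := \sum_(i < _) _ in IH *; set b := \sum_(i < _) _ in IH *.
transitivity (((1 + (r%:C)%C * w) * a - (g%:C)%C * w * b) +
  (((K.+1%:R * gbin g K.+1)%:C)%C * (r ^+ K)%:C%C * w ^+ K.+1 * (1 + (r%:C)%C * w)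
   - (g%:C)%C * w * (((gbin g K.+1)%:C)%C * (((r%:C)%C * w) ^+ K.+1)))).
  rewrite -[_ *+ K.+1]mulr_natr !rmorphM /=; ring.
rewrite IH exprMn -rmorphXn /=.
have -> : ((K%:R - g) * gbin g K * r ^+ K) = - (K.+1%:R * gbin g K.+1) * r ^+ K.
  by rewrite gbinS; ring.
rewrite (exprS r) (exprS w K.+1) !(rmorphM, rmorphB, rmorphN) /=.
by ring.
Qed.

Let S2 w : {poly R} := 1 + (2 * complex.Re w) *: 'X + (cabs w ^+ 2) *: 'X^2.

Let S2E w r : (S2 w).[r] = cabs (1 + (r%:C)%C * w) ^+ 2.
Proof.
rewrite /S2 !hornerE !cabs_sqr; case: w => a b /=; ring.
Qed.

Let Qr g K w : {poly R} := \poly_(k < K.+1) (gbin g k * complex.Re (w ^+ k)).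
Let Qi g K w : {poly R} := \poly_(k < K.+1) (gbin g k * complex.Im (w ^+ k)).

Let ImM (x : R) z : complex.Im ((x%:C)%C * z) = x * complex.Im z.
Proof. by case: z => a b /=; rewrite mul0r addr0. Qed.

Let QrE g K w r : (Qr g K w).[r] = complex.Re (binpoly g K ((r%:C)%C * w)).
Proof.
rewrite horner_poly Re_sum; apply: eq_bigr => k _.
by rewrite exprMn -rmorphXn /= Re_scale Re_scale; ring.
Qed.

Let QiE g K w r : (Qi g K w).[r] = complex.Im (binpoly g K ((r%:C)%C * w)).
Proof.
rewrite horner_poly Im_sum; apply: eq_bigr => k _.
by rewrite exprMn -rmorphXn /= ImM ImM; ring.
Qed.

Let deriv_poly_horner (E : nat -> R) n r :
  ((\poly_(k < n) E k)^`()).[r] = \sum_(k < n) E k * (r ^+ k.-1 *+ k).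
Proof.
rewrite poly_def raddf_sum horner_sum; apply: eq_bigr => k _.
by rewrite -[LHS]/((E k *: 'X^k)^`()).[r] derivZ derivXn hornerZ hornerMn hornerXn.
Qed.

Let dQrE g K w r : ((Qr g K w)^`()).[r] = complex.Re (dbin g K w r).
Proof.
rewrite deriv_poly_horner Re_sum; apply: eq_bigr => k _.
by rewrite Re_scale; ring.
Qed.

Let dQiE g K w r : ((Qi g K w)^`()).[r] = complex.Im (dbin g K w r).
Proof.
rewrite deriv_poly_horner Im_sum; apply: eq_bigr => k _.
by rewrite ImM; ring.
Qed.

(** The quotient of [|Q (r w)| ^ 2] by [|1 + r w| ^ (2 g)] equals 1 at [r = 0]. By the differential
    equation its derivative in [r] involves the last term only, and the mean value theorem on the
    segment from 0 to 1 concludes. Only moduli occur, so no complex power has to be defined. *)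
Lemma binpoly_approx g K w th : `|g| <= 1 -> cabs w <= th -> th < 1 ->
  `|cabs (binpoly g K w) ^+ 2 * (cabs (1 + w) ^+ 2) `^ (- g) - 1|
    <= 4 * (1 - th) ^- 5 * K.+1%:R * cabs w ^+ K.+1.
Proof.
move=> g1 wt t1; have t0 : 0 <= th by exact: le_trans (cabs_ge0 w) wt.
have ht : 0 < 1 - th by rewrite subr_gt0.
pose N : {poly R} := Qr g K w * Qr g K w + Qi g K w * Qi g K w.
have S2ge r : 0 <= r <= 1 -> (1 - th) ^+ 2 <= (S2 w).[r].
  move=> /andP[r0 r1]; rewrite S2E lerXn2r ?nnegrE ?cabs_ge0 //; first exact: ltW.
  have := cabsB_ge 1 (- ((r%:C)%C * w)); rewrite opprK cabs1 cabsN cabsM cabs_real ger0_norm //.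
  move=> h; apply: le_trans h; rewrite lerB // (le_trans _ wt) // ler_piMl ?cabs_ge0 //.
have S2pos r : 0 <= r <= 1 -> 0 < (S2 w).[r].
  by move=> h; apply: lt_le_trans (S2ge _ h); rewrite exprn_gt0.
pose D r := N.[r] * (S2 w).[r] `^ (- g).
pose dD r := N.[r] * ((- g) * (S2 w).[r] `^ (- g - 1) * ((S2 w)^`()).[r])
             + (S2 w).[r] `^ (- g) * (N^`()).[r].
have hD r : 0 <= r <= 1 -> is_derive r 1 D (dD r).
  move=> hr; have hS := S2pos _ hr.
  have := is_deriveM (is_derive_poly N r)
    (is_derive1_comp (is_derive1_powR (- g) hS) (is_derive_poly (S2 w) r)).
  move=> h; apply: is_derive_eq h _; rewrite /dD /GRing.scale /=; ring.
have [c c01 hc] : exists2 c, c \in `[0, 1]%R & D 1 - D 0 = dD c * (1 - 0).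
  apply: MVT_segment => //.
    by move=> x; rewrite in_itv /= => /andP[x0 x1]; apply: hD; rewrite !ltW.
  apply: derivable_within_continuous => x; rewrite in_itv /= => hx.
  by case: (hD _ hx).
have D0 : D 0 = 1.
  rewrite /D S2E /N hornerD !hornerM QrE QiE rmorph0 mul0r addr0 cabs1 expr1n powR1 mulr1.
  rewrite /binpoly big_ord_recl expr0 gbin0 mulr1 big1 ?addr0 /=; first by ring.
  by move=> i _; rewrite expr0n /= mulr0.
have D1 : D 1 = cabs (binpoly g K w) ^+ 2 * (cabs (1 + w) ^+ 2) `^ (- g).
  rewrite /D S2E /N hornerD !hornerM QrE QiE rmorph1 !mul1r.
  by rewrite [cabs (binpoly _ _ _) ^+ 2]cabs_sqr !expr2.
rewrite D0 D1 subr0 mulr1 in hc; rewrite hc {hc D0 D1}.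
rewrite in_itv /= in c01; have hS := S2pos _ c01; have [c0 c1] := andP c01.
set q := binpoly g K ((c%:C)%C * w); set u := 1 + (c%:C)%C * w.
have hw : cabs ((c%:C)%C * w) <= th.
  by rewrite cabsM cabs_real ger0_norm // (le_trans _ wt) // ler_piMl ?cabs_ge0.
(* The quotient rule gives [2 * Re (conj q * (conj u * (u q' - g w q)))] up to a power of [|u|]; the
   inner bracket is the left side of [binpoly_ode]. *)
have -> : dD c = (S2 w).[c] `^ (- g - 1) * (2 * complex.Re (conjc q * conjc u *
    ((((K%:R - g) * gbin g K * c ^+ K)%:C)%C * w ^+ K.+1))).
  rewrite /dD -binpoly_ode.
  have -> : (S2 w).[c] `^ (- g) = (S2 w).[c] `^ (- g - 1) * (S2 w).[c].
    by rewrite -[X in _ = _ * X]powRr1 ?ltW // -powRD ?subrK // (gt_eqF hS) implybT.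
  have -> : ((S2 w)^`()).[c] = 2 * complex.Re (w * conjc u).
    rewrite /S2 !poly.derivE !hornerE /u /= !cabs_sqr; case: (w) => a b /=; ring.
  rewrite S2E /N derivD !derivM !hornerD !hornerM QrE QiE dQrE dQiE -/q -/u cabs_sqr.
  case: (dbin g K w c) => d1 d2; case: (q) => q1 q2; case: (u) => u1 u2; case: (w) => w1 w2 /=.
  by move: (_ `^ _) => V; ring.
rewrite normrM ger0_norm ?powR_ge0 // normrM (ger0_norm (_ : 0 <= 2)) //.
(* As [g <= 1], the exponent is at least [- 2], and the base is at least [(1 - th) ^ 2]. The fifth
   factor [(1 - th)^-1] of the claim comes from the bound on [q]. *)
have h1 : (S2 w).[c] `^ (- g - 1) <= (1 - th) ^- 4.
  have -> : - g - 1 = - (g + 1) by ring.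
  move: g1; rewrite ler_norml => /andP[ga gb].
  have ha : 0 <= g + 1 by lra.
  rewrite powRN lef_pV2 ?posrE ?powR_gt0 ?exprn_gt0 //.
  apply: le_trans (ge0_ler_powR ha _ _ (S2ge _ c01)); rewrite ?nnegrE ?exprn_ge0 // ?(ltW ht) // ?(ltW hS) //.
  have -> : (1 - th) ^+ 4 = ((1 - th) ^+ 2) `^ 2%:R by rewrite powR_mulrn ?exprn_ge0 ?(ltW ht) // -exprM.
  have hx : 0 < (1 - th) ^+ 2 <= 1.
    by rewrite exprn_gt0 //= exprn_ile1 ?(ltW ht) //; lra.
  by apply: (ger_powR hx); lra.
have h2 : `|complex.Re (conjc q * conjc u *
    ((((K%:R - g) * gbin g K * c ^+ K)%:C)%C * w ^+ K.+1))|
    <= (1 - th)^-1 * 2 * (K.+1%:R * cabs w ^+ K.+1).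
  apply: le_trans (normr_Re_le _) _.
  rewrite !cabsM !cabs_conj cabs_real cabsX.
  apply: ler_pM; rewrite ?mulr_ge0 ?cabs_ge0 ?exprn_ge0 ?normr_ge0 ?cabs_ge0 //.
    apply: ler_pM; rewrite ?cabs_ge0 //; first exact: cabs_binpoly_le.
    apply: le_trans (cabsD _ _) _; rewrite cabs1.
    have : cabs ((c%:C)%C * w) <= 1 by apply: le_trans hw (ltW t1).
    lra.
  apply: ler_wpM2r; first by rewrite exprn_ge0 ?cabs_ge0.
  rewrite !normrM -[X in _ <= X]mulr1 -[X in _ <= X]mulr1.
  apply: ler_pM; rewrite ?mulr_ge0 ?normr_ge0 //.
    apply: ler_pM; rewrite ?normr_ge0 ?normr_gbin_le1 //.
    apply: le_trans (ler_normB _ _) _; rewrite normr_nat.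
    by rewrite -natr1 lerD2l.
  by rewrite normrX exprn_ile1 // ger0_norm.
apply: le_trans (_ : (1 - th) ^- 4 * (2 * ((1 - th)^-1 * 2 * (K.+1%:R * cabs w ^+ K.+1))) <= _).
  by apply: ler_pM => //; rewrite ?powR_ge0 ?mulr_ge0 ?normr_ge0 // ler_wpM2l.
rewrite le_eqVlt; apply/orP; left; apply/eqP.
have := gt_eqF ht; move=> /negbT hn.
by field.
Qed.

End TruncatedBinomial.

(** * Mean values on the real line *)

Section BoundedMeasurable.
Variable R : realType.
Implicit Types (f g : R -> R).

(** A class closed under all the operations used on integrands and contained in the integrable
    functions of every segment, so that integrability is settled by closure rules. *)
Definition bmeas f := measurable_fun setT f /\ exists B : R, forall x, `|f x| <= B.

Lemma bmeas_cst (c : R) : bmeas (fun=> c).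
Proof. by split; [exact: measurable_cst | exists `|c|]. Qed.

Lemma bmeasD f g : bmeas f -> bmeas g -> bmeas (fun x => f x + g x).
Proof.
move=> [mf [B hB]] [mg [D hD]]; split; first exact: measurable_funD.
by exists (B + D) => x; apply: le_trans (ler_normD _ _) (lerD _ _).
Qed.

Lemma bmeasM f g : bmeas f -> bmeas g -> bmeas (fun x => f x * g x).
Proof.
move=> [mf [B hB]] [mg [D hD]]; split; first exact: measurable_funM.
by exists (B * D) => x; rewrite normrM ler_pM.
Qed.

Lemma bmeasZ (c : R) f : bmeas f -> bmeas (fun x => c * f x).
Proof. by move=> hf; apply: bmeasM => //; exact: bmeas_cst. Qed.

Lemma bmeasB f g : bmeas f -> bmeas g -> bmeas (fun x => f x - g x).
Proof.
move=> hf hg; have := bmeasD hf (bmeasZ (-1) hg).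
by under eq_fun do rewrite mulN1r.
Qed.

Lemma bmeasX f n : bmeas f -> bmeas (fun x => f x ^+ n).
Proof.
move=> hf; elim: n => [|n IH]; first exact: bmeas_cst.
by under eq_fun do rewrite exprS; exact: bmeasM.
Qed.

Lemma bmeas_sum I (s : seq I) (F : I -> R -> R) :
  (forall i, bmeas (F i)) -> bmeas (fun x => \sum_(i <- s) F i x).
Proof.
move=> hF; elim: s => [|i s IH].
  by under eq_fun do rewrite big_nil; exact: bmeas_cst.
by under eq_fun do rewrite big_cons; exact: bmeasD.
Qed.

Lemma bmeas_powR f (r : R) : 0 <= r -> (forall x, 0 <= f x) -> bmeas f ->
  bmeas (fun x => f x `^ r).
Proof.
move=> r0 f0 [mf [B hB]]; split.
  exact: (measurableT_comp (measurable_powR r) mf).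
exists (B `^ r) => x; rewrite ger0_norm ?powR_ge0 //.
have hx : f x <= B by rewrite -(ger0_norm (f0 x)).
by apply: ge0_ler_powR; rewrite ?nnegrE // (le_trans (f0 x)).
Qed.

Lemma bmeas_cos (a b : R) : bmeas (fun x => cos (a * x + b)).
Proof.
split; last by exists 1 => x; rewrite ler_norml cos_geN1 cos_le1.
apply: continuous_measurable_fun => x.
apply: continuous_comp; last exact: continuous_cos.
by apply: cvgD; [apply: cvgMr; exact: cvg_id | exact: cvg_cst].
Qed.

Lemma bmeas_sin (a b : R) : bmeas (fun x => sin (a * x + b)).
Proof.
split; last by exists 1 => x; rewrite ler_norml sin_geN1 sin_le1.
apply: continuous_measurable_fun => x.
apply: continuous_comp; last exact: continuous_sin.
by apply: cvgD; [apply: cvgMr; exact: cvg_id | exact: cvg_cst].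
Qed.

Lemma bmeas_integrable (a b : R) f : bmeas f ->
  (@lebesgue_measure R).-integrable `[a, b] (EFin \o f).
Proof.
move=> [mf [B hB]]; apply: measurable_bounded_integrable => //.
- have h : (lebesgue_measure (`[a, b]%classic : set R) < +oo)%E.
    by rewrite lebesgue_measure_itv /=; case: ifP => // _; rewrite -EFinB ltry.
  exact: h.
- exact: measurable_funTS.
- exists B; split; first exact: num_real.
  by move=> M BM x _ /=; apply: le_trans (hB x) (ltW BM).
Qed.

Lemma Rintegral_FTC (F f : R -> R) (a b : R) : a < b ->
  (forall x : R, is_derive x 1 F (f x)) -> continuous f ->
  Rintegral lebesgue_measure `[a, b] f = F b - F a.
Proof.
move=> ab dF cf; have cF : continuous F.
  by move=> x; apply: differentiable_continuous; apply/derivable1_diffP; case: (dF x).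
rewrite /Rintegral (@continuous_FTC2 _ f F) //.
- exact: continuous_subspaceT.
- split.
  + by move=> x _; case: (dF x).
  + by apply: cvg_at_right_filter; exact: cF.
  + by apply: cvg_at_left_filter; exact: cF.
- by move=> x _; rewrite derive1E; exact: derive_val.
Qed.

End BoundedMeasurable.

Section Mean.
Variable R : realType.
Implicit Types (f g : R -> R) (m : R).

Definition mean f (T : R) : R :=
  (2 * T)^-1 * Rintegral lebesgue_measure `[- T, T] f.

Definition has_mean f m := mean f T @[T --> +oo] --> m.

Lemma has_mean_unique f m m' : has_mean f m -> has_mean f m' -> m = m'.
Proof. by move=> h h'; apply: (cvg_unique _ h h'). Qed.

Lemma meanD f g T : bmeas f -> bmeas g ->
  mean (fun x => f x + g x) T = mean f T + mean g T.
Proof.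
move=> hf hg; rewrite /mean RintegralD; [by rewrite mulrDr | by [] | |];
exact: bmeas_integrable.
Qed.

Lemma meanZ (c : R) f T : bmeas f -> mean (fun x => c * f x) T = c * mean f T.
Proof.
move=> hf; rewrite /mean RintegralZl; [by rewrite mulrCA | by [] |].
exact: bmeas_integrable.
Qed.

Lemma mean_cst (c : R) T : 0 < T -> mean (fun=> c) T = c.
Proof.
move=> T0; rewrite /mean Rintegral_cst //; set X := fine _.
have h : lebesgue_measure (`[- T, T]%classic : set R) = (2 * T)%:E.
  rewrite lebesgue_measure_itv /= lte_fin.
  have -> : - T < T by lra.
  by rewrite -EFinB; congr EFin; ring.
have -> : X = 2 * T by exact: (congr1 fine h).
by field; rewrite gt_eqF.
Qed.

Lemma le_mean f g T : 0 < T -> bmeas f -> bmeas g -> (forall x, f x <= g x) ->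
  mean f T <= mean g T.
Proof.
move=> T0 hf hg fg; rewrite /mean ler_wpM2l ?invr_ge0 ?mulr_ge0 ?(ltW T0) //.
by apply: le_Rintegral => //; exact: bmeas_integrable.
Qed.

Lemma has_meanD f g m m' : bmeas f -> bmeas g -> has_mean f m -> has_mean g m' ->
  has_mean (fun x => f x + g x) (m + m').
Proof.
move=> bf bg hf hg; rewrite /has_mean; under eq_fun do rewrite meanD //.
exact: cvgD.
Qed.

Lemma has_meanZ (c : R) f m : bmeas f -> has_mean f m ->
  has_mean (fun x => c * f x) (c * m).
Proof.
move=> bf hf; rewrite /has_mean; under eq_fun do rewrite meanZ //.
exact: cvgMr.
Qed.

Lemma has_mean_cst (c : R) : has_mean (fun=> c) c.
Proof.
apply: (@cvg_trans _ ((fun=> c : R) @ (+oo : set_system R))); last exact: cvg_cst.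
apply: near_eq_cvg; near=> T; rewrite mean_cst //.
Unshelve. all: by end_near. Qed.

Lemma has_mean_sum I (s : seq I) (F : I -> R -> R) (m : I -> R) :
  (forall i, bmeas (F i)) -> (forall i, has_mean (F i) (m i)) ->
  has_mean (fun x => \sum_(i <- s) F i x) (\sum_(i <- s) m i).
Proof.
move=> bF hF; elim: s => [|i s IH].
  by rewrite big_nil; under eq_fun do rewrite big_nil; exact: has_mean_cst.
rewrite big_cons; under eq_fun do rewrite big_cons.
by apply: has_meanD => //; exact: bmeas_sum.
Qed.

Lemma le_has_mean f g m m' : bmeas f -> bmeas g -> (forall x, f x <= g x) ->
  has_mean f m -> has_mean g m' -> m <= m'.
Proof.
move=> bf bg fg hf hg; apply: (ler_cvg_to hf hg); near=> T.
by apply: le_mean => //; near: T; exact: nbhs_pinfty_gt.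
Unshelve. all: by end_near. Qed.

Lemma has_mean_bounded_integral f (C : R) :
  (forall T, 0 < T -> `|Rintegral lebesgue_measure `[- T, T] f| <= C) ->
  has_mean f 0.
Proof.
move=> hC; apply/cvgrPdist_le => e e0.
near=> T; rewrite sub0r normrN /mean normrM.
have T0 : 0 < T by near: T; exact: nbhs_pinfty_gt.
rewrite ger0_norm ?invr_ge0 ?mulr_ge0 ?(ltW T0) // ler_pdivrMl ?mulr_gt0 //.
apply: le_trans (hC _ T0) _.
have : C / e <= T by near: T; exact: nbhs_pinfty_ge (num_real _).
rewrite ler_pdivrMr // => h.
by apply: le_trans h _; rewrite ler_pM2r //; lra.
Unshelve. all: by end_near. Qed.

Lemma has_mean_cos (l : R) : has_mean (fun t => cos (l * t)) (l == 0)%:R.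
Proof.
have [->|l0] := eqVneq l 0.
  by under eq_fun do rewrite mul0r cos0; exact: has_mean_cst.
apply: (@has_mean_bounded_integral _ (2 / `|l|)) => T T0.
have dF (x : R) : is_derive x 1 (fun t => l^-1 * sin (l * t)) (cos (l * x)).
  have h1 : is_derive x 1 (fun t : R => l * t) l.
    by apply: is_derive_eq (is_deriveZ _ _) _; rewrite /GRing.scale /= mulr1.
  have h := is_deriveZ (l^-1) (is_derive1_comp (is_derive_sin (l * x)) h1).
  by apply: is_derive_eq h _; rewrite /GRing.scale /=; field.
have cf : continuous (fun t : R => cos (l * t)).
  move=> x; apply: continuous_comp; last exact: continuous_cos.
  by apply: cvgMr; exact: cvg_id.
have TT : - T < T by lra.
rewrite (Rintegral_FTC TT dF cf) -mulrBr normrM normfV mulrC ler_wpM2r ?invr_ge0 //.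
apply: le_trans (ler_normB _ _) _.
have h (x : R) : `|sin x| <= 1 by rewrite ler_norml sin_geN1 sin_le1.
by have := h (l * T); have := h (l * - T); lra.
Qed.

Lemma has_mean_sin (l : R) : has_mean (fun t => sin (l * t)) 0.
Proof.
have [->|l0] := eqVneq l 0.
  by under eq_fun do rewrite mul0r sin0; exact: has_mean_cst.
apply: (@has_mean_bounded_integral _ (2 / `|l|)) => T T0.
have dF (x : R) : is_derive x 1 (fun t => - l^-1 * cos (l * t)) (sin (l * x)).
  have h1 : is_derive x 1 (fun t : R => l * t) l.
    by apply: is_derive_eq (is_deriveZ _ _) _; rewrite /GRing.scale /= mulr1.
  have h := is_deriveZ (- l^-1) (is_derive1_comp (is_derive_cos (l * x)) h1).
  by apply: is_derive_eq h _; rewrite /GRing.scale /=; field.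
have cf : continuous (fun t : R => sin (l * t)).
  move=> x; apply: continuous_comp; last exact: continuous_sin.
  by apply: cvgMr; exact: cvg_id.
have TT : - T < T by lra.
rewrite (Rintegral_FTC TT dF cf) -mulrBr normrM normrN normfV mulrC ler_wpM2r ?invr_ge0 //.
apply: le_trans (ler_normB _ _) _.
have h (x : R) : `|cos x| <= 1 by rewrite ler_norml cos_geN1 cos_le1.
by have := h (l * T); have := h (l * - T); lra.
Qed.

Lemma bmeas_Re_cis (c : R[i]) (l : R) : bmeas (fun t => complex.Re (c * cis (l * t))).
Proof.
under eq_fun do rewrite Re_mul /=.
apply: bmeasB; apply: bmeasZ.
- by have := bmeas_cos l 0; under eq_fun do rewrite addr0.
- by have := bmeas_sin l 0; under eq_fun do rewrite addr0.
Qed.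

Lemma has_mean_Re_cis (c : R[i]) (l : R) :
  has_mean (fun t => complex.Re (c * cis (l * t))) (complex.Re c *+ (l == 0)).
Proof.
under eq_fun do rewrite Re_mul /= -mulNr.
have -> : complex.Re c *+ (l == 0) = complex.Re c * (l == 0)%:R + - complex.Im c * 0.
  by rewrite mulr0 addr0 mulr_natr.
have bc : bmeas (fun t => cos (l * t)).
  by have := bmeas_cos l 0; under eq_fun do rewrite addr0.
have bs : bmeas (fun t => sin (l * t)).
  by have := bmeas_sin l 0; under eq_fun do rewrite addr0.
apply: has_meanD; [exact: bmeasZ | exact: bmeasZ | |].
- by apply: has_meanZ => //; exact: has_mean_cos.
- by apply: has_meanZ => //; exact: has_mean_sin.
Qed.

Lemma has_mean_trig I (s : seq I) (c : I -> R[i]) (l : I -> R) :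
  has_mean (fun t => complex.Re (\sum_(i <- s) c i * cis (l i * t)))
           (\sum_(i <- s) complex.Re (c i) *+ (l i == 0)).
Proof.
under eq_fun do rewrite Re_sum.
apply: has_mean_sum => i; [exact: bmeas_Re_cis | exact: has_mean_Re_cis].
Qed.

(** Averages over a segment are stable under uniform perturbation, so they satisfy the Cauchy
    criterion. Treating a pair at once yields existence of the mean and equality of the two means
    together. *)
Lemma has_mean_approx f1 f2 : bmeas f1 -> bmeas f2 ->
  (forall e : R, 0 < e -> exists g1 g2 m, [/\ bmeas g1 /\ bmeas g2,
     has_mean g1 m, has_mean g2 m & forall x, `|f1 x - g1 x| <= e /\ `|f2 x - g2 x| <= e]) ->
  exists m, has_mean f1 m /\ has_mean f2 m.
Proof.
move=> b1 b2 happ.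
have key e : 0 < e -> exists m, \forall T \near +oo,
    `|m - mean f1 T| <= e /\ `|m - mean f2 T| <= e.
  move=> e0; have e2 : 0 < e / 2 by rewrite divr_gt0.
  have [g1 [g2 [m [[bg1 bg2] h1 h2 h]]]] := happ _ e2.
  exists m.
  move/cvgrPdist_le : h1 => /(_ _ e2) h1; move/cvgrPdist_le : h2 => /(_ _ e2) h2.
  have aux f g T : 0 < T -> bmeas f -> bmeas g -> (forall x, `|f x - g x| <= e / 2) ->
      `|m - mean g T| <= e / 2 -> `|m - mean f T| <= e.
    move=> T0 bf bg hfg hm.
    have : `|mean f T - mean g T| <= e / 2.
      rewrite ler_norml; apply/andP; split.
        rewrite lerBrDr -(mean_cst (- (e / 2)) T0) -meanD //; last exact: bmeas_cst.
        apply: le_mean => //; first by apply: bmeasD => //; exact: bmeas_cst.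
        by move=> x; have := hfg x; rewrite ler_norml => /andP[]; lra.
      rewrite lerBlDr -[X in _ <= X + _](mean_cst (e / 2) T0) -meanD //; last exact: bmeas_cst.
      apply: le_mean => //; first by apply: bmeasD => //; exact: bmeas_cst.
      by move=> x; have := hfg x; rewrite ler_norml => /andP[]; lra.
    move: hm; rewrite !ler_norml => /andP[h3 h4] /andP[h5 h6].
    by apply/andP; split; lra.
  near=> T; have T0 : 0 < T by near: T; exact: nbhs_pinfty_gt.
  by split; [apply: (aux f1 g1) | apply: (aux f2 g2)] => //;
    [move=> x; case: (h x) | near: T | move=> x; case: (h x) | near: T].
have /cvg_ex[m hm] : cvg (mean f1 T @[T --> +oo]).
  apply/cauchy_cvgP; apply/cauchy_exP => e e0.
  have e2 : 0 < e / 2 by rewrite divr_gt0.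
  have [m hm] := key _ e2; exists m; apply: filterS hm => T [h _].
  by rewrite /ball /=; apply: le_lt_trans h _; lra.
exists m; split => //; apply/cvgrPdist_le => e e0.
have e3 : 0 < e / 3 by rewrite divr_gt0.
have [m' hm'] := key _ e3.
move/cvgrPdist_le : hm => /(_ _ e3) hm.
near=> T.
have : `|m - mean f1 T| <= e / 3 by near: T.
have [] : `|m' - mean f1 T| <= e / 3 /\ `|m' - mean f2 T| <= e / 3 by near: T.
rewrite !ler_norml => /andP[? ?] /andP[? ?] /andP[? ?].
by apply/andP; split; lra.
Unshelve. all: by end_near. Qed.

End Mean.

(** * Means of powers from integral moments *)

Section PowerApproximation.
Variable R : realType.
Implicit Types (x y r e : R).

Lemma exists_small_mul_geom (C th e : R) : 0 <= C -> 0 <= th -> th < 1 -> 0 < e ->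
  exists K : nat, forall n, (K <= n)%N -> C * n%:R * th ^+ n <= e.
Proof.
(* With [th = q * q], one factor [q ^ n] tends to 0 and the other tames [n]: each of the [n] terms
   [q ^ i], [i < n], is at least [q ^ n], whence [n * q ^ n] is at most the geometric sum. *)
move=> C0 t0 t1 e0; pose q := Num.sqrt th.
have q0 : 0 <= q by exact: sqrtr_ge0.
have q1 : q < 1 by rewrite -sqrtr1 ltr_sqrt.
have tq : th = q * q by rewrite -expr2 sqr_sqrtr.
have hn n : n%:R * q ^+ n <= (1 - q)^-1.
  apply: le_trans (geom_le n q0 q1).
  rewrite mulr_natl -[X in _ *+ X]card_ord -sumr_const ler_sum // => i _.
  by rewrite ler_wiXn2l ?(ltW q1) // ltnW.
have hq : 0 < 1 - q by rewrite subr_gt0.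
pose d := e * (1 - q) / (C + 1).
have d0 : 0 < d by rewrite divr_gt0 ?mulr_gt0 // ltr_wpDl.
have /cvgrPdist_le/(_ _ d0)[K _ hK] : q ^+ n @[n --> \oo] --> 0.
  by apply: cvg_expr; rewrite ger0_norm.
exists K => m Km; have := hK m Km; rewrite sub0r normrN ger0_norm ?exprn_ge0 // => h.
rewrite tq exprMn -!mulrA.
apply: le_trans (_ : C * ((1 - q)^-1 * d) <= _).
  by rewrite ler_wpM2l // mulrA ler_pM // ?mulr_ge0 ?exprn_ge0.
have -> : C * ((1 - q)^-1 * d) = e * (C / (C + 1)).
  by rewrite /d; field; apply/andP; split; rewrite gt_eqF // ltr_wpDl.
by rewrite ler_piMr ?(ltW e0) // ler_pdivrMr ?mul1r ?ltr_wpDl // lerDl.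
Qed.

Lemma powR_addr_le x y r : 0 <= x -> 0 <= y -> 0 < r <= 1 ->
  (x + y) `^ r <= x `^ r + y `^ r.
Proof.
move=> x0 y0 /andP[r0 r1].
have [->|xn] := eqVneq x 0; first by rewrite add0r lerDr powR_ge0.
have [->|yn] := eqVneq y 0; first by rewrite addr0 lerDl powR_ge0.
have xp : 0 < x by rewrite lt_neqAle eq_sym xn.
have yp : 0 < y by rewrite lt_neqAle eq_sym yn.
have sp : 0 < x + y by rewrite addr_gt0.
have key z : 0 < z -> z <= x + y -> z / (x + y) * (x + y) `^ r <= z `^ r.
  move=> z0 zs.
  have -> : z `^ r = (z / (x + y)) `^ r * (x + y) `^ r.
    rewrite -powRM ?divr_ge0 ?(ltW z0) ?(ltW sp) // divfK // gt_eqF //.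
  rewrite ler_wpM2r ?powR_ge0 // ger1_powR // divr_gt0 //=.
  by rewrite ler_pdivrMr // mul1r.
apply: le_trans (lerD (key _ xp _) (key _ yp _)); rewrite ?lerDl ?lerDr ?(ltW xp) ?(ltW yp) //.
by rewrite -mulrDl -mulrDl divff ?mul1r // gt_eqF.
Qed.

Lemma powR_dist_le x y r : 0 <= x -> 0 <= y -> 0 < r <= 1 ->
  `|x `^ r - y `^ r| <= `|x - y| `^ r.
Proof.
move=> x0 y0 hr; wlog xy : x y x0 y0 / y <= x.
  move=> H; have [yx|/ltW xy] := leP y x; first exact: H.
  by rewrite distrC (distrC x); exact: H.
have r0 : 0 <= r by case/andP: hr => /ltW.
rewrite (ger0_norm (_ : 0 <= x - y)) ?subr_ge0 // ger0_norm; last first.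
  by rewrite subr_ge0 ge0_ler_powR // nnegrE.
rewrite lerBlDr; apply: le_trans (powR_addr_le _ y0 hr); rewrite ?subr_ge0 //.
by rewrite subrK.
Qed.

(** A constructive Weierstrass theorem for powers. Shifting [x] by [d] moves away from the
    singularity at 0; after division by [L = B + d] the variable [z] satisfies [|z - 1| <= th < 1],
    and the binomial series converges there. *)
Lemma powR_poly_approx (B r e : R) : 0 <= B -> 0 < r <= 1 -> 0 < e ->
  exists q : {poly R}, forall x, 0 <= x <= B -> `|x `^ r - q.[x]| <= e.
Proof.
move=> B0 hr e0; have [r0 r1] := andP hr.
have e2 : 0 < e / 2 by rewrite divr_gt0.
(* Chosen so that [d ^ r = e / 2], which bounds the change of [x ^ r] caused by the shift. *)
pose d := (e / 2) `^ r^-1.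
have d0 : 0 < d by rewrite powR_gt0.
have dr : d `^ r = e / 2 by rewrite /d -powRrM mulVf ?gt_eqF // powRr1 // ltW.
pose L := B + d; have L0 : 0 < L by rewrite ltr_wpDl.
pose th := B / L.
have th0 : 0 <= th by rewrite divr_ge0 // ltW.
have th1 : th < 1 by rewrite ltr_pdivrMr // mul1r ltrDl.
have C0 : 0 <= 4 * (1 - th) ^- 5 * L `^ r.
  by rewrite !mulr_ge0 ?powR_ge0 // invr_ge0 exprn_ge0 // subr_ge0 ltW.
have [K /(_ K.+1 (leqnSn K)) hK] := exists_small_mul_geom C0 th0 th1 e2.
(* Half of the exponent, because [binpoly_approx] controls the square of the polynomial. *)
pose g := r / 2.
have g1 : `|g| <= 1 by rewrite /g ger0_norm ?divr_ge0 ?(ltW r0) //; lra.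
pose lin : {poly R} := L^-1 *: 'X + (d / L - 1)%:P.
pose q0 : {poly R} := \sum_(k < K.+1) gbin g k *: lin ^+ k.
exists (L `^ r *: (q0 * q0)) => x /andP[x0 xB].
pose z := (x + d) / L.
have z0 : 0 < z by rewrite divr_gt0 // ltr_wpDl.
have z1 : z <= 1 by rewrite ler_pdivrMr // mul1r lerD2r.
have linE : lin.[x] = z - 1.
  by rewrite /lin hornerD hornerZ hornerX hornerC /z; ring.
have q0E : ((q0.[x])%:C)%C = binpoly g K ((z - 1)%:C)%C.
  rewrite /q0 horner_sum rmorph_sum /binpoly /=; apply: eq_bigr => k _.
  by rewrite hornerZ horner_exp linE rmorphM rmorphXn.
have wth : cabs ((z - 1)%:C)%C <= th.
  rewrite cabs_real ler0_norm ?subr_le0 // opprB /z /th.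
  have -> : 1 - (x + d) / L = (B - x) / L by rewrite -[1](@divff _ L) ?gt_eqF // -mulrBl /L; congr (_ / _); ring.
  by rewrite ler_wpM2r ?invr_ge0 ?(ltW L0) // gerBl.
have := binpoly_approx K g1 wth th1.
rewrite -q0E (cabs_real q0.[x]) real_normK ?num_real //.
have -> : 1 + (((z - 1)%:C)%C : R[i]) = (z%:C)%C by rewrite -(rmorph1 (real_complex R)) -rmorphD /=; congr (_ %:C)%C; ring.
rewrite cabs_real (ger0_norm (ltW z0)).
have -> : (z ^+ 2) `^ (- g) = (z `^ r)^-1.
  rewrite -powRN -powR_mulrn ?(ltW z0) // -powRrM; congr (_ `^ _); rewrite /g; lra.
move=> happ.
have zr0 : 0 < z `^ r by rewrite powR_gt0.
have zr1 : z `^ r <= 1.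
  by have := ge0_ler_powR (ltW r0) _ _ z1; rewrite powR1; apply; rewrite nnegrE ?(ltW z0).
have h1 : `|q0.[x] ^+ 2 - z `^ r| <= 4 * (1 - th) ^- 5 * K.+1%:R * th ^+ K.+1.
  have -> : q0.[x] ^+ 2 - z `^ r = (q0.[x] ^+ 2 / z `^ r - 1) * z `^ r.
    by rewrite mulrBl divfK ?gt_eqF // mul1r.
  rewrite normrM (gtr0_norm zr0) -[X in _ <= X]mulr1 ler_pM // ?(ltW zr0) //.
  apply: le_trans happ _; rewrite ler_wpM2l //.
    by rewrite !mulr_ge0 // invr_ge0 exprn_ge0 // subr_ge0 ltW.
  by rewrite lerXn2r ?nnegrE // cabs_ge0.
have h2 : `|(x + d) `^ r - L `^ r * (q0.[x] * q0.[x])| <= e / 2.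
  have -> : (x + d) `^ r = L `^ r * z `^ r.
    by rewrite -powRM ?(ltW L0) ?(ltW z0) // /z mulrC divfK // gt_eqF.
  rewrite -mulrBr -expr2 normrM ger0_norm ?powR_ge0 // distrC.
  apply: le_trans hK; apply: le_trans (ler_wpM2l (powR_ge0 _ _) h1) _.
  by rewrite le_eqVlt; apply/orP; left; apply/eqP; ring.
have h3 : `|x `^ r - (x + d) `^ r| <= e / 2.
  have := powR_dist_le x0 (_ : 0 <= x + d) hr; rewrite addr_ge0 ?(ltW d0) // => /(_ isT).
  by have -> : x - (x + d) = - d by [ring]; rewrite normrN (gtr0_norm d0) dr.
rewrite hornerZ hornerM.
move: h2 h3; rewrite !ler_norml => /andP[? ?] /andP[? ?]; apply/andP; split; lra.
Qed.

Lemma cvg_powR (F : set_system R) {FF : Filter F} (f : R -> R) (m r : R) : 0 < r <= 1 ->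
  0 <= m -> (\forall x \near F, 0 <= f x) -> f x @[x --> F] --> m ->
  f x `^ r @[x --> F] --> m `^ r.
Proof.
move=> hr m0 f0 /cvgrPdist_le hf; apply/cvgrPdist_le => e e0.
have [r0 _] := andP hr.
have d0 : 0 < e `^ r^-1 by rewrite powR_gt0.
apply: filterS2 f0 (hf _ d0) => x fx h.
apply: le_trans (powR_dist_le m0 fx hr) _.
have -> : e = (e `^ r^-1) `^ r by rewrite -powRrM mulVf ?gt_eqF // powRr1 // ltW.
by apply: ge0_ler_powR => //; rewrite ?nnegrE ?(ltW r0) ?(ltW d0).
Qed.

Lemma has_mean_horner (G : R -> R) (mom : nat -> R) (q : {poly R}) : bmeas G ->
  (forall j, has_mean (fun t => G t ^+ j) (mom j)) ->
  has_mean (fun t => q.[G t]) (\sum_(i < size q) q`_i * mom i).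
Proof.
move=> bG hG; under eq_fun do rewrite horner_coef.
apply: has_mean_sum => i; first by apply: bmeasZ; exact: bmeasX.
by apply: has_meanZ => //; exact: bmeasX.
Qed.

Lemma bmeas_horner (G : R -> R) (q : {poly R}) : bmeas G -> bmeas (fun t => q.[G t]).
Proof.
move=> bG; under eq_fun do rewrite horner_coef.
by apply: bmeas_sum => i; apply: bmeasZ; exact: bmeasX.
Qed.

(** Bounded functions with the same moments have the same means of polynomials, hence by uniform
    approximation the same mean of the power [r]. This is how a noninteger exponent is reached from
    algebraic identities. *)
Lemma has_mean_powR_moments (G1 G2 : R -> R) (B r : R) (mom : nat -> R) :
  0 < r <= 1 -> bmeas G1 -> bmeas G2 ->
  (forall t, 0 <= G1 t <= B) -> (forall t, 0 <= G2 t <= B) ->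
  (forall j, has_mean (fun t => G1 t ^+ j) (mom j)) ->
  (forall j, has_mean (fun t => G2 t ^+ j) (mom j)) ->
  exists m, has_mean (fun t => G1 t `^ r) m /\ has_mean (fun t => G2 t `^ r) m.
Proof.
move=> hr b1 b2 B1 B2 h1 h2; have [r0 _] := andP hr.
have g1 t : 0 <= G1 t by case/andP: (B1 t).
have g2 t : 0 <= G2 t by case/andP: (B2 t).
have B0 : 0 <= B by case/andP: (B1 0) => /le_trans h /h.
apply: has_mean_approx; [exact: bmeas_powR (ltW r0) _ _ | exact: bmeas_powR (ltW r0) _ _ |].
move=> e e0; have [q hq] := powR_poly_approx B0 hr e0.
exists (fun t => q.[G1 t]), (fun t => q.[G2 t]), (\sum_(i < size q) q`_i * mom i).
split; [by split; exact: bmeas_horner | exact: has_mean_horner | exact: has_mean_horner |].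
by move=> t; split; exact: hq.
Qed.

End PowerApproximation.

(** * The norm of a Dirichlet polynomial *)

Section DirichletMean.
Variable R : realType.
Implicit Types (P Q : dpoly R) (p t : R).

Lemma devalE P t :
  deval P 0 t = \sum_(i < P.1) P.2 i.+1 * cis (- (t * ln i.+1%:R)).
Proof.
rewrite /deval big_add1 /= big_mkord; apply: eq_bigr => i _.
by rewrite npow0E /dcoef /= ltn_ord.
Qed.

Let pairc P (ii : 'I_(P.1) * 'I_(P.1)) : R[i] := P.2 ii.1.+1 * conjc (P.2 ii.2.+1).
Let pairl P (ii : 'I_(P.1) * 'I_(P.1)) : R := ln ii.2.+1%:R - ln ii.1.+1%:R.

Let devalJ P t : deval P 0 t * conjc (deval P 0 t) =
  \sum_(ii : 'I_(P.1) * 'I_(P.1)) pairc ii * cis (pairl ii * t).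
Proof.
rewrite devalE conj_sum mulr_suml -(pair_bigA _ (fun i j => pairc (i, j) * cis (pairl (i, j) * t))) /=.
apply: eq_bigr => i _; rewrite mulr_sumr; apply: eq_bigr => j _.
rewrite conjM -cisN opprK mulrACA -cisD /pairc /pairl /=.
by congr (_ * cis _); ring.
Qed.

(** The mean of [|P| ^ (2 j)]: after expansion of the [j] factors [P * conj P], the function [f]
    picks one term in each, and only products of frequency zero survive averaging. *)
Definition dmoment P (j : nat) : R :=
  \sum_(f : {ffun 'I_j -> 'I_(P.1) * 'I_(P.1)})
     complex.Re (\prod_k pairc (f k)) *+ (\sum_k pairl (f k) == 0).

Lemma has_mean_dmoment P j :
  has_mean (fun t => (cabs (deval P 0 t) ^+ 2) ^+ j) (dmoment P j).
Proof.
have -> : (fun t => (cabs (deval P 0 t) ^+ 2) ^+ j) = (fun t => complex.Re (\sum_(f : {ffun 'I_j -> 'I_(P.1) * 'I_(P.1)})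
    (\prod_k pairc (f k)) * cis ((\sum_k pairl (f k)) * t))).
  apply/funext => t.
  have -> : (cabs (deval P 0 t) ^+ 2) ^+ j =
      complex.Re ((deval P 0 t * conjc (deval P 0 t)) ^+ j).
    by rewrite mul_conj_cabs -rmorphXn.
  congr complex.Re; rewrite devalJ.
  rewrite -[X in _ ^+ X](card_ord j) -prodr_const.
  rewrite bigA_distr_bigA /=; apply: eq_bigr => f _.
  by rewrite big_split /= mulr_suml cis_sum.
exact: has_mean_trig.
Qed.

Lemma bmeas_cabs_sqr P : bmeas (fun t => cabs (deval P 0 t) ^+ 2).
Proof.
have -> : (fun t => cabs (deval P 0 t) ^+ 2) =
    (fun t => \sum_(ii : 'I_(P.1) * 'I_(P.1)) complex.Re (pairc ii * cis (pairl ii * t))).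
  by apply/funext => t; rewrite -Re_sum -devalJ mul_conj_cabs.
by apply: bmeas_sum => ii; exact: bmeas_Re_cis.
Qed.

Lemma cabs_deval_le P t : cabs (deval P 0 t) <= \sum_(i < P.1) cabs (P.2 i.+1).
Proof.
rewrite devalE; apply: le_trans (cabs_sum _ _ _) _.
by apply: ler_sum => i _; rewrite cabsM cabs_cis mulr1.
Qed.

Lemma bmeas_cabs_powR p P : 0 <= p -> bmeas (fun t => cabs (deval P 0 t) `^ p).
Proof.
move=> p0; under eq_fun do rewrite cabs_powR.
apply: bmeas_powR; [by rewrite divr_ge0 | by move=> t; exact: sqr_ge0 |].
exact: bmeas_cabs_sqr.
Qed.

Definition twist P (chi : nat -> R[i]) : dpoly R := (P.1, fun n => P.2 n * chi n).

(** These are the points of the infinite torus in Bohr's correspondence: the values at the primes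
    can be prescribed independently. *)
Definition unimodular_char (chi : nat -> R[i]) :=
  [/\ chi 1 = 1, (forall m n, (0 < m)%N -> (0 < n)%N -> chi (m * n)%N = chi m * chi n) &
      forall n, cabs (chi n) = 1].

Lemma char_prod chi (I : finType) (F : I -> nat) : unimodular_char chi ->
  (forall i, (0 < F i)%N) -> chi (\prod_i F i)%N = \prod_i chi (F i).
Proof.
move=> [c1 cM _] F0.
suff : (0 < \prod_i F i)%N /\ chi (\prod_i F i)%N = \prod_i chi (F i) by case.
apply: (big_ind2 (fun (m : nat) (z : R[i]) => (0 < m)%N /\ chi m = z)) => //.
by move=> m z n w [m0 <-] [n0 <-]; rewrite muln_gt0 m0 n0 cM.
Qed.

Lemma ln_prod_nat (I : finType) (F : I -> nat) : (forall i, (0 < F i)%N) ->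
  ln ((\prod_i F i)%N%:R) = \sum_i ln (F i)%:R :> R.
Proof.
move=> F0.
suff : (0 < \prod_i F i)%N /\ ln ((\prod_i F i)%N%:R) = \sum_i ln (F i)%:R :> R by case.
apply: (big_ind2 (fun (m : nat) (z : R) => (0 < m)%N /\ ln m%:R = z)) => //.
  by rewrite ln1.
by move=> m z n w [m0 <-] [n0 <-]; rewrite muln_gt0 m0 n0 lnM_nat.
Qed.

Lemma ln_nat_inj (m n : nat) : (0 < m)%N -> (0 < n)%N ->
  ln m%:R = ln n%:R :> R -> m = n.
Proof.
move=> m0 n0 /ln_inj h; apply/eqP; rewrite -(@eqr_nat R).
by apply/eqP/h; rewrite posrE ltr0n.
Qed.

(** A term of frequency zero has equal products of its first and of its second indices, since [ln]
    is injective on positive integers. By multiplicativity the values of [chi] then combine to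
    [|chi n| ^ 2 = 1]. *)
Lemma dmoment_twist P chi j : unimodular_char chi ->
  dmoment (twist P chi) j = dmoment P j.
Proof.
move=> hchi; have [_ _ chi1] := hchi.
rewrite /dmoment; apply: eq_bigr => /= f _.
have [/= E|] := eqVneq (\sum_k pairl (f k)) 0; last by rewrite !mulr0n.
rewrite !mulr1n; congr complex.Re.
have -> : \prod_(k < j) @pairc (twist P chi) (f k) =
   (\prod_k pairc (f k)) * ((\prod_k chi (f k).1.+1) * conjc (\prod_k chi (f k).2.+1)).
  rewrite rmorph_prod -!big_split /=; apply: eq_bigr => k _.
  by rewrite /pairc /twist /= rmorphM; ring.
rewrite -!char_prod //.
have -> : (\prod_k (f k).2.+1 = \prod_k (f k).1.+1)%N.
  apply: ln_nat_inj; rewrite ?prodn_gt0 // !ln_prod_nat //.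
  by apply/eqP; rewrite -subr_eq0 -sumrB; apply/eqP.
by rewrite mul_conj_cabs chi1 expr1n rmorph1 mulr1.
Qed.

Definition Hp_mean p P : R := lim (mean (fun t => cabs (deval P 0 t) `^ p) T @[T --> +oo]).

Lemma Hp_mean_exists p P chi : 0 < p <= 2 -> unimodular_char chi ->
  exists m, has_mean (fun t => cabs (deval P 0 t) `^ p) m /\
            has_mean (fun t => cabs (deval (twist P chi) 0 t) `^ p) m.
Proof.
move=> /andP[p0 p2] hchi.
have hr : 0 < p / 2 <= 1 by apply/andP; split; lra.
pose B := (\sum_(i < P.1) cabs (P.2 i.+1)) ^+ 2.
have hB (Q : dpoly R) t : \sum_(i < Q.1) cabs (Q.2 i.+1) = \sum_(i < P.1) cabs (P.2 i.+1) ->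
    0 <= cabs (deval Q 0 t) ^+ 2 <= B.
  move=> hQ; rewrite sqr_ge0 /= lerXn2r ?nnegrE ?cabs_ge0 //.
    by apply: sumr_ge0 => i _; exact: cabs_ge0.
  by rewrite -hQ; exact: cabs_deval_le.
have hE : \sum_(i < (twist P chi).1) cabs ((twist P chi).2 i.+1) = \sum_(i < P.1) cabs (P.2 i.+1).
  by apply: eq_bigr => i _ /=; case: hchi => _ _ h; rewrite cabsM h mulr1.
have hm j : has_mean (fun t => (cabs (deval (twist P chi) 0 t) ^+ 2) ^+ j) (dmoment P j).
  by rewrite -(dmoment_twist P j hchi); exact: has_mean_dmoment.
have [m [h1 h2]] := has_mean_powR_moments hr (bmeas_cabs_sqr P) (bmeas_cabs_sqr (twist P chi))
   (fun t => hB P t erefl) (fun t => hB (twist P chi) t hE) (@has_mean_dmoment P) hm.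
exists m; split.
  by move: h1; under eq_fun do rewrite -cabs_powR.
by move: h2; under eq_fun do rewrite -cabs_powR.
Qed.

Lemma Hp_meanP p P : 0 < p <= 2 ->
  has_mean (fun t => cabs (deval P 0 t) `^ p) (Hp_mean p P).
Proof.
move=> hp; have triv : unimodular_char (fun=> 1).
  by split=> // *; rewrite ?mulr1 ?cabs1.
have [m [h _]] := Hp_mean_exists P hp triv.
by rewrite /Hp_mean (cvg_lim _ h).
Qed.

Lemma Hp_mean_twist p P chi : 0 < p <= 2 -> unimodular_char chi ->
  Hp_mean p (twist P chi) = Hp_mean p P.
Proof.
move=> hp hchi; have [m [h1 h2]] := Hp_mean_exists P hp hchi.
by rewrite (has_mean_unique (@Hp_meanP p P hp) h1) (has_mean_unique (@Hp_meanP p _ hp) h2).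
Qed.

Lemma Hp_mean_ge0 p P : 0 < p <= 2 -> 0 <= Hp_mean p P.
Proof.
move=> hp; have [p0 _] := andP hp.
apply: (@le_has_mean R (fun=> 0) (fun t => cabs (deval P 0 t) `^ p));
  [exact: bmeas_cst | exact: bmeas_cabs_powR (ltW p0) | | exact: has_mean_cst | exact: Hp_meanP].
by move=> t; exact: powR_ge0.
Qed.

Lemma Hp_norm_polyP p P : 1 <= p <= 2 ->
  dmean p P T `^ p^-1 @[T --> +oo] --> Hp_mean p P `^ p^-1.
Proof.
move=> /andP[p1 p2]; have p0 : 0 < p by lra.
have hp : 0 < p <= 2 by rewrite p0.
apply: cvg_powR.
- by rewrite invr_gt0 p0 invf_le1.
- exact: Hp_mean_ge0.
- near=> T; have T0 : 0 < T by near: T; exact: nbhs_pinfty_gt.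
  rewrite /dmean mulr_ge0 ?invr_ge0 ?mulr_ge0 ?(ltW T0) //.
  by apply: Rintegral_ge0 => t _; exact: powR_ge0.
- exact: Hp_meanP.
Unshelve. all: by end_near. Qed.

Lemma Hp_norm_polyE p P : 1 <= p <= 2 -> Hp_norm_poly p P = Hp_mean p P `^ p^-1.
Proof. by move=> hp; apply: cvg_lim => //; exact: Hp_norm_polyP. Qed.

Lemma Hp_norm_poly_ge0 p P : 1 <= p <= 2 -> 0 <= Hp_norm_poly p P.
Proof. by move=> hp; rewrite Hp_norm_polyE // powR_ge0. Qed.

Lemma Hp_norm_poly_powR p P : 1 <= p <= 2 -> Hp_norm_poly p P `^ p = Hp_mean p P.
Proof.
move=> hp; have [p1 p2] := andP hp; have p0 : 0 < p by lra.
by rewrite Hp_norm_polyE // -powRrM mulVf ?gt_eqF // powRr1 // Hp_mean_ge0 // p0.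
Qed.

Lemma deval_widen P t N : (P.1 <= N)%N ->
  deval P 0 t = \sum_(1 <= n < N.+1) dcoef P n * npow_s n 0 t.
Proof.
move=> PN; rewrite [RHS](big_cat_nat _ (n := P.1.+1)) //=.
rewrite [X in _ + X]big_nat_cond [X in _ + X]big1 ?addr0 // => n.
by rewrite andbT => /andP[Pn _]; rewrite /dcoef andbC leqNgt Pn mul0r.
Qed.

Lemma deval_dsub P Q t : deval (dsub P Q) 0 t = deval P 0 t - deval Q 0 t.
Proof.
rewrite (@deval_widen P t (maxn P.1 Q.1)) ?leq_maxl //.
rewrite (@deval_widen Q t (maxn P.1 Q.1)) ?leq_maxr //.
rewrite /deval /dsub -sumrB /= !big_nat; apply: eq_bigr => n /andP[n0 nN].
by rewrite {1}/dcoef /= n0 -ltnS nN -mulrBl.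
Qed.

(** Convexity of the power [p] at the points [u / (1 - th)] and [v / th]. The right side is linear
    in [u ^ p] and [v ^ p], so it can be averaged with [th] fixed; optimizing in [th] afterwards
    gives Minkowski's inequality. *)
Lemma powRD_convex (u v th p : R) : 1 <= p -> 0 <= u -> 0 <= v -> 0 < th < 1 ->
  (u + v) `^ p <= (1 - th) `^ (1 - p) * u `^ p + th `^ (1 - p) * v `^ p.
Proof.
move=> p1 u0 v0 /andP[t0 t1].
have s0 : 0 < 1 - th by rewrite subr_gt0.
have key x y : 0 < x -> 0 <= y -> x `^ (1 - p) * y `^ p = x * (y / x) `^ p.
  move=> x0 y0; rewrite powRM ?invr_ge0 ?(ltW x0) // -powR_inv1 ?(ltW x0) // -powRrM mulN1r.
  rewrite -{2}[x]powRr1 ?(ltW x0) // powRD ?(gt_eqF x0) ?implybT //.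
  by rewrite [RHS]mulrCA [RHS]mulrC; ring.
rewrite !key //.
have h : (th * (v / th) + (1 - th) * (u / (1 - th))) `^ p <=
    th * (v / th) `^ p + (1 - th) * (u / (1 - th)) `^ p.
  apply: (convex_powR p1 (Itv01 (ltW t0) (ltW t1)));
    by rewrite inE /= in_itv /= andbT divr_ge0 // ltW.
have E1 : th * (v / th) = v by rewrite mulrC divfK // gt_eqF.
have E2 : (1 - th) * (u / (1 - th)) = u by rewrite mulrC divfK // gt_eqF.
by rewrite E1 E2 [v + u]addrC in h; rewrite [X in _ <= X]addrC.
Qed.

Lemma le_powR_add_of_split (M a b p e : R) : 1 <= p -> 0 <= a -> 0 <= b -> 0 < e ->
  (forall th, 0 < th < 1 -> M <= (1 - th) `^ (1 - p) * a `^ p + th `^ (1 - p) * b `^ p) ->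
  M <= (a + b + e) `^ p.
Proof.
move=> p1 a0 b0 e0 h.
have p0 : 0 <= p by lra.
(* Adding [e / 2] to each summand makes both positive, so that the optimal value [Y / (X + Y)] lies
   strictly between 0 and 1 even if [a] or [b] vanishes. *)
have [X [Xa X0 [Y [Yb Y0 XY]]]] : exists X, [/\ a <= X, 0 < X &
    exists Y, [/\ b <= Y, 0 < Y & a + b + e = X + Y]].
  by exists (a + e / 2); split; [lra | lra | exists (b + e / 2); split; lra].
have S0 : 0 < X + Y by exact: addr_gt0.
have key x : 0 < x -> (x / (X + Y)) `^ (1 - p) * x `^ p = x * (X + Y) `^ (p - 1).
  move=> x0; rewrite powRM ?invr_ge0 ?(ltW x0) ?(ltW S0) //.
  rewrite -powR_inv1 ?(ltW S0) // -powRrM mulN1r opprB mulrAC; congr (_ * _).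
  by rewrite -powRD ?(gt_eqF x0) ?implybT // subrK powRr1 // ltW.
have th0 : 0 < Y / (X + Y) by exact: divr_gt0.
have th1 : Y / (X + Y) < 1 by rewrite ltr_pdivrMr // mul1r ltrDr.
have thE : 1 - Y / (X + Y) = X / (X + Y) by field; rewrite gt_eqF.
have th01 : 0 < Y / (X + Y) < 1 by rewrite th0.
have hX : a `^ p <= X `^ p by rewrite ge0_ler_powR ?nnegrE // ltW.
have hY : b `^ p <= Y `^ p by rewrite ge0_ler_powR ?nnegrE // ltW.
apply: le_trans (h _ th01) _.
apply: le_trans (lerD (ler_wpM2l (powR_ge0 _ _) hX) (ler_wpM2l (powR_ge0 _ _) hY)) _.
rewrite thE (key X X0) (key Y Y0) -mulrDl XY -{1}[X + Y]powRr1 ?(ltW S0) //.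
by rewrite -powRD ?(gt_eqF S0) ?implybT // [1 + _]addrC subrK.
Qed.

Lemma Hp_norm_triangle p P Q : 1 <= p <= 2 ->
  Hp_norm_poly p P <= Hp_norm_poly p Q + Hp_norm_poly p (dsub P Q).
Proof.
move=> hp; have [p1 p2] := andP hp; have p0 : 0 < p by lra.
have hp0 : 0 < p <= 2 by rewrite p0.
apply/ler_addgt0Pr => e e0.
have a0 := Hp_norm_poly_ge0 Q hp; have b0 := Hp_norm_poly_ge0 (dsub P Q) hp.
have bP := bmeas_cabs_powR P (ltW p0).
have bQ := bmeas_cabs_powR Q (ltW p0).
have bD := bmeas_cabs_powR (dsub P Q) (ltW p0).
rewrite (Hp_norm_polyE P hp).
move: (Hp_norm_poly p Q) (Hp_norm_poly_powR Q hp) a0 => a aE a0.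
move: (Hp_norm_poly p (dsub P Q)) (Hp_norm_poly_powR (dsub P Q) hp) b0 => b bE b0.
have hS : Hp_mean p P <= (a + b + e) `^ p.
  apply: le_powR_add_of_split => // th hth; rewrite aE bE.
  set c1 := (1 - th) `^ (1 - p); set c2 := th `^ (1 - p).
  have bS : bmeas (fun t => c1 * cabs (deval Q 0 t) `^ p + c2 * cabs (deval (dsub P Q) 0 t) `^ p).
    by apply: bmeasD; exact: bmeasZ.
  have mS : has_mean (fun t => c1 * cabs (deval Q 0 t) `^ p + c2 * cabs (deval (dsub P Q) 0 t) `^ p)
      (c1 * Hp_mean p Q + c2 * Hp_mean p (dsub P Q)).
    by apply: has_meanD; [exact: bmeasZ | exact: bmeasZ | |];
      apply: has_meanZ => //; exact: Hp_meanP.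
  apply: (le_has_mean bP bS _ (@Hp_meanP p P hp0) mS).
  move=> t; apply: le_trans (powRD_convex p1 (cabs_ge0 _) (cabs_ge0 _) hth).
  rewrite deval_dsub ge0_ler_powR ?nnegrE ?addr_ge0 ?cabs_ge0 ?(ltW p0) //.
  by apply: le_trans (cabsD _ _); rewrite addrC subrK.
have S0 : 0 <= a + b + e by rewrite !addr_ge0 // ltW.
rewrite -[a + b + e]powRr1 // -(mulfV (negbT (gt_eqF p0))) powRrM.
by apply: ge0_ler_powR; rewrite ?nnegrE ?invr_ge0 ?(ltW p0) ?Hp_mean_ge0 ?powR_ge0.
Qed.

Lemma Hp_norm_limP p (Ps : nat -> dpoly R) : 1 <= p <= 2 -> Hp_cauchy p Ps ->
  Hp_norm_poly p (Ps k) @[k --> \oo] --> Hp_norm_lim p Ps.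
Proof.
move=> hp hc; suff : cvg (Hp_norm_poly p (Ps k) @[k --> \oo]) by [].
apply/cauchy_cvgP; apply/cauchy_exP => e e0.
have [K hK] := hc _ e0.
exists (Hp_norm_poly p (Ps K)); exists K => // k /= Kk.
have aux (x y d d' : R) : x <= y + d -> y <= x + d' -> d < e -> d' < e -> `|x - y| < e.
  by move=> h1 h2 h3 h4; rewrite ltr_norml; apply/andP; split; lra.
exact: (aux _ _ _ _ (Hp_norm_triangle (Ps K) (Ps k) hp) (Hp_norm_triangle (Ps k) (Ps K) hp)
   (hK K k (leqnn K) Kk) (hK k K Kk (leqnn K))).
Qed.

End DirichletMean.

(** * The coefficient inequality *)

Section OneVariable.
Variable R : realType.

Lemma powR_le_affine (x t : R) : 0 <= x -> 0 <= t <= 1 -> x `^ t <= t * x + (1 - t).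
Proof.
move=> x0 /andP[t0 t1]; have [->|xn] := eqVneq x 0.
  have [->|tn] := eqVneq t 0; first by rewrite powRr0; lra.
  by rewrite powR0 // mulr0 add0r subr_ge0.
have xp : 0 < x by rewrite lt_neqAle eq_sym xn.
have xE : x = expR (ln x) by rewrite lnK.
have -> : x `^ t = expR (t * ln x) by rewrite /powR (negbTE xn).
set l := ln x in xE *; rewrite {1}xE.
have h1 := expR_ge1Dx ((1 - t) * l); have h2 := expR_ge1Dx (- (t * l)).
have v0 := expR_gt0 (t * l).
have E1 : expR l = expR ((1 - t) * l) * expR (t * l) by rewrite -expRD; congr expR; ring.
have E2 : 1 = expR (- (t * l)) * expR (t * l) by rewrite -expRD addNr expR0.
have -> : t * expR l + (1 - t) = (t * expR ((1 - t) * l) + (1 - t) * expR (- (t * l))) * expR (t * l).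
  by rewrite mulrDl -mulrA -E1 -mulrA -E2 mulr1.
rewrite -[X in X <= _]mul1r ler_pM2r //.
have : t * (1 + (1 - t) * l) + (1 - t) * (1 + - (t * l)) <=
   t * expR ((1 - t) * l) + (1 - t) * expR (- (t * l)).
  by rewrite lerD // ler_wpM2l // subr_ge0.
by apply: le_trans; rewrite le_eqVlt; apply/orP; left; apply/eqP; ring.
Qed.

Lemma powR_amgm (a b t : R) : 0 <= a -> 0 < b -> 0 <= t <= 1 ->
  a `^ t * b `^ (1 - t) <= t * a + (1 - t) * b.
Proof.
move=> a0 b0 ht.
have -> : a `^ t * b `^ (1 - t) = b * (a / b) `^ t.
  rewrite powRM ?invr_ge0 ?(ltW b0) // -powR_inv1 ?(ltW b0) // -powRrM mulN1r.
  rewrite powRD ?(gt_eqF b0) ?implybT // powRr1 ?(ltW b0) //; ring.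
have := powR_le_affine (divr_ge0 a0 (ltW b0)) ht.
rewrite -(ler_pM2l b0) => h; apply: le_trans h _.
by rewrite le_eqVlt; apply/orP; left; apply/eqP; field; rewrite gt_eqF.
Qed.

Lemma holder_sum (I : finType) (X Y : I -> R) (t : R) : 0 < t <= 1 ->
  (forall i, 0 <= X i) -> (forall i, 0 <= Y i) -> 0 < \sum_i Y i ->
  \sum_i X i `^ t * Y i `^ (1 - t) <= (\sum_i X i) `^ t * (\sum_i Y i) `^ (1 - t).
Proof.
move=> /andP[t0 t1] X0 Y0 B0; set A := \sum_i X i; set B := \sum_i Y i in B0 *.
have A0 : 0 <= A by apply: sumr_ge0.
have [AE|An] := eqVneq A 0.
  rewrite [X in X <= _]big1 ?mulr_ge0 ?powR_ge0 // => i _.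
  have -> : X i = 0 by apply/eqP; move/eqP: AE; rewrite psumr_eq0 // => /allP/(_ i); apply; rewrite mem_index_enum.
  by rewrite powR0 ?mul0r // gt_eqF.
have Ap : 0 < A by rewrite lt_neqAle eq_sym An.
have ht : 0 <= 1 - t <= 1 by lra.
have key i : X i `^ t * Y i `^ (1 - t) <=
    A `^ t * B `^ (1 - t) * (t * (X i / A) + (1 - t) * (Y i / B)).
  have -> : X i `^ t * Y i `^ (1 - t) =
      A `^ t * B `^ (1 - t) * ((X i / A) `^ t * (Y i / B) `^ (1 - t)).
    rewrite mulrACA -!powRM ?divr_ge0 ?(ltW Ap) ?(ltW B0) //.
    by rewrite ![_ * (_ / _)]mulrC !divfK ?gt_eqF.
  rewrite ler_wpM2l ?mulr_ge0 ?powR_ge0 //.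
  have [yE|yn] := eqVneq (Y i) 0; last first.
    apply: powR_amgm; rewrite ?divr_ge0 ?(ltW Ap) ?(ltW t0) //.
    by rewrite divr_gt0 // lt_neqAle eq_sym yn Y0.
  (* The case [t = 1] is separate because the power of 0 with exponent [1 - t = 0] is 1. *)
  rewrite yE mul0r mulr0 addr0; have [->|tn] := eqVneq t 1.
    by rewrite subrr powRr0 mulr1 powRr1 ?mul1r // divr_ge0 // ltW.
  rewrite [0 `^ _]powR0 ?subr_eq0 1?eq_sym // mulr0.
  by rewrite mulr_ge0 ?divr_ge0 ?(ltW Ap) ?(ltW t0).
apply: le_trans (ler_sum _ (fun i _ => key i)) _.
rewrite -mulr_sumr big_split /= -!mulr_sumr -!mulr_suml !divff ?gt_eqF //.
by rewrite !mulr1 addrC subrK mulr1.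
Qed.

(** The points of order [M] on the unit circle. Averages over them replace integrals over the circle
    and are exact on polynomials of degree below [M], which keeps the one-variable argument
    finite. *)
Definition uroot (M j : nat) : R[i] := cis (2 * pi * j%:R / M%:R).

Arguments uroot : simpl never.

Lemma cabs_uroot M j : cabs (uroot M j) = 1.
Proof. exact: cabs_cis. Qed.

Lemma cis_eq1_lt (x : R) : 0 < x < 2 * pi -> cis x <> 1.
Proof.
move=> /andP[x0 x1] /(congr1 (@complex.Re R)) /=.
have -> : x = x / 2 + x / 2 by lra.
rewrite cosD => h; have := cos2Dsin2 (x / 2).
have sp : 0 < sin (x / 2) by apply: sin_gt0_pi; apply/andP; split; lra.
have : 0 < sin (x / 2) * sin (x / 2) by rewrite mulr_gt0.
rewrite !expr2; lra.
Qed.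

Lemma cis2pi : cis (2 * pi) = 1 :> R[i].
Proof.
have cp : cis pi = -1 :> R[i].
  by rewrite /cis cospi sinpi; apply/eqP; rewrite eq_complex /= oppr0 !eqxx.
by rewrite mulr_natl mulr2n cisD cp mulrNN mulr1.
Qed.

Lemma sum_uroot_pow (M a b : nat) : (a < M)%N -> (b < M)%N ->
  \sum_(j < M) uroot M j ^+ a * conjc (uroot M j) ^+ b = (M%:R : R[i]) *+ (a == b).
Proof.
move=> aM bM; have M0 : (0 < M)%N by exact: leq_ltn_trans aM.
have M0R : 0 < M%:R :> R by rewrite ltr0n.
pose x : R := 2 * pi * (a%:R - b%:R) / M%:R.
have E j : uroot M j ^+ a * conjc (uroot M j) ^+ b = cis x ^+ j.
  rewrite /uroot -cisN !cisX -cisD; congr cis; rewrite /x; field.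
  by rewrite gt_eqF.
under eq_bigr do rewrite E.
have [ab|ab] := eqVneq a b.
  rewrite /x ab subrr mulr0 mul0r cis0; under eq_bigr do rewrite expr1n.
  by rewrite sumr_const card_ord.
rewrite mulr0n.
have x1 : cis x <> 1.
  have pi0 := pi_gt0 R.
  wlog lab : a b aM bM @x E ab / (b < a)%N.
    move=> H; have [h|h] := ltnP b a; first exact: (H a b).
    have h' : (a < b)%N by rewrite ltn_neqAle ab.
    have Hx : 2 * pi * (b%:R - a%:R) / M%:R = - x by rewrite /x; ring.
    have := H b a bM aM _ _ h'; rewrite Hx cisN => H1 H2; apply: H1.
    - by move=> j; rewrite -[conjc (cis x) ^+ j]conjX -E conjM !conjX conjcK mulrC.
    - by rewrite eq_sym.
    - by rewrite H2 rmorph1.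
  apply: cis_eq1_lt; rewrite /x -natrB ?(ltnW lab) //; apply/andP; split.
    by rewrite divr_gt0 ?mulr_gt0 // ltr0n subn_gt0.
  rewrite ltr_pdivrMr // ltr_pM2l ?mulr_gt0 // ltr_nat.
  by rewrite (leq_ltn_trans (leq_subr _ _)).
have xM : cis x ^+ M = 1.
  rewrite cisX (_ : M%:R * x = a%:R * (2 * pi) - b%:R * (2 * pi)); last first.
    by rewrite /x; field; rewrite gt_eqF.
  rewrite cisD cisN -[cis (a%:R * _)]cisX -[cis (b%:R * _)]cisX.
  by rewrite cis2pi !expr1n rmorph1 mulr1.
have := subrX1 (cis x) M; rewrite xM subrr => /esym/eqP.
rewrite mulf_eq0 subr_eq0 => /orP[/eqP //|/eqP]; exact.
Qed.

Lemma sum_uroot_horner (h : {poly R[i]}) (M b : nat) : (size h <= M)%N -> (b < M)%N ->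
  \sum_(j < M) h.[uroot M j] * conjc (uroot M j) ^+ b = M%:R * h`_b.
Proof.
move=> hM bM.
under eq_bigr => j _ do rewrite (horner_coef_wide _ hM) mulr_suml.
rewrite exchange_big (bigD1 (Ordinal bM)) //= [X in _ + X]big1 ?addr0 => [|i ib].
  under eq_bigr do rewrite -mulrA.
  by rewrite -mulr_sumr sum_uroot_pow // eqxx mulr1n mulrC.
under eq_bigr do rewrite -mulrA.
rewrite -mulr_sumr sum_uroot_pow // (_ : (i : nat) == b = false) ?mulr0 //.
by apply/negbTE; apply: contra ib => /eqP E; apply/eqP/val_inj.
Qed.

Definition uavg (M : nat) (F : nat -> R) : R := M%:R^-1 * \sum_(j < M) F j.

(** Duality between the exponent [2 / s] and its conjugate [2 / (2 - s)]: a test function of modulus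
    at most about [|u| ^ (2 - s)] has its dual norm controlled by the quadratic mean of [u], which
    is computable. *)
Lemma holder_uroot (M : nat) (s : R) (f v u : nat -> R[i]) (E D : R) : (0 < M)%N ->
  1 <= s <= 2 -> 0 <= E -> 0 < D ->
  (forall j, cabs (v j) ^+ 2 <= (1 + E) * (cabs (u j) ^+ 2) `^ (2 - s)) ->
  \sum_(j < M) cabs (u j) ^+ 2 = M%:R * D ->
  (cabs (\sum_(j < M) f j * v j) / M%:R) ^+ 2 <=
    (1 + E) * (uavg M (fun j => cabs (f j) `^ (2 / s))) `^ s * D `^ (2 - s).
Proof.
move=> M0 /andP[s1 s2] E0 D0 hv hD.
have MR : 0 < M%:R :> R by rewrite ltr0n.
have s0 : 0 < s by lra.
have hE : 0 <= 1 + E by rewrite addr_ge0.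
pose X j := cabs (f j) `^ (2 / s); pose Y j := cabs (u j) ^+ 2.
have ht : 0 < s / 2 <= 1 by apply/andP; split; lra.
have hY : \sum_(j < M) Y j = M%:R * D by [].
have h1 : cabs (\sum_(j < M) f j * v j) <=
    Num.sqrt (1 + E) * \sum_(j < M) X j `^ (s / 2) * Y j `^ (1 - s / 2).
  apply: le_trans (cabs_sum _ _ _) _; rewrite mulr_sumr; apply: ler_sum => j _.
  rewrite cabsM /X -powRrM (_ : 2 / s * (s / 2) = 1); last by field; rewrite gt_eqF.
  rewrite powRr1 ?cabs_ge0 // mulrCA ler_wpM2l ?cabs_ge0 //.
  rewrite -(@ler_pXn2r _ 2) ?nnegrE ?cabs_ge0 ?mulr_ge0 ?sqrtr_ge0 ?powR_ge0 //.
  rewrite exprMn (sqr_sqrtr hE); apply: le_trans (hv j) _.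
  rewrite -[(_ `^ (1 - _)) ^+ 2]powR_mulrn ?powR_ge0 // -powRrM.
  by rewrite (_ : (1 - s / 2) * 2%:R = 2 - s) //; field.
have h2 : \sum_(j < M) X j `^ (s / 2) * Y j `^ (1 - s / 2) <=
    (\sum_(j < M) X j) `^ (s / 2) * (M%:R * D) `^ (1 - s / 2).
  rewrite -hY; apply: holder_sum => // [j|j|]; [exact: powR_ge0 | exact: sqr_ge0 |].
  by rewrite hY mulr_gt0.
have h3 : cabs (\sum_(j < M) f j * v j) / M%:R <=
    Num.sqrt (1 + E) * (uavg M X `^ (s / 2) * D `^ (1 - s / 2)).
  rewrite ler_pdivrMr //; apply: le_trans h1 _; rewrite -!mulrA ler_wpM2l ?sqrtr_ge0 //.
  apply: le_trans h2 _; rewrite powRM ?(ltW MR) ?(ltW D0) // /uavg powRM ?invr_ge0 ?(ltW MR) //; last first.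
    by apply: sumr_ge0 => j _; exact: powR_ge0.
  have -> : M%:R^-1 `^ (s / 2) = M%:R `^ (- (s / 2)).
    by rewrite -powR_inv1 ?(ltW MR) // -powRrM mulN1r.
  rewrite le_eqVlt; apply/orP; left; apply/eqP.
  set a := (\sum_(j < M) X j) `^ _; set b := D `^ _.
  transitivity (a * b * M%:R `^ (1 - s / 2)); first by ring.
  transitivity (a * b * (M%:R `^ (- (s / 2)) * M%:R `^ 1)).
    by rewrite -powRD ?(gt_eqF MR) ?implybT // [- _ + _]addrC.
  by rewrite powRr1 ?(ltW MR) //; ring.
have U0 : 0 <= uavg M X.
  by rewrite /uavg mulr_ge0 ?invr_ge0 ?(ltW MR) // sumr_ge0 // => j _; exact: powR_ge0.
apply: le_trans (_ : (Num.sqrt (1 + E) * (uavg M X `^ (s / 2) * D `^ (1 - s / 2))) ^+ 2 <= _).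
  by rewrite lerXn2r ?nnegrE ?divr_ge0 ?cabs_ge0 ?(ltW MR) // ?mulr_ge0 ?sqrtr_ge0 ?powR_ge0.
rewrite !exprMn (sqr_sqrtr hE) -mulrA.
rewrite -[(_ `^ (s / 2)) ^+ 2]powR_mulrn ?powR_ge0 // -[(_ `^ (1 - _)) ^+ 2]powR_mulrn ?powR_ge0 //.
rewrite -!powRrM (_ : s / 2 * 2%:R = s); last by field.
by rewrite (_ : (1 - s / 2) * 2%:R = 2 - s) //; field.
Qed.

Lemma exists_phase (z : R[i]) : exists e : R[i], cabs e = 1 /\ z = (cabs z)%:C%C * e.
Proof.
have [->|zn] := eqVneq z 0; first by exists 1; rewrite cabs0 cabs1 mul0r.
have zc : cabs z != 0 by apply: contra zn => /eqP/cabs_eq0 ->.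
have zC : (cabs z)%:C%C != 0 :> R[i] by rewrite eq_complex /= negb_and zc.
exists (z / (cabs z)%:C%C); split; last by rewrite mulrC divfK.
by rewrite cabsM -fmorphV cabs_real normfV ger0_norm ?cabs_ge0 // divff.
Qed.

End OneVariable.

(** * Two coefficients of a polynomial in one variable *)

Section OneVariableInequality.
Variable R : realType.
Implicit Types (s th : R) (f : {poly R[i]}) (x : R[i]).

Definition bingap (th : R) (K : nat) : R := 4 * (1 - th) ^- 5 * K.+1%:R * th ^+ K.+1.

Lemma bingap_ge0 th K : 0 <= th -> th < 1 -> 0 <= bingap th K.
Proof.
move=> t0 t1; rewrite /bingap !mulr_ge0 ?exprn_ge0 // invr_ge0 exprn_ge0 //.
by rewrite subr_ge0 ltW.
Qed.

Lemma cabs_add1_gt0 x : cabs x < 1 -> 0 < cabs (1 + x).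
Proof.
move=> x1; have := cabsB_ge 1 (- x); rewrite opprK cabs1 cabsN; lra.
Qed.

Lemma cabs_binpoly_sqr_le g K x th : `|g| <= 1 -> cabs x <= th -> th < 1 ->
  cabs (binpoly g K x) ^+ 2 <= (1 + bingap th K) * (cabs (1 + x) ^+ 2) `^ g.
Proof.
move=> g1 xt t1; have t0 : 0 <= th by apply: le_trans (cabs_ge0 x) xt.
have := binpoly_approx K g1 xt t1.
have u0 : 0 < cabs (1 + x) ^+ 2.
  by rewrite exprn_gt0 // cabs_add1_gt0 // (le_lt_trans xt).
have p0 : 0 < (cabs (1 + x) ^+ 2) `^ g by rewrite powR_gt0.
rewrite powRN ler_norml => /andP[_]; rewrite lerBlDl => h.
rewrite -ler_pdivrMr //; apply: le_trans h _; rewrite lerD2l /bingap.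
rewrite ler_wpM2l //; last by rewrite lerXn2r ?nnegrE ?cabs_ge0.
by rewrite !mulr_ge0 // invr_ge0 exprn_ge0 // subr_ge0 ltW.
Qed.

Let qpoly (g : R) (K k : nat) x : {poly R[i]} :=
  \sum_(m < K.+1) (((gbin g m)%:C)%C * x ^+ m) *: 'X^(k * m).

Let qpoly_horner g K k x z : (qpoly g K k x).[z] = binpoly g K (x * z ^+ k).
Proof.
rewrite /qpoly horner_sum; apply: eq_bigr => m _.
by rewrite hornerZ hornerXn exprMn exprM mulrA.
Qed.

Let size_qpoly g K k x : (size (qpoly g K k x) <= (k * K).+1)%N.
Proof.
apply: leq_trans (size_sum _ _ _) _; apply/bigmax_leqP => m _.
apply: leq_trans (size_scale_leq _ _) _.
by rewrite size_polyXn ltnS leq_mul2l -ltnS ltn_ord orbT.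
Qed.

Let qpolyS g K k x : exists r : {poly R[i]},
  qpoly g K.+1 k x = 1 + ((g%:C)%C * x) *: 'X^k + 'X^(k + k) * r.
Proof.
exists (\sum_(m < K) (((gbin g m.+2)%:C)%C * x ^+ m.+2) *: 'X^(k * m)).
rewrite /qpoly 2!big_ord_recl /= gbin0 gbin1 muln0 muln1 expr0 expr1 mulr1 scale1r addrA.
congr (_ + _ + _).
rewrite mulr_sumr; apply: eq_bigr => m _; rewrite -scalerAr -exprD.
by congr (_ *: 'X^_); rewrite /bump /= !add1n !mulnS addnA.
Qed.

Let coef_mul_qpoly f g K k x : (0 < k)%N ->
  (f * qpoly g K.+1 k x)`_0 = f`_0 /\
  (f * qpoly g K.+1 k x)`_k = f`_k + (g%:C)%C * x * f`_0.
Proof.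
move=> k0; have [r ->] := qpolyS g K k x.
have kk : (k < k + k)%N by rewrite -[X in (X < _)%N]addn0 ltn_add2l.
split; rewrite !mulrDr mulr1 -scalerAr mulrCA !coefD coefZ coefXnM coefMXn.
  by rewrite k0 addn_gt0 k0 mulr0 !addr0.
by rewrite ltnn subnn kk addr0.
Qed.

(** The test functions are truncations of [conj u * u ^ (1 - s)] and [conj z ^ k * u ^ (2 - s)] with
    [u = 1 + x z ^ k]; both have modulus about [|u| ^ (2 - s)]. Their pairings with [f] read off the
    coefficients 0 and [k] exactly, [M] being large enough to exclude aliasing. The last factor of
    [B] bounds [(1 + |x| ^ 2) ^ (2 - s)]. *)
Lemma one_variable_tests s th K f k M x : 1 <= s <= 2 -> th < 1 -> cabs x <= th ->
  (0 < k)%N -> (size f + k * K.+2 <= M)%N ->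
  let N := (uavg M (fun j => cabs f.[uroot R M j] `^ (2 / s))) `^ s in
  let B := (1 + bingap th K.+1) * N * (1 + (2 - s) * cabs x ^+ 2) in
  cabs (f`_0 + conjc x * (f`_k + ((1 - s)%:C)%C * x * f`_0)) ^+ 2 <= B /\
  cabs (f`_k + ((2 - s)%:C)%C * x * f`_0) ^+ 2 <= B.
Proof.
move=> /andP[s1 s2] t1 xt k0 hM N B.
have t0 : 0 <= th by apply: le_trans (cabs_ge0 x) xt.
have hkM : (k < M)%N.
  by move: hM; rewrite !mulnS; lia.
have M0 : (0 < M)%N by exact: leq_ltn_trans hkM.
have MR : 0 < M%:R :> R by rewrite ltr0n.
have MC : M%:R != 0 :> R[i] by rewrite pnatr_eq0 -lt0n.
pose z := uroot R M; pose u j := 1 + x * z j ^+ k.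
have xz j : cabs (x * z j ^+ k) <= th by rewrite cabsM cabsX cabs_uroot expr1n mulr1.
have szfq g : (size (f * qpoly g K.+1 k x)%R <= M)%N.
  apply: leq_trans (size_polyMleq _ _) _.
  by have := size_qpoly g K.+1 k x; move: hM; rewrite !mulnS; lia.
have hu j : cabs (u j) ^+ 2 = complex.Re ((1 + x *: 'X^k).[z j] * (1 + conjc x * conjc (z j) ^+ k)).
  rewrite hornerD hornerZ hornerXn hornerC -[1 + conjc x * _](_ : conjc (u j) = _) ?mul_conj_cabs //.
  by rewrite /u conjD conj1 conjM conjX.
have sumT (h : {poly R[i]}) : (size h <= M)%N ->
    \sum_(j < M) h.[z j] * (1 + conjc x * conjc (z j) ^+ k) = M%:R * (h`_0 + conjc x * h`_k).
  move=> hh; under eq_bigr => j _ do rewrite mulrDr mulr1 mulrCA.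
  rewrite big_split /= -mulr_sumr sum_uroot_horner //.
  have h0 := sum_uroot_horner hh M0.
  have -> : \sum_(i < M) h.[z i] = M%:R * h`_0.
    by rewrite -h0; apply: eq_bigr => j _; rewrite expr0 mulr1.
  by ring.
have sumu : \sum_(j < M) cabs (u j) ^+ 2 = M%:R * (1 + cabs x ^+ 2).
  under eq_bigr do rewrite hu; rewrite -Re_sum sumT; last first.
    apply: leq_trans (size_polyD _ _) _; rewrite geq_max size_poly1 M0 /=.
    by apply: leq_trans (size_scale_leq _ _) _; rewrite size_polyXn.
  rewrite !coefD !coefZ !coefXn !coef1 eqxx (gtn_eqF k0) (ltn_eqF k0) mulr0 addr0 add0r mulr1.
  rewrite eqxx mulr1n [conjc x * x]mulrC mul_conj_cabs.
  by rewrite -(rmorph_nat (real_complex R)) Re_scale Re_add.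
have D0 : 0 < 1 + cabs x ^+ 2 by rewrite ltr_pwDl // sqr_ge0.
have E0 : 0 <= bingap th K.+1 by exact: bingap_ge0.
have N0 : 0 <= N by exact: powR_ge0.
have hs : 1 <= s <= 2 by rewrite s1.
have u0 j : 0 < cabs (u j) ^+ 2.
  by rewrite exprn_gt0 // cabs_add1_gt0 // (le_lt_trans (xz j)).
have fin (v : nat -> R[i]) (V : R[i]) :
    (forall j, cabs (v j) ^+ 2 <= (1 + bingap th K.+1) * (cabs (u j) ^+ 2) `^ (2 - s)) ->
    \sum_(j < M) f.[z j] * v j = M%:R * V -> cabs V ^+ 2 <= B.
  move=> hv hV; have := holder_uroot (fun j => f.[z j]) M0 hs E0 D0 hv sumu.
  rewrite hV cabsM -(rmorph_nat (real_complex R)) cabs_real normr_nat mulrAC divff ?gt_eqF // mul1r.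
  move=> h; apply: le_trans h _; rewrite /B ler_wpM2l ?mulr_ge0 ?addr_ge0 //.
  have h2s : 0 <= 2 - s <= 1 by lra.
  by apply: le_trans (powR_le_affine (ltW D0) h2s) _; lra.
have g1 : `|1 - s| <= 1 by rewrite ler_norml; lra.
have g2 : `|2 - s| <= 1 by rewrite ler_norml; lra.
split.
- apply: (fin (fun j => conjc (u j) * binpoly (1 - s) K.+1 (x * z j ^+ k))) => [j|].
    rewrite cabsM cabs_conj exprMn mulrC.
    apply: le_trans (ler_wpM2r (sqr_ge0 _) (cabs_binpoly_sqr_le K.+1 g1 (xz j) t1)) _.
    rewrite -mulrA ler_wpM2l ?addr_ge0 // -[X in _ * X <= _]powRr1 ?(ltW (u0 j)) //.
    by rewrite -powRD ?(gt_eqF (u0 j)) ?implybT // (_ : 1 - s + 1 = 2 - s) //; ring.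
  have [c0 ck] := coef_mul_qpoly f (1 - s) K x k0.
  rewrite -ck -c0 -sumT //; apply: eq_bigr => j _.
  rewrite hornerM qpoly_horner /u conjD conj1 conjM conjX; ring.
- apply: (fin (fun j => conjc (z j) ^+ k * binpoly (2 - s) K.+1 (x * z j ^+ k))) => [j|].
    rewrite cabsM cabsX cabs_conj cabs_uroot expr1n mul1r.
    exact: cabs_binpoly_sqr_le.
  have [c0 ck] := coef_mul_qpoly f (2 - s) K x k0.
  rewrite -ck -sum_uroot_horner //; apply: eq_bigr => j _.
  rewrite hornerM qpoly_horner; ring.
Qed.

End OneVariableInequality.

Section OneVariableReal.
Variable R : realType.
Implicit Types (s th E A N : R).

(** The first test serves when [A <= s * a0], the second otherwise. In both cases a second-order
    term is left over after the main inequality, and it dominates the quartic surplus. The factor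
    [th ^ 4] is the price of parameters bounded by [th]. *)
Lemma one_variable_real s th E (a0 : R) A N : 1 < s <= 2 -> 0 < th <= 1 -> 0 <= E ->
  0 <= a0 -> 0 <= A -> 0 <= N ->
  (forall xi, 0 <= xi <= th ->
     (a0 * (1 + (1 - s) * xi ^+ 2) + xi * A) ^+ 2 <= (1 + E) * N * (1 + (2 - s) * xi ^+ 2) /\
     (A + (2 - s) * xi * a0) ^+ 2 <= (1 + E) * N * (1 + (2 - s) * xi ^+ 2)) ->
  th ^+ 4 * (a0 ^+ 2 + A ^+ 2 / s + (s - 1) ^+ 2 / (2 * s ^+ 4) * (A ^+ 4 / (a0 ^+ 2 + A ^+ 2)))
    <= (1 + E) * N.
Proof.
move=> /andP[s1 s2] /andP[t0 t1] E0 a00 A0 N0 H.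
have s0 : 0 < s by lra.
set W := (1 + E) * N in H *.
have th2 : th ^+ 2 <= 1 by rewrite exprn_ile1 // ltW.
have th4 : th ^+ 4 <= th ^+ 2.
  by rewrite (_ : th ^+ 4 = th ^+ 2 * th ^+ 2); [rewrite ler_piMr // sqr_ge0 | ring].
have th40 : 0 <= th ^+ 4 by rewrite exprn_ge0 // ltW.
have s2n : 0 < s ^+ 2 by rewrite exprn_gt0.
set c := (s - 1) ^+ 2 / (2 * s ^+ 4).
have c0 : 0 <= c by rewrite /c divr_ge0 ?sqr_ge0 // mulr_ge0 // exprn_ge0 // ltW.
have [case1|case2] := leP A (s * a0).
- have [a0E|a0n] := eqVneq a0 0.
    have -> : A = 0 by apply/eqP; rewrite eq_le A0 andbT; move: case1; rewrite a0E mulr0.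
    by rewrite a0E !expr0n /= !mul0r mulr0 !addr0 mulr0 /W mulr_ge0 // addr_ge0.
  have a0p : 0 < a0 by rewrite lt_neqAle eq_sym a0n.
  (* The parameter for which the function [(1 + x z) ^ s] has the ratio [A / a0] between its
     coefficients of index 1 and 0. For [th = 1] the tested quantity becomes [a0 * (1 + x ^ 2)]. *)
  pose x := A / (s * a0).
  have x0 : 0 <= x by rewrite divr_ge0 // mulr_ge0 // ltW.
  have x1 : x <= 1 by rewrite ler_pdivrMr ?mulr_gt0 // mul1r.
  have AE : A = s * a0 * x by rewrite /x mulrC divfK // mulf_neq0 // gt_eqF.
  have xi01 : 0 <= th * x <= th by rewrite mulr_ge0 ?(ltW t0) //= ler_piMr // ltW.
  have [H1 _] := H _ xi01.
  pose v := (th * x) ^+ 2.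
  have v0 : 0 <= v by exact: sqr_ge0.
  have tx0 : 0 <= th * x by rewrite mulr_ge0 // ltW.
  have tx1 : th * x <= 1 by rewrite mulr_ile1 // ltW.
  have v1 : v <= 1 by exact: exprn_ile1.
  have vE : v = th ^+ 2 * x ^+ 2 by rewrite /v exprMn.
  rewrite -/v in H1; clearbody v.
  pose c' := (s - 1) ^+ 2 / 2.
  have k1 : (a0 * (1 + v)) ^+ 2 <= W * (1 + (2 - s) * v).
    apply: le_trans H1; apply: lerXn2r; rewrite ?nnegrE.
      by rewrite mulr_ge0 ?addr_ge0.
      apply: addr_ge0; last exact: mulr_ge0; apply: mulr_ge0 => //.
      have : (s - 1) * v <= 1 by rewrite mulr_ile1 ?subr_ge0 ?(ltW s1) //; lra.
      lra.
    rewrite AE.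
    have -> : th * x * (s * a0 * x) = a0 * (s * (th * x ^+ 2)) by ring.
    have : v <= th * x ^+ 2.
      by rewrite vE ler_wpM2r ?sqr_ge0 // expr2 ler_piMr // ltW.
    rewrite -mulrDr ler_pM2l // => hv; nra.
  have k2 : (1 + (2 - s) * v) * (1 + s * v + c' * v ^+ 2) <= (1 + v) ^+ 2.
    rewrite -subr_ge0.
    have -> : (1 + v) ^+ 2 - (1 + (2 - s) * v) * (1 + s * v + c' * v ^+ 2) =
       v ^+ 2 * (c' * (1 - (2 - s) * v)) by rewrite /c'; field.
    rewrite mulr_ge0 ?sqr_ge0 // mulr_ge0 ?divr_ge0 ?sqr_ge0 //; nra.
  have k3 : a0 ^+ 2 * (1 + s * v + c' * v ^+ 2) <= W.
    have d0 : 0 < 1 + (2 - s) * v by nra.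
    rewrite -(ler_pM2r d0); apply: le_trans k1; rewrite exprMn -mulrA ler_wpM2l ?sqr_ge0 //.
    by rewrite mulrC.
  apply: le_trans k3.
  have k4 : A ^+ 4 / (a0 ^+ 2 + A ^+ 2) <= A ^+ 4 / a0 ^+ 2.
    rewrite ler_wpM2l ?exprn_ge0 // lef_pV2 ?posrE ?exprn_gt0 // ?lerDl ?sqr_ge0 //.
    by rewrite ltr_pwDl ?exprn_gt0 // sqr_ge0.
  apply: le_trans (ler_wpM2l th40 (lerD (lexx _) (ler_wpM2l c0 k4))) _.
  have -> : a0 ^+ 2 + A ^+ 2 / s + c * (A ^+ 4 / a0 ^+ 2) =
     a0 ^+ 2 * (1 + s * x ^+ 2 + c' * x ^+ 4).
    by rewrite AE /c /c'; field; rewrite a0n gt_eqF.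
  rewrite mulrCA ler_wpM2l ?sqr_ge0 // !mulrDr mulr1 vE.
  have -> : (th ^+ 2 * x ^+ 2) ^+ 2 = th ^+ 4 * x ^+ 4 by ring.
  apply: lerD; last by rewrite mulrCA.
  apply: lerD; first by apply: le_trans th2.
  by rewrite mulrCA ler_wpM2l ?(ltW s0) // ler_wpM2r // sqr_ge0.
- have Ap : 0 < A by apply: le_lt_trans case2; rewrite mulr_ge0 // ltW.
  (* The reciprocal choice, again at most 1; for [th = 1] the tested quantity becomes
     [A / s * (s + (2 - s) * y ^ 2)]. *)
  pose y := s * a0 / A.
  have y0 : 0 <= y by rewrite divr_ge0 // mulr_ge0 // ltW.
  have y1 : y <= 1 by rewrite ler_pdivrMr // mul1r ltW.
  have aE : a0 = A * y / s by rewrite /y; field; rewrite !gt_eqF.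
  have xi01 : 0 <= th * y <= th by rewrite mulr_ge0 ?(ltW t0) //= ler_piMr // ltW.
  have [_ H2] := H _ xi01.
  pose v := (th * y) ^+ 2.
  have v0 : 0 <= v by exact: sqr_ge0.
  have ty0 : 0 <= th * y by rewrite mulr_ge0 // ltW.
  have ty1 : th * y <= 1 by rewrite mulr_ile1 // ltW.
  have v1 : v <= 1 by exact: exprn_ile1.
  have vE : v = th ^+ 2 * y ^+ 2 by rewrite /v exprMn.
  rewrite -/v in H2; clearbody v.
  have k1 : (A / s * (s + (2 - s) * v)) ^+ 2 <= W * (1 + (2 - s) * v).
    apply: le_trans H2; rewrite lerXn2r ?nnegrE //.
    + by rewrite mulr_ge0 ?divr_ge0 ?(ltW s0) //; nra.
    + by rewrite addr_ge0 // mulr_ge0 // mulr_ge0 //; lra.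
    + rewrite aE.
      have -> : A + (2 - s) * (th * y) * (A * y / s) = A / s * (s + (2 - s) * (th * y ^+ 2)).
        by field; rewrite gt_eqF.
      rewrite ler_wpM2l ?divr_ge0 ?(ltW s0) // lerD2l ler_wpM2l; [by []|lra|].
      by rewrite vE ler_wpM2r ?sqr_ge0 // expr2 ler_piMr // ltW.
  pose d := (s - 1) ^+ 2 / 2.
  have k2 : (1 + (2 - s) * v) * (s + v + d) <= (s + (2 - s) * v) ^+ 2.
    rewrite -subr_ge0.
    have -> : (s + (2 - s) * v) ^+ 2 - (1 + (2 - s) * v) * (s + v + d) =
       (s - 1) * ((s - 1) * (1 - v) + (2 - s) * ((1 - v) * (1 + v)) + (s - 1) / 2 * (1 - (2 - s) * v)).
      by rewrite /d; field.
    rewrite mulr_ge0 ?subr_ge0 ?(ltW s1) // !addr_ge0 //.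
    + by rewrite mulr_ge0 ?subr_ge0 // ltW.
    + by rewrite !mulr_ge0 ?subr_ge0 // addr_ge0.
    + by rewrite mulr_ge0 ?divr_ge0 ?subr_ge0 ?(ltW s1) // mulr_ile1 //; lra.
  have k3 : A ^+ 2 / s ^+ 2 * (s + v + d) <= W.
    have d0 : 0 < 1 + (2 - s) * v by nra.
    rewrite -(ler_pM2r d0); apply: le_trans k1.
    have -> : (A / s * (s + (2 - s) * v)) ^+ 2 = A ^+ 2 / s ^+ 2 * (s + (2 - s) * v) ^+ 2.
      by rewrite exprMn expr_div_n.
    have -> : A ^+ 2 / s ^+ 2 * (s + v + d) * (1 + (2 - s) * v) =
        A ^+ 2 / s ^+ 2 * ((1 + (2 - s) * v) * (s + v + d)) by rewrite -mulrA [(s + v + d) * _]mulrC.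
    by rewrite ler_wpM2l ?divr_ge0 ?sqr_ge0.
  apply: le_trans k3.
  have k4 : c * (A ^+ 4 / (a0 ^+ 2 + A ^+ 2)) <= A ^+ 2 / s ^+ 2 * d.
    have k5 : A ^+ 4 / (a0 ^+ 2 + A ^+ 2) <= A ^+ 2.
      rewrite ler_pdivrMr ?ltr_wpDl ?sqr_ge0 ?exprn_gt0 //.
      have -> : A ^+ 4 = A ^+ 2 * A ^+ 2 by ring.
      by rewrite ler_wpM2l ?sqr_ge0 // lerDr sqr_ge0.
    apply: le_trans (ler_wpM2l c0 k5) _.
    rewrite (_ : A ^+ 2 / s ^+ 2 * d = d / s ^+ 2 * A ^+ 2); last by rewrite mulrC mulrCA mulrC.
    rewrite ler_wpM2r ?sqr_ge0 // (_ : c = d / s ^+ 4); last by rewrite /c /d; field; rewrite gt_eqF.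
    rewrite ler_wpM2l ?divr_ge0 ?sqr_ge0 // lef_pV2 ?posrE ?exprn_gt0 //.
    by rewrite ler_eXn2l //; lra.
  rewrite !mulrDr.
  have e1 : A ^+ 2 / s ^+ 2 * s = A ^+ 2 / s by field; rewrite gt_eqF.
  have e2 : A ^+ 2 / s ^+ 2 * v = th ^+ 2 * a0 ^+ 2 by rewrite aE vE; field; rewrite gt_eqF.
  rewrite e1 e2.
  have h1 : th ^+ 4 * a0 ^+ 2 <= th ^+ 2 * a0 ^+ 2 by rewrite ler_wpM2r ?sqr_ge0.
  have h2 : th ^+ 4 * (A ^+ 2 / s) <= A ^+ 2 / s.
    by rewrite ler_piMl ?divr_ge0 ?sqr_ge0 ?(ltW s0) // (le_trans th4).
  have h3 : th ^+ 4 * (c * (A ^+ 4 / (a0 ^+ 2 + A ^+ 2))) <= A ^+ 2 / s ^+ 2 * d.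
    apply: le_trans k4; rewrite ler_piMl ?(le_trans th4) // mulr_ge0 // divr_ge0 ?exprn_ge0 //.
    by rewrite addr_ge0 ?sqr_ge0.
  lra.
Qed.

End OneVariableReal.

Section SliceInequality.
Variable R : realType.
Implicit Types (s eta c : R) (f : {poly R[i]}).

Definition surplus s : R := (s - 1) ^+ 2 / (2 * s ^+ 4).

Lemma surplus_gt0 s : 1 < s -> 0 < surplus s.
Proof.
by move=> s1; rewrite /surplus divr_gt0 ?exprn_gt0 ?mulr_gt0 ?exprn_gt0 //; lra.
Qed.

Let phase_identity1 (e1 e2 b1 b2 X A B S : R[i]) : b1 * e1 = 1 -> b2 * e2 = 1 ->
  A * e1 + X * b2 * e1 * (B * e2 + S * (X * e2 * b1) * (A * e1)) =
  (A * (1 + S * X ^+ 2) + X * B) * e1.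
Proof.
move=> h1 h2.
have -> : A * e1 + X * b2 * e1 * (B * e2 + S * (X * e2 * b1) * (A * e1)) =
  A * e1 + X * B * e1 * (b2 * e2) + S * X ^+ 2 * A * e1 * (b1 * e1) * (b2 * e2) by ring.
by rewrite h1 h2; ring.
Qed.

Let phase_identity2 (e1 e2 b1 X A B S : R[i]) : b1 * e1 = 1 ->
  B * e2 + S * (X * e2 * b1) * (A * e1) = (B + S * X * A) * e2.
Proof.
move=> h1; have -> : S * (X * e2 * b1) * (A * e1) = S * X * A * e2 * (b1 * e1) by ring.
by rewrite h1; ring.
Qed.

(** The argument of [x] is turned by the phases of the two coefficients, so that the complex tests
    reduce to the real inequality for moduli. The bound [K] depends on [s] and [eta] only, not on
    [f] or [k]. *)
Lemma one_variable s eta : 1 < s <= 2 -> 0 < eta <= 1 ->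
  exists K : nat, forall f k M, (0 < k)%N -> (size f + k * K <= M)%N ->
    cabs f`_0 ^+ 2 + cabs f`_k ^+ 2 / s
      + surplus s * (cabs f`_k ^+ 4 / (cabs f`_0 ^+ 2 + cabs f`_k ^+ 2))
    <= (1 + eta) * (uavg M (fun j => cabs f.[uroot R M j] `^ (2 / s))) `^ s.
Proof.
move=> hs /andP[eta0 eta1]; have [s1 s2] := andP hs.
have hs' : 1 <= s <= 2 by rewrite (ltW s1).
(* Close enough to 1 for [1 + eta / 2 <= th ^ 4 * (1 + eta)]; the truncation error may then use up
   [eta / 2]. *)
pose th : R := 1 - eta / 16.
have th0 : 0 < th by rewrite /th; lra.
have th1 : th < 1 by rewrite /th; lra.
have C0 : 0 <= 4 * (1 - th) ^- 5.
  by rewrite mulr_ge0 // invr_ge0 exprn_ge0 // subr_ge0 ltW.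
have e0 : 0 < eta / 2 by rewrite divr_gt0.
have [K hK] := exists_small_mul_geom C0 (ltW th0) th1 e0.
exists K.+2 => f k M k0 hM.
set N := _ `^ s.
have N0 : 0 <= N by exact: powR_ge0.
have [e1 [e1c a0E]] := exists_phase f`_0.
have [e2 [e2c akE]] := exists_phase f`_k.
have E0 : 0 <= bingap th K.+1 by apply: bingap_ge0 => //; exact: ltW.
have H : th ^+ 4 * (cabs f`_0 ^+ 2 + cabs f`_k ^+ 2 / s
      + surplus s * (cabs f`_k ^+ 4 / (cabs f`_0 ^+ 2 + cabs f`_k ^+ 2)))
    <= (1 + bingap th K.+1) * N.
  apply: one_variable_real; rewrite ?cabs_ge0 ?th0 ?(ltW th1) // => xi /andP[xi0 xi1].
  pose x : R[i] := ((xi%:C)%C * e2 * conjc e1).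
  have cx : cabs x = xi.
    by rewrite /x !cabsM cabs_conj e1c e2c !mulr1 cabs_real ger0_norm.
  have cxth : cabs x <= th by rewrite cx.
  have [T1 T2] := one_variable_tests hs' th1 cxth k0 hM.
  have ee1 : conjc e1 * e1 = 1 by rewrite mulrC mul_conj_cabs e1c expr1n rmorph1.
  have ee2 : conjc e2 * e2 = 1 by rewrite mulrC mul_conj_cabs e2c expr1n rmorph1.
  have nn (y : R) (e : R[i]) : cabs e = 1 -> cabs ((y%:C)%C * e) ^+ 2 = y ^+ 2.
    by move=> ec; rewrite cabsM ec mulr1 cabs_real real_normK ?num_real.
  rewrite cx in T1 T2; split.
  - apply: le_trans T1; rewrite le_eqVlt; apply/orP; left; apply/eqP.
    rewrite -(nn _ e1 e1c); congr (cabs _ ^+ 2).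
    have conjx : conjc x = (xi%:C)%C * conjc e2 * e1.
      by rewrite /x !conjM conjcK conjc_real.
    have -> : f`_0 + conjc x * (f`_k + ((1 - s)%:C)%C * x * f`_0) =
        ((cabs f`_0)%:C)%C * e1 + (xi%:C)%C * conjc e2 * e1 *
        (((cabs f`_k)%:C)%C * e2 + ((1 - s)%:C)%C * ((xi%:C)%C * e2 * conjc e1) * (((cabs f`_0)%:C)%C * e1)).
      by rewrite -a0E -akE conjx.
    rewrite (phase_identity1 _ _ _ _ ee1 ee2).
    by rewrite !(real_complexD, real_complexM, real_complexX).
  - apply: le_trans T2; rewrite le_eqVlt; apply/orP; left; apply/eqP.
    rewrite -(nn _ e2 e2c); congr (cabs _ ^+ 2).
    have -> : f`_k + ((2 - s)%:C)%C * x * f`_0 =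
        ((cabs f`_k)%:C)%C * e2 + ((2 - s)%:C)%C * ((xi%:C)%C * e2 * conjc e1) * (((cabs f`_0)%:C)%C * e1).
      by rewrite -a0E -akE.
    rewrite (phase_identity2 _ _ _ _ _ ee1).
    by rewrite !(real_complexD, real_complexM, real_complexX).
have hE : bingap th K.+1 <= eta / 2.
  by apply: (hK K.+2); rewrite ltnW // ltnW.
have th4 : 1 + eta / 2 <= th ^+ 4 * (1 + eta).
  have h1 : 1 - eta / 4 <= th ^+ 4.
    have h2 : 1 - eta / 8 <= th ^+ 2 by rewrite /th expr2; nra.
    have -> : th ^+ 4 = th ^+ 2 * th ^+ 2 by ring.
    apply: le_trans (_ : (1 - eta / 8) * (1 - eta / 8) <= _); first by nra.
    by apply: ler_pM => //; lra.
  apply: le_trans (ler_wpM2r _ h1); [by nra | by lra].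
have t4 : 0 < th ^+ 4 by rewrite exprn_gt0.
rewrite -(ler_pM2l t4); apply: le_trans H _; rewrite mulrA ler_wpM2r //.
by apply: le_trans th4; rewrite lerD2l.
Qed.

(* The surplus term absorbs, at second order only, the mass moved from the first
   coefficient to the higher ones. *)
Lemma combine_slices s c S W (a : nat -> R) (kap : nat -> R) (L : nat) :
  0 < s -> 0 < c -> (forall k, 0 <= a k) -> (forall k, 0 <= kap k) ->
  \sum_(2 <= k < L) kap k <= S -> S <= 2^-1 -> (1 < L)%N -> 0 <= W ->
  (forall k, (0 < k < L)%N ->
     a 0%N ^+ 2 + a k ^+ 2 / s + c * (a k ^+ 4 / (a 0%N ^+ 2 + a k ^+ 2)) <= W) ->
  a 0%N ^+ 2 + a 1%N ^+ 2 / s + \sum_(2 <= k < L) kap k * (a k ^+ 2 / s)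
    <= (1 + S ^+ 2 * ((1 + s) / (2 * c * s ^+ 2))) * W.
Proof.
move=> s0 c0 a0 k0 hS hS2 L1 W0 H.
set Q := \sum_(2 <= k < L) kap k in hS *.
have Q0 : 0 <= Q by apply: sumr_ge0 => k _.
have Q2 : Q <= 2^-1 by exact: le_trans hS _.
have X0 (k : nat) : 0 <= c * (a k ^+ 4 / (a 0%N ^+ 2 + a k ^+ 2)).
  by rewrite mulr_ge0 ?(ltW c0) // divr_ge0 ?exprn_ge0 // addr_ge0 ?sqr_ge0.
have h1 := H 1%N L1.
(* The inequalities of index [k >= 2] are averaged with weights [kap k], the one of index 1 with
   weight [1 - Q]. What is missing on the left is [Q * a 1 ^ 2 / s], and by the inequality of the
   means it is at most half of the surplus plus a term of order [Q ^ 2]. *)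
have hk : Q * (a 0%N ^+ 2) + \sum_(2 <= k < L) kap k * (a k ^+ 2 / s) <= Q * W.
  rewrite /Q !mulr_suml -big_split /= !big_nat; apply: ler_sum => k /andP[k2 kL].
  rewrite -mulrDr ler_wpM2l //; apply: le_trans (H k _); last by rewrite kL andbT ltnW.
  by rewrite lerDl.
set X := a 1%N ^+ 4 / _ in h1.
set T := a 0%N ^+ 2 + a 1%N ^+ 2 in X h1.
have TW : T <= (1 + s) * W.
  have ha : a 0%N ^+ 2 <= W.
    apply: le_trans h1; rewrite -addrA lerDl addr_ge0 //; last exact: X0.
    by rewrite divr_ge0 ?sqr_ge0 // ltW.
  have hb : a 1%N ^+ 2 <= s * W.
    rewrite -ler_pdivrMl // mulrC; apply: le_trans h1.
    by rewrite addrAC lerDr addr_ge0 ?sqr_ge0 //; exact: X0.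
  by rewrite /T mulrDl mul1r lerD.
have key : Q * (a 1%N ^+ 2 / s) <= 2^-1 * (c * X) + S ^+ 2 * ((1 + s) / (2 * c * s ^+ 2)) * W.
  have [T0|Tn] := eqVneq T 0.
    have -> : a 1%N = 0.
      have : 0 <= a 1%N ^+ 2 by exact: sqr_ge0.
      have : 0 <= a 0%N ^+ 2 by exact: sqr_ge0.
      move: T0; rewrite /T => T0 ha hb.
      by apply/eqP; rewrite -sqrf_eq0; apply/eqP; lra.
    rewrite expr0n /= mul0r mulr0.
    have hD : 0 <= (1 + s) / (2 * c * s ^+ 2).
      by rewrite divr_ge0 ?mulr_ge0 ?exprn_ge0 ?addr_ge0 // ltW.
    apply: addr_ge0; last by rewrite mulr_ge0 // mulr_ge0 // sqr_ge0.
    by rewrite mulr_ge0 //; exact: X0.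
  have Tp : 0 < T by rewrite lt_neqAle eq_sym Tn /T addr_ge0 ?sqr_ge0.
  have amgm : Q * (a 1%N ^+ 2 / s) <= 2^-1 * (c * X) + Q ^+ 2 / (2 * c * s ^+ 2) * T.
    rewrite -subr_ge0.
    have -> : 2^-1 * (c * X) + Q ^+ 2 / (2 * c * s ^+ 2) * T - Q * (a 1%N ^+ 2 / s) =
       (c * a 1%N ^+ 2 - Q * T / s) ^+ 2 / (2 * c * T).
      by rewrite /X; field; rewrite Tn !gt_eqF.
    by rewrite divr_ge0 ?sqr_ge0 // !mulr_ge0 ?(ltW c0) ?(ltW Tp).
  apply: le_trans amgm _; rewrite lerD2l.
  have D0 : 0 < 2 * c * s ^+ 2 by rewrite !mulr_gt0 ?exprn_gt0.
  apply: le_trans (_ : Q ^+ 2 / (2 * c * s ^+ 2) * ((1 + s) * W) <= _).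
    by rewrite ler_wpM2l // divr_ge0 ?sqr_ge0 // ltW.
  have -> : Q ^+ 2 / (2 * c * s ^+ 2) * ((1 + s) * W) = Q ^+ 2 * ((1 + s) / (2 * c * s ^+ 2)) * W.
    by field; rewrite !gt_eqF.
  rewrite ler_wpM2r // ler_wpM2r //; first by rewrite divr_ge0 ?(ltW D0) //; lra.
  by rewrite lerXn2r ?nnegrE // (le_trans Q0).
have hQ1 : (1 - Q) * (a 0%N ^+ 2 + a 1%N ^+ 2 / s + c * X) <= (1 - Q) * W.
  by rewrite ler_wpM2l //; lra.
have hcX : 0 <= c * X by exact: X0.
have hQX : (Q * (c * X)) <= 2^-1 * (c * X) by rewrite ler_wpM2r.
rewrite mulrDl mul1r; move: hk hQ1 hQX key; lra.
Qed.

End SliceInequality.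

(** * The inequality at a single prime *)

Section CoefficientInequality.
Variable R : realType.
Implicit Types (s : R) (P : dpoly R).

(** The values 1 and [s] are those of the two-coefficient inequality. For [k >= 2] any growth
    [q ^ (a * k)] with [1 / 4 < a < 1 / 2] makes both the losses, of order [q ^ (- 4 a)], and the
    contribution of [q ^ 2] to the Euler product, of order [q ^ (2 a - 2)], summable; [a = 1 / 3]
    equates the two. The factor 10 keeps the total weight of the higher coefficients below
    [1 / 2]. *)
Definition pweight s (q k : nat) : R :=
  if k == 0%N then 1 else if k == 1%N then s else 10 * s * q%:R `^ (k%:R / 3).

Lemma pweight_gt0 s q k : 0 < s -> (0 < q)%N -> 0 < pweight s q k.
Proof.
move=> s0 q0; rewrite /pweight; case: ifP => // _; case: ifP => // _.
by rewrite !mulr_gt0 ?powR_gt0 ?ltr0n.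
Qed.

(** The 1 pays for [eta = q ^ (- 4 / 3)] in [one_variable]; the fraction is the constant of
    [combine_slices] for [S = q ^ (- 2 / 3) / 2]. *)
Definition loss s : R := 1 + (1 + s) / (8 * surplus s * s ^+ 2).

Lemma loss_ge0 s : 1 < s -> 0 <= loss s.
Proof.
move=> s1; rewrite /loss; move: (surplus s) (surplus_gt0 s1) => c c0.
have s0 : 0 < s by lra.
have D : 0 < 8 * c * s ^+ 2 by rewrite !mulr_gt0 ?exprn_gt0.
by rewrite addr_ge0 // divr_ge0 ?(ltW D) //; lra.
Qed.

Lemma prime_slice s q : 1 < s <= 2 -> (1 < q)%N ->
  exists K : nat, forall L M (a : nat -> R[i]), (1 < L)%N -> (L + L * K <= M)%N ->
    \sum_(k < L) cabs (a k) ^+ 2 / pweight s q k <=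
    expR (loss s * q%:R `^ (- (4 / 3))) *
     (uavg M (fun j => cabs (\sum_(k < L) a k * uroot R M j ^+ k) `^ (2 / s))) `^ s.
Proof.
move=> hs q1; have [s1 s2] := andP hs; have s0 : 0 < s by lra.
have qR : 0 < q%:R :> R by rewrite ltr0n ltnW.
pose rho : R := q%:R `^ (- (1 / 3)).
have r0 : 0 < rho by rewrite powR_gt0.
have rX n : rho ^+ n = q%:R `^ (- (n%:R / 3)).
  by rewrite -powR_mulrn ?(ltW r0) // -powRrM; congr (_ `^ _); field.
(* From [rho ^ 3 = 1 / q <= 1 / 2 <= (4 / 5) ^ 3]; the geometric series of ratio [rho] is then at
   most 5. *)
have r45 : rho <= 4 / 5.
  rewrite -(@ler_pXn2r _ 3) ?nnegrE ?(ltW r0) ?divr_ge0 // rX divff // powR_inv1 ?(ltW qR) //.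
  apply: le_trans (_ : 2^-1 <= _); last by rewrite !exprS expr0; lra.
  by rewrite lef_pV2 ?posrE // ler_nat.
clearbody rho.
have r41 : 0 < rho ^+ 4 <= 1.
  by rewrite exprn_gt0 //= exprn_ile1 ?(ltW r0) //; lra.
have [K hK] := one_variable hs r41.
rewrite /loss; move: (surplus s) (surplus_gt0 s1) hK => c c0 hK.
exists K => L M a L1 hM.
pose f : {poly R[i]} := \poly_(k < L) a k.
have sf : (size f <= L)%N by exact: size_poly.
have fk k : (k < L)%N -> f`_k = a k by move=> kL; rewrite coef_poly kL.
set N := _ `^ s.
have N0 : 0 <= N by exact: powR_ge0.
have NE : N = (uavg M (fun j => cabs f.[uroot R M j] `^ (2 / s))) `^ s.
  rewrite /N; congr (_ `^ _); congr (uavg M _); apply/funext => j.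
  by rewrite /f horner_poly.
clearbody N.
(* Then [kap k / s] is the inverse of [pweight s q k] for [k >= 2], and the sum is at most
   [5 / 10 * rho ^ 2]. *)
pose kap k : R := rho ^+ k / 10.
have hS : \sum_(2 <= k < L) kap k <= rho ^+ 2 / 2.
  rewrite (big_addn 0 L 2) big_mkord.
  apply: le_trans (_ : rho ^+ 2 / 10 * \sum_(k < L - 2) rho ^+ k <= _).
    rewrite [X in _ <= X]mulr_sumr; apply: ler_sum => k _; rewrite /kap exprD.
    by rewrite le_eqVlt; apply/orP; left; apply/eqP; ring.
  have r1 : rho < 1 by lra.
  apply: le_trans (_ : rho ^+ 2 / 10 * 5 <= _); last first.
    by rewrite le_eqVlt; apply/orP; left; apply/eqP; field.
  have h1r : 0 < 1 - rho by lra.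
  have h5 : (1 - rho)^-1 <= 5 by rewrite -div1r ler_pdivrMr //; lra.
  have r2 : 0 <= rho ^+ 2 / 10 by apply: divr_ge0 => //; exact: sqr_ge0.
  exact: (ler_wpM2l r2 (le_trans (geom_le _ (ltW r0) r1) h5)).
have hS2 : rho ^+ 2 / 2 <= 2^-1.
  have : rho ^+ 2 <= 1 by rewrite exprn_ile1 ?(ltW r0) //; lra.
  lra.
have W0 : 0 <= (1 + rho ^+ 4) * N by rewrite mulr_ge0 // addr_ge0 // exprn_ge0 // ltW.
have kap0 k : 0 <= kap k by rewrite /kap divr_ge0 // exprn_ge0 // ltW.
have := combine_slices (a := fun k => cabs (a k)) s0 c0 (fun k => cabs_ge0 _) kap0 hS hS2 L1 W0.
have L0 : (0 < L)%N by exact: ltnW.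
move=> H; have {}H : cabs (a 0%N) ^+ 2 + cabs (a 1%N) ^+ 2 / s + \sum_(2 <= k < L) kap k * (cabs (a k) ^+ 2 / s) <=
    (1 + (rho ^+ 2 / 2) ^+ 2 * ((1 + s) / (2 * c * s ^+ 2))) * ((1 + rho ^+ 4) * N).
  apply: H => k /andP[k0 kL].
  have := hK f k M k0; rewrite !fk // -NE; apply.
  apply: leq_trans hM; rewrite leq_add // leq_mul2r ltnW ?orbT //.
have -> : \sum_(k < L) cabs (a k) ^+ 2 / pweight s q k =
    cabs (a 0%N) ^+ 2 + cabs (a 1%N) ^+ 2 / s + \sum_(2 <= k < L) kap k * (cabs (a k) ^+ 2 / s).
  rewrite -(big_mkord xpredT (fun k => cabs (a k) ^+ 2 / pweight s q k)).
  rewrite big_ltn // big_ltn // addrA /pweight /= divr1; congr (_ + _).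
  rewrite !big_nat; apply: eq_bigr => k /andP[k2 _].
  rewrite (gtn_eqF (ltnW k2)) (gtn_eqF k2) /kap rX powRN.
  have : q%:R `^ (k%:R / 3) != 0 :> R by rewrite gt_eqF // powR_gt0.
  by move=> qn; field; rewrite qn gt_eqF.
apply: le_trans H _.
have -> : (rho ^+ 2 / 2) ^+ 2 * ((1 + s) / (2 * c * s ^+ 2)) =
   (1 + s) / (8 * c * s ^+ 2) * rho ^+ 4 by field; rewrite !gt_eqF.
rewrite mulrA ler_wpM2r //.
have -> : q%:R `^ (- (4 / 3)) = rho ^+ 4 by rewrite rX.
rewrite [X in expR X]mulrDl mul1r expRD [X in _ <= X]mulrC; apply: ler_pM.
- have D : 0 < 8 * c * s ^+ 2 by rewrite !mulr_gt0 ?exprn_gt0.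
  by rewrite addr_ge0 // mulr_ge0 ?exprn_ge0 ?(ltW r0) // divr_ge0 ?(ltW D) //; lra.
- by rewrite addr_ge0 // exprn_ge0 // ltW.
- exact: expR_ge1Dx.
- exact: expR_ge1Dx.
Qed.

(* Minkowski's inequality in [l^s]: by duality against the weights [Y] only linear
   functionals of the [G k] have to be averaged. *)
Lemma mean_slices s (L : nat) (G : 'I_L -> R -> R) (F : R -> R) (w : 'I_L -> R)
    (mu : 'I_L -> R) (muF Gam : R) :
  1 < s -> (forall k, bmeas (G k)) -> bmeas F -> (forall k t, 0 <= G k t) ->
  (forall t, 0 <= F t) -> (forall k, 0 < w k) -> 0 < Gam ->
  (forall k, has_mean (G k) (mu k)) -> has_mean F muF ->
  (forall t, \sum_k G k t `^ s / w k <= Gam * F t `^ s) ->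
  \sum_k mu k `^ s / w k <= Gam * muF `^ s.
Proof.
move=> s1 bG bF G0 F0 w0 Gam0 hG hF H; have s0 : 0 < s by lra.
have sn : s != 0 by rewrite gt_eqF.
have mu0 k : 0 <= mu k.
  by apply: (@le_has_mean R (fun=> 0) (G k)) => //; [exact: bmeas_cst | exact: has_mean_cst].
have muF0 : 0 <= muF.
  by apply: (@le_has_mean R (fun=> 0) F) => //; [exact: bmeas_cst | exact: has_mean_cst].
pose Y k := mu k `^ s / w k.
have Y0 k : 0 <= Y k by rewrite divr_ge0 ?powR_ge0 // ltW.
set B := \sum_k _; have BE : B = \sum_k Y k by [].
clearbody B.
have B0 : 0 <= B by rewrite BE; apply: sumr_ge0 => k _; exact: Y0.
have [->|Bn] := eqVneq B 0; first by rewrite mulr_ge0 ?powR_ge0 // ltW.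
have Bp : 0 < B by rewrite lt_neqAle eq_sym Bn.
have ht : 0 < s^-1 <= 1 by rewrite invr_gt0 s0 invf_le1 //; lra.
have root (x : R) : 0 <= x -> (x `^ s) `^ s^-1 = x by move=> x0; rewrite -powRrM mulfV // powRr1.
(* The linear functional that is extremal at the means themselves: its value at [mu] is exactly [B],
   and Hölder's inequality bounds it on the [G k t] for every [t]. *)
pose e k := (w k)^-1 `^ s^-1 * Y k `^ (1 - s^-1).
have pt t : \sum_k e k * G k t <= Gam `^ s^-1 * B `^ (1 - s^-1) * F t.
  have hol := holder_sum (X := fun k => G k t `^ s / w k) (Y := Y) ht
    (fun k => divr_ge0 (powR_ge0 _ _) (ltW (w0 k))) Y0.
  rewrite -BE in hol.
  have -> : \sum_k e k * G k t = \sum_k (G k t `^ s / w k) `^ s^-1 * Y k `^ (1 - s^-1).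
    apply: eq_bigr => k _; rewrite powRM ?powR_ge0 ?invr_ge0 ?(ltW (w0 k)) // root //.
    by rewrite /e; ring.
  apply: le_trans (hol Bp) _.
  rewrite -mulrA [B `^ _ * _]mulrC mulrA ler_wpM2r ?powR_ge0 //.
  rewrite -[X in _ * X]root // -powRM ?powR_ge0 ?(ltW Gam0) //.
  apply: ge0_ler_powR; rewrite ?nnegrE ?invr_ge0 ?(ltW s0) //.
    by apply: sumr_ge0 => k _; rewrite divr_ge0 ?powR_ge0 // ltW.
  by rewrite mulr_ge0 ?powR_ge0 // ltW.
have hm : \sum_k e k * mu k <= Gam `^ s^-1 * B `^ (1 - s^-1) * muF.
  apply: (@le_has_mean R (fun t => \sum_k e k * G k t) (fun t => Gam `^ s^-1 * B `^ (1 - s^-1) * F t)) => //.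
  - by apply: bmeas_sum => k; exact: bmeasZ.
  - exact: bmeasZ.
  - by apply: has_mean_sum => k; [exact: bmeasZ | exact: has_meanZ].
  - exact: has_meanZ.
have eB : \sum_k e k * mu k = B.
  rewrite BE; apply: eq_bigr => k _.
  rewrite /e mulrAC -{1}[mu k]root // -powRM ?powR_ge0 ?invr_ge0 ?(ltW (w0 k)) //.
  rewrite [_^-1 * _]mulrC -/(Y k).
  have [->|Yn] := eqVneq (Y k) 0; first by rewrite powR0 ?mul0r // invr_eq0.
  by rewrite -powRD ?Yn ?implybT // addrC subrK powRr1.
rewrite eB in hm.
have hB : B `^ s^-1 <= Gam `^ s^-1 * muF.
  have p0 : 0 < B `^ (1 - s^-1) by rewrite powR_gt0.
  rewrite -(ler_pM2r p0) -powRD ?Bn ?implybT // [s^-1 + _]addrC subrK powRr1 //.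
  by apply: le_trans hm _; rewrite mulrAC.
have := ge0_ler_powR (ltW s0) _ _ hB.
rewrite !nnegrE powR_ge0 mulr_ge0 ?powR_ge0 // => /(_ isT isT).
rewrite powRM ?powR_ge0 // -!powRrM mulVf // powRr1 // powRr1 // ltW //.
Qed.

End CoefficientInequality.

(** * Induction over the primes *)

Section PrimeInduction.
Variable R : realType.
Implicit Types (s p t : R) (P : dpoly R) (q : nat).

Definition qchar q (w : R[i]) (n : nat) : R[i] := w ^+ logn q n.

Lemma qchar_unimodular q w : cabs w = 1 -> unimodular_char (qchar q w).
Proof.
move=> w1; split=> [|m n m0 n0|n]; rewrite /qchar ?logn1 ?expr0 //.
- by rewrite lognM // exprD.
- by rewrite cabsX w1 expr1n.
Qed.

Definition pslice q (k : nat) P : dpoly R :=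
  (P.1, fun n => if logn q n == k then P.2 n else 0).

(** The link with one variable: for fixed [t], twisting at [q] makes [P] a polynomial in the free
    unimodular variable [w]. *)
Lemma deval_qtwist P q w t :
  deval (twist P (qchar q w)) 0 t = \sum_(k < P.1.+2) deval (pslice q k P) 0 t * w ^+ k.
Proof.
have E k : deval (pslice q k P) 0 t * w ^+ k =
    \sum_(i < P.1) (pslice q k P).2 i.+1 * cis (- (t * ln i.+1%:R)) * w ^+ k.
  by rewrite devalE mulr_suml.
under eq_bigr do rewrite E; rewrite exchange_big devalE; apply: eq_bigr => i _.
have hk : (logn q i.+1 < P.1.+2)%N.
  exact: leq_trans (ltn_logl q (ltn0Sn i)) (leqW (leqW (ltn_ord i))).
rewrite (bigD1 (Ordinal hk)) //= eqxx big1 ?addr0 => [|k kn].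
  by rewrite /qchar; ring.
rewrite ifN ?mul0r //; apply: contra kn => /eqP h; apply/eqP/val_inj; by rewrite /= h.
Qed.

Lemma has_mean_uavg (I : nat) (F : nat -> R -> R) (m : R) : (0 < I)%N ->
  (forall j, bmeas (F j)) -> (forall j, has_mean (F j) m) ->
  has_mean (fun t => uavg I (fun j => F j t)) m.
Proof.
move=> I0 bF hF; rewrite /uavg.
have -> : m = I%:R^-1 * \sum_(j < I) m.
  by rewrite sumr_const card_ord -[m *+ I]mulr_natl mulKf // pnatr_eq0 -lt0n.
apply: has_meanZ; first by apply: bmeas_sum => j; exact: bF.
by apply: has_mean_sum => j; [exact: bF | exact: hF].
Qed.

(** Averaging [|P| ^ p] over the twists by roots of unity does not change its mean. For each [t]
    these twists are the values of a polynomial whose coefficients are the slices, so [prime_slice]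
    applies pointwise and [mean_slices] carries the inequality over to the means. *)
Lemma Hp_mean_slices s P q : 1 < s <= 2 -> (1 < q)%N ->
  \sum_(k < P.1.+2) Hp_mean (2 / s) (pslice q k P) `^ s / pweight s q k <=
  expR (loss s * q%:R `^ (- (4 / 3))) * Hp_mean (2 / s) P `^ s.
Proof.
move=> hs q1; have [s1 s2] := andP hs; have s0 : 0 < s by lra.
set p := 2 / s; have p0 : 0 < p by rewrite divr_gt0.
have ps : p * s = 2 by rewrite /p divfK // gt_eqF.
have hp : 0 < p <= 2 by rewrite p0 /= ler_pdivrMr //; lra.
have [K hK] := prime_slice hs q1.
(* The number of slices is [P.1.+2] so that it exceeds 1, as [prime_slice] demands, even when
   [P.1 = 0]; valuations of indices up to [P.1] are smaller. *)
pose M := (P.1.+2 + P.1.+2 * K)%N.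
have M0 : (0 < M)%N by [].
pose F t := uavg M (fun j => cabs (deval (twist P (qchar q (uroot R M j))) 0 t) `^ p).
have bF j : bmeas (fun t => cabs (deval (twist P (qchar q (uroot R M j))) 0 t) `^ p).
  exact: bmeas_cabs_powR (ltW p0).
apply: (@mean_slices _ s P.1.+2 (fun k t => cabs (deval (pslice q k P) 0 t) `^ p) F) => //.
- by move=> k; exact: bmeas_cabs_powR (ltW p0).
- by rewrite /F /uavg; apply: bmeasZ; apply: bmeas_sum => j; exact: bF.
- by move=> k t; exact: powR_ge0.
- move=> t; rewrite /F /uavg mulr_ge0 ?invr_ge0 //.
  by apply: sumr_ge0 => j _; exact: powR_ge0.
- by move=> k; apply: pweight_gt0 => //; exact: ltnW.
- exact: expR_gt0.
- by move=> k; exact: Hp_meanP.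
- apply: (has_mean_uavg M0 bF) => j.
  have hc := qchar_unimodular q (cabs_uroot R M j).
  by rewrite -(Hp_mean_twist P hp hc); exact: Hp_meanP.
- move=> t.
  have := hK P.1.+2 M (fun k => deval (pslice q k P) 0 t) isT (leqnn _).
  have -> : (fun j => cabs (\sum_(k < P.1.+2) deval (pslice q k P) 0 t * uroot R M j ^+ k) `^ (2 / s)) =
     (fun j => cabs (deval (twist P (qchar q (uroot R M j))) 0 t) `^ p).
    by apply/funext => j; rewrite deval_qtwist.
  apply: le_trans; rewrite le_eqVlt; apply/orP; left; apply/eqP.
  by apply: eq_bigr => k _; rewrite -powRrM ps powR_mulrn // cabs_ge0.
Qed.

Definition lweight s (l : seq nat) (n : nat) : R := \prod_(q <- l) pweight s q (logn q n).

(** The invariant of the induction over primes: slicing at the head of the list preserves it for the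
    tail, and for the empty list it leaves at most one nonzero coefficient. *)
Definition lsep (l : seq nat) P := forall i j, (i < P.1)%N -> (j < P.1)%N ->
  P.2 i.+1 != 0 -> P.2 j.+1 != 0 -> {in l, forall q, logn q i.+1 = logn q j.+1} -> i = j.

Lemma lweight_gt0 s l n : 0 < s -> {in l, forall q, (1 < q)%N} -> 0 < lweight s l n.
Proof.
move=> s0 hl; rewrite /lweight big_seq; apply: prodr_gt0 => q ql.
by apply: pweight_gt0 => //; exact: ltnW (hl _ ql).
Qed.

Lemma Hp_mean_single p P i : (i < P.1)%N -> 0 < p <= 2 ->
  (forall j, (j < P.1)%N -> j != i -> P.2 j.+1 = 0) -> Hp_mean p P = cabs (P.2 i.+1) `^ p.
Proof.
move=> iP hp H; apply: has_mean_unique (@Hp_meanP _ p P hp) _.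
have -> : (fun t => cabs (deval P 0 t) `^ p) = (fun=> cabs (P.2 i.+1) `^ p).
  apply/funext => t; rewrite devalE (bigD1 (Ordinal iP)) //= big1 ?addr0.
    by rewrite cabsM cabs_cis mulr1.
  by move=> j ji; rewrite H ?mul0r.
exact: has_mean_cst.
Qed.

(** Slicing at the first prime of the list reduces to its tail, at the cost of one factor
    [expR (loss s * q ^ (- 4 / 3))]. Once the list is empty only a monomial is left, whose modulus
    is constant in [t], so that equality holds. *)
Lemma lweight_ineq s l P : 1 < s <= 2 -> {in l, forall q, (1 < q)%N} -> lsep l P ->
  \sum_(i < P.1) cabs (P.2 i.+1) ^+ 2 / lweight s l i.+1 <=
  expR (loss s * \sum_(q <- l) q%:R `^ (- (4 / 3))) * Hp_mean (2 / s) P `^ s.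
Proof.
move=> hs; have [s1 s2] := andP hs; have s0 : 0 < s by lra.
have p0 : 0 < 2 / s by rewrite divr_gt0.
have ps : 2 / s * s = 2 by rewrite divfK // gt_eqF.
have hp : 0 < 2 / s <= 2 by rewrite p0 /= ler_pdivrMr //; lra.
elim: l P => [|q l IH] P hl hsep.
  rewrite big_nil mulr0 expR0 mul1r.
  have [[i iP ai]|none] := pselect (exists2 i, (i < P.1)%N & P.2 i.+1 != 0); last first.
    rewrite big1 ?powR_ge0 // => i _; rewrite (_ : P.2 i.+1 = 0) ?cabs0 ?expr0n ?mul0r //.
    by apply/eqP/negPn/negP => h; apply: none; exists i.
  have H j : (j < P.1)%N -> j != i -> P.2 j.+1 = 0.
    by move=> jP ji; apply/eqP/negPn/negP => aj; move/eqP: ji; apply; apply: hsep.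
  rewrite (Hp_mean_single iP hp H) -powRrM ps powR_mulrn ?cabs_ge0 //.
  rewrite (bigD1 (Ordinal iP)) //= big1 ?addr0; last first.
    by move=> j ji; rewrite H ?cabs0 ?expr0n ?mul0r.
  by rewrite /lweight big_nil divr1.
have q1 : (1 < q)%N by apply: hl; rewrite mem_head.
have hl' : {in l, forall q, (1 < q)%N} by move=> r rl; apply: hl; rewrite inE rl orbT.
set G := expR (loss s * \sum_(r <- l) r%:R `^ (- (4 / 3))).
have G0 : 0 < G by exact: expR_gt0.
have sepk k : lsep l (pslice q k P).
  move=> i j /= iP jP; case: (logn q i.+1 =P k) => [ki|]; last by rewrite eqxx.
  case: (logn q j.+1 =P k) => [kj|]; last by rewrite eqxx.
  move=> ai aj h; apply: hsep => // r; rewrite inE => /orP[/eqP ->|]; first by rewrite ki kj.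
  exact: h.
have step : \sum_(i < P.1) cabs (P.2 i.+1) ^+ 2 / lweight s (q :: l) i.+1 =
    \sum_(k < P.1.+2) (\sum_(i < P.1) cabs ((pslice q k P).2 i.+1) ^+ 2 / lweight s l i.+1) / pweight s q k.
  under [RHS]eq_bigr do rewrite mulr_suml.
  rewrite exchange_big /=; apply: eq_bigr => i _.
  have hk : (logn q i.+1 < P.1.+2)%N.
    exact: leq_trans (ltn_logl q (ltn0Sn i)) (leqW (leqW (ltn_ord i))).
  rewrite (bigD1 (Ordinal hk)) //= eqxx big1 ?addr0 => [|k kn]; last first.
    rewrite ifN ?cabs0 ?expr0n ?mul0r //.
    by apply: contra kn => /eqP h; apply/eqP/val_inj; rewrite /= h.
  by rewrite /lweight big_cons invfM -mulrA [_^-1 * _]mulrC.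
rewrite step big_cons mulrDr expRD -/G.
apply: le_trans (_ : \sum_(k < P.1.+2) G * (Hp_mean (2 / s) (pslice q k P) `^ s / pweight s q k) <= _).
  apply: ler_sum => k _; rewrite mulrA ler_wpM2r ?invr_ge0 ?(ltW (pweight_gt0 _ s0 (ltnW q1))) //.
  by apply: (IH (pslice q k P)).
rewrite -mulr_sumr [expR _ * G]mulrC -mulrA ler_wpM2l ?(ltW G0) //.
exact: Hp_mean_slices.
Qed.

Definition prime_upto (N : nat) : seq nat := [seq q <- index_iota 0 N.+1 | prime q].

(** The product over all primes, cut at [n] because a larger prime has valuation 0 in [n] and
    contributes the factor 1. *)
Definition mweight s (n : nat) : R := lweight s (prime_upto n) n.

Lemma prime_upto_gt1 N : {in prime_upto N, forall q, (1 < q)%N}.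
Proof. by move=> q; rewrite mem_filter => /andP[/prime_gt1]. Qed.

Lemma mweight_gt0 s n : 0 < s -> 0 < mweight s n.
Proof. by move=> s0; apply: lweight_gt0 => //; exact: prime_upto_gt1. Qed.

Lemma logn_eq0_gt q n : (0 < n)%N -> (n < q)%N -> logn q n = 0%N.
Proof.
move=> n0 nq; apply/eqP; rewrite -leqn0 leqNgt logn_gt0 mem_primes n0 /=.
by apply/negP => /andP[_ /dvdn_leq]; move=> /(_ n0); rewrite leqNgt nq.
Qed.

Lemma lweight_prime_upto s n N : (0 < n)%N -> (n <= N)%N ->
  lweight s (prime_upto N) n = mweight s n.
Proof.
move=> n0 nN; rewrite /mweight /lweight /prime_upto !big_filter.
rewrite (@big_cat_nat _ _ _ n.+1) //= [X in _ * X]big_nat_cond [X in _ * X]big1 ?mulr1 //.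
by move=> q /andP[/andP[nq _] _]; rewrite logn_eq0_gt.
Qed.

(** Comparison of a term with the integral of [t ^ (- (1 + e))] over the preceding unit interval,
    without integrals; it makes the zeta sums telescope. *)
Lemma powR_sub_ge (x y e : R) : 0 < x -> 0 < y -> y - x = 1 -> 0 < e ->
  y `^ (- (1 + e)) <= (x `^ (- e) - y `^ (- e)) / e.
Proof.
move=> x0 y0 xy e0; rewrite ler_pdivlMr //.
have ye : 0 < y `^ (- e) by rewrite powR_gt0.
have -> : y `^ (- (1 + e)) = y `^ (- e) / y.
  by rewrite opprD powRD ?(gt_eqF y0) ?implybT // powR_inv1 ?(ltW y0) // mulrC.
have -> : x `^ (- e) = y `^ (- e) * expR (- e * ln (x / y)).
  rewrite lnM ?posrE ?invr_gt0 // lnV ?posrE // /powR !gt_eqF // -expRD; congr expR; ring.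
rewrite -{3}[y `^ _]mulr1 -mulrBr -mulrA ler_pM2l //.
apply: le_trans (_ : (1 + e / y) - 1 <= _); first by rewrite addrC addKr mulrC.
rewrite lerB //; apply: le_trans (expR_ge1Dx _) _; rewrite ler_expR.
rewrite mulNr -mulrN ler_pM2l // lerNr.
have h : x / y = 1 - y^-1 by rewrite -[x](subrK y) -opprB xy mulrDl divff ?gt_eqF // mulN1r addrC.
have h0 : 0 < x / y by rewrite divr_gt0.
rewrite h; apply: le_ln1Dx; rewrite h in h0; lra.
Qed.

Lemma zeta_partial_le (e : R) N : 0 < e ->
  \sum_(1 <= n < N.+1) n%:R `^ (- (1 + e)) <= 1 + e^-1 :> R.
Proof.
move=> e0; case: N => [|N]; first by rewrite big_geq // addr_ge0 // invr_ge0 ltW.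
rewrite big_ltn // powR1 lerD2l.
suff : \sum_(2 <= n < N.+2) n%:R `^ (- (1 + e)) <= (1 - N.+1%:R `^ (- e)) / e.
  move/le_trans; apply; rewrite -[X in _ <= X]div1r ler_wpM2r ?invr_ge0 ?(ltW e0) //.
elim: N => [|N IH]; first by rewrite big_geq // powR1 subrr mul0r.
rewrite big_nat_recr //=.
apply: le_trans (lerD IH (powR_sub_ge (ltr0Sn R N) (ltr0Sn R N.+1) _ e0)) _.
  by rewrite -natrB // subSnn.
by rewrite -mulrDl addrA subrK.
Qed.

Lemma coef_ineq p : 1 <= p < 2 -> exists C : R, 0 < C /\ forall P,
  \sum_(i < P.1) cabs (P.2 i.+1) ^+ 2 / mweight (2 / p) i.+1 <= C * Hp_norm_poly p P ^+ 2.
Proof.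
move=> /andP[p1 p2]; have p0 : 0 < p by lra.
set s := 2 / p.
have s1 : 1 < s by rewrite /s ltr_pdivlMr // mul1r.
have s2 : s <= 2 by rewrite /s ler_pdivrMr //; lra.
have hs : 1 < s <= 2 by rewrite s1.
have ps : 2 / s = p by rewrite /s; field; rewrite gt_eqF.
(* The 4 bounds the sum of [q ^ (- 4 / 3)] through [zeta_partial_le] with [e = 1 / 3]. *)
exists (expR (loss s * 4)); split; first exact: expR_gt0.
move=> P; have hsep : lsep (prime_upto P.1) P.
  move=> i j iP jP _ _ H; apply: succn_inj; apply: eqn_from_log => // q.
  have [qP|qP] := leqP q P.1; last by rewrite !logn_eq0_gt // (leq_ltn_trans _ qP).
  have [pq|npq] := boolP (prime q); last by rewrite lognE (negbTE npq) [RHS]lognE (negbTE npq).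
  by apply: H; rewrite mem_filter pq mem_index_iota.
have := lweight_ineq hs (@prime_upto_gt1 P.1) hsep.
have -> : Hp_mean (2 / s) P `^ s = Hp_norm_poly p P ^+ 2.
  have hp : 1 <= p <= 2 by rewrite p1 ltW.
  rewrite ps -(Hp_norm_poly_powR P hp) -powRrM (_ : p * s = 2%:R); last by rewrite /s mulrC divfK // gt_eqF.
  by rewrite powR_mulrn // Hp_norm_poly_ge0.
have -> : \sum_(i < P.1) cabs (P.2 i.+1) ^+ 2 / lweight s (prime_upto P.1) i.+1 =
    \sum_(i < P.1) cabs (P.2 i.+1) ^+ 2 / mweight s i.+1.
  by apply: eq_bigr => i _; rewrite lweight_prime_upto.
move=> h; apply: le_trans h _; rewrite ler_wpM2r ?sqr_ge0 // ler_expR ler_wpM2l ?loss_ge0 //.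
rewrite /prime_upto big_filter.
apply: le_trans (_ : \sum_(1 <= q < P.1.+1) q%:R `^ (- (1 + 3^-1)) <= _); last first.
  by apply: le_trans (zeta_partial_le _ _) _ => //; rewrite invrK; lra.
rewrite big_mkcond [X in X <= _]big_ltn //= add0r; apply: ler_sum => q _.
case: ifP => _; last exact: powR_ge0.
by rewrite (_ : 4 / 3 = 1 + 3^-1 :> R) //; lra.
Qed.

End PrimeInduction.

(** * The summatory function of the weight *)

Section WeightSum.
Variable R : realType.
Implicit Types (s e sg : R) (q N : nat) (l : seq nat).

Lemma sum_multiples (F : nat -> R) d N : (0 < d)%N ->
  \sum_(1 <= n < N.+1 | (d %| n)%N) F n = \sum_(1 <= m < (N %/ d).+1) F (d * m)%N.
Proof.
move=> d0; elim: N => [|N IH]; first by rewrite div0n !big_geq.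
rewrite big_mkcond big_nat_recr //= -big_mkcond IH divnS //.
case: ifP => [dN|_]; last by rewrite addr0.
rewrite (_ : (true + N %/ d)%N = (N %/ d).+1) // [RHS]big_nat_recr //=; congr (_ + F _).
by rewrite mulnC -[LHS](divnK dN) divnS // dN.
Qed.

Definition coprime_to l (n : nat) := all (fun q => ~~ (q %| n)%N) l.

Arguments coprime_to : simpl never.

Lemma prime_ndvdM l q m : prime q -> {in l, forall r, prime r} -> q \notin l ->
  coprime_to l (q * m) = coprime_to l m.
Proof.
move=> pq pl ql; apply: eq_in_all => r rl; rewrite Euclid_dvdM ?pl //.
rewrite (dvdn_prime2 (pl _ rl) pq) (_ : (r == q) = false) //.
by apply/negbTE; apply: contraNneq ql => <-.
Qed.

Lemma euler_factor_le sg l q N : prime q -> {in l, forall r, prime r} -> q \notin l ->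
  (1 + q%:R `^ (- sg)) * \sum_(1 <= n < N.+1 | coprime_to (q :: l) n) n%:R `^ (- sg) <=
  \sum_(1 <= n < (q * N).+1 | coprime_to l n) n%:R `^ (- sg) :> R.
Proof.
move=> pq pl ql; have q0 := prime_gt0 pq.
rewrite [X in _ <= X](bigID (fun n => q %| n)%N) /= mulrDl mul1r [X in _ <= X]addrC.
apply: lerD.
- rewrite [X in _ <= X](@big_cat_nat _ _ _ N.+1) //=; last by rewrite ltnS leq_pmull.
  have -> : \sum_(1 <= n < N.+1 | coprime_to (q :: l) n) n%:R `^ (- sg) =
     \sum_(1 <= n < N.+1 | coprime_to l n && ~~ (q %| n)%N) n%:R `^ (- sg) :> R.
    by apply: eq_bigl => n; rewrite /coprime_to /= andbC.
  by rewrite lerDl sumr_ge0 // => n _; exact: powR_ge0.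
- have -> : \sum_(1 <= n < (q * N).+1 | coprime_to l n && (q %| n)%N) n%:R `^ (- sg) =
      \sum_(1 <= n < (q * N).+1 | (q %| n)%N) (if coprime_to l n then n%:R `^ (- sg) else 0) :> R.
    by rewrite -big_mkcondr /=; apply: eq_bigl => n; rewrite andbC.
  rewrite sum_multiples // mulKn // mulr_sumr big_mkcond /=; apply: ler_sum => n _.
  rewrite prime_ndvdM // {1}/coprime_to /= -/(coprime_to l n) natrM powRM //.
  by case: ifP => [/andP[_ ->] //|_]; case: ifP => // _; rewrite mulr_ge0 ?powR_ge0.
Qed.

(** Expanding the product and multiplying by integers coprime to the list yields distinct integers,
    all at most the product of the primes times [N]. The induction moves one prime at a time between
    the two sides. *)
Lemma euler_prod_le sg l N : {in l, forall r, prime r} -> uniq l ->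
  (\prod_(q <- l) (1 + q%:R `^ (- sg))) * \sum_(1 <= n < N.+1 | coprime_to l n) n%:R `^ (- sg) <=
  \sum_(1 <= n < ((\prod_(q <- l) q) * N).+1) n%:R `^ (- sg) :> R.
Proof.
elim: l N => [|q l IH] N pl; first by rewrite !big_nil mul1r mul1n.
move=> /= /andP[ql ul].
have pq : prime q by apply: pl; rewrite mem_head.
have pl' : {in l, forall r, prime r} by move=> r rl; apply: pl; rewrite inE rl orbT.
rewrite !big_cons -mulrA mulrCA.
have h0 : 0 <= \prod_(r <- l) (1 + r%:R `^ (- sg)) :> R.
  by apply: prodr_ge0 => r _; rewrite addr_ge0 // powR_ge0.
apply: le_trans (ler_wpM2l h0 (euler_factor_le sg N pq pl' ql)) _.
by apply: le_trans (IH (q * N)%N pl' ul) _; rewrite mulnA [(_ * q)%N]mulnC.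
Qed.

Lemma euler_prod_le_zeta e l : 0 < e -> {in l, forall r, prime r} -> uniq l ->
  \prod_(q <- l) (1 + q%:R `^ (- (1 + e))) <= 1 + e^-1 :> R.
Proof.
move=> e0 pl ul; have := euler_prod_le (1 + e) 1 pl ul.
rewrite [X in _ * X]big_mkcond big_nat1.
have -> : coprime_to l 1.
  by apply/allP => q ql; rewrite dvdn1; apply/eqP => q1; have := pl _ ql; rewrite q1.
by rewrite powR1 mulr1 => h; apply: le_trans h (zeta_partial_le _ e0).
Qed.

(** The Dirichlet convolution of [pweight] with the Möbius function on the powers of [q]: summing it
    over the powers of [q] that divide [n] gives the weight back. *)
Definition gweight s q k : R := if k is k'.+1 then pweight s q k - pweight s q k' else 1.

Lemma sum_gweight s q k : \sum_(j < k.+1) gweight s q j = pweight s q k.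
Proof.
elim: k => [|k IH]; first by rewrite big_ord_recl big_ord0 addr0.
by rewrite big_ord_recr /= IH addrC subrK.
Qed.

Lemma gweight_ge0 s q k : 1 <= s -> (0 < q)%N -> 0 <= gweight s q k.
Proof.
move=> s1 q0; have q1 : 1 <= q%:R :> R by rewrite ler1n.
case: k => [|[|k]] /=; first by rewrite ler01.
  by rewrite /pweight /= subr_ge0.
rewrite subr_ge0 /pweight /=; case: k => [|k] /=.
  have h : q%:R `^ 0 <= q%:R `^ (2 / 3) :> R by apply: ler_powR => //; rewrite divr_ge0.
  rewrite powRr0 in h; by rewrite -[X in X <= _]mulr1 ler_pM //; lra.
rewrite ler_wpM2l //; first by rewrite mulr_ge0 //; lra.
by rewrite ler_powR // ler_wpM2r ?invr_ge0 // ler_nat.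
Qed.

Lemma gweight_le s q k : 0 < s -> (0 < q)%N -> gweight s q k <= pweight s q k.
Proof.
by move=> s0 q0; case: k => [|k] //=; rewrite gerBl ltW // pweight_gt0.
Qed.

Lemma lweight_mul_prime s l q k m : prime q -> {in l, forall r, prime r} -> q \notin l ->
  (0 < m)%N -> lweight s l (q ^ k * m) = lweight s l m.
Proof.
move=> pq pl ql m0; rewrite /lweight !big_seq; apply: eq_bigr => r rl.
have qk0 : (0 < q ^ k)%N by rewrite expn_gt0 prime_gt0.
rewrite lognM // lognX (logn_prime r pq).
rewrite (_ : (r == q) = false) ?muln0 //.
by apply/negbTE; apply: contraNneq ql => <-.
Qed.

(** The weight at [q] is written as a sum of [gweight] over the powers of [q] dividing [n], which
    turns the sum into sums over multiples. Rankin's trick, bounding a count [N] by [N ^ (1 + e)],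
    makes the dependence on [N] multiplicative, so that the series at each prime splits off. *)
Lemma sum_lweight_le s e l (H : nat -> R) N : 1 <= s -> 0 < e ->
  {in l, forall r, prime r} -> uniq l ->
  (forall q K, q \in l -> \sum_(k < K) gweight s q k * q%:R `^ (- (k%:R * (1 + e))) <= H q) ->
  \sum_(1 <= n < N.+1) lweight s l n <= N%:R `^ (1 + e) * \prod_(q <- l) H q.
Proof.
move=> s1 e0; elim: l N => [|q l IH] N pl.
  move=> _ _; rewrite big_nil mulr1.
  under eq_bigr do rewrite /lweight big_nil.
  rewrite sumr_const_nat subn1 /=; case: N => [|N]; first by rewrite powR_ge0.
  by rewrite le1r_powR ?ler1n //; lra.
move=> /= /andP[ql ul] hH.
have pq : prime q by apply: pl; rewrite mem_head.
have pl' : {in l, forall r, prime r} by move=> r rl; apply: pl; rewrite inE rl orbT.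
have hH' r K : r \in l -> \sum_(k < K) gweight s r k * r%:R `^ (- (k%:R * (1 + e))) <= H r.
  by move=> rl; apply: hH; rewrite inE rl orbT.
have q0 := prime_gt0 pq.
have qR : 0 < q%:R :> R by rewrite ltr0n.
have H0 : 0 <= \prod_(r <- l) H r.
  rewrite big_seq; apply: prodr_ge0 => r rl; apply: le_trans (hH' r 0%N rl).
  by rewrite big_ord0.
have E : \sum_(1 <= n < N.+1) lweight s (q :: l) n =
   \sum_(k < N.+1) gweight s q k * \sum_(1 <= n < N.+1 | (q ^ k %| n)%N) lweight s l n.
  under [RHS]eq_bigr do rewrite mulr_sumr.
  under [RHS]eq_bigr do rewrite big_mkcond.
  rewrite exchange_big /= !big_nat; apply: eq_bigr => n /andP[n0 nN].
  rewrite /lweight big_cons -/(lweight s l n) -sum_gweight mulr_suml.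
  rewrite -(big_mkord xpredT (fun j => gweight s q j * lweight s l n)).
  rewrite -(big_mkord xpredT (fun k => if (q ^ k %| n)%N then gweight s q k * lweight s l n else 0)).
  have vN : ((logn q n).+1 <= N.+1)%N by rewrite (leq_trans (ltn_logl q n0)) // -ltnS ltnW.
  rewrite [RHS](@big_cat_nat _ _ _ (logn q n).+1) //=.
  rewrite [X in _ + X]big_nat_cond [X in _ + X]big1 ?addr0.
    rewrite !big_nat; apply: eq_bigr => k /andP[_ kv].
    by rewrite pfactor_dvdn // -ltnS kv.
  by move=> k /andP[/andP[vk _] _]; rewrite pfactor_dvdn // leqNgt vk.
rewrite E big_cons.
apply: le_trans (_ : \sum_(k < N.+1) gweight s q k * (q%:R `^ (- (k%:R * (1 + e))) * (N%:R `^ (1 + e) * \prod_(r <- l) H r)) <= _).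
  apply: ler_sum => k _; rewrite ler_wpM2l ?gweight_ge0 //.
  rewrite sum_multiples ?expn_gt0 ?q0 //.
  have -> : \sum_(1 <= m < (N %/ q ^ k).+1) lweight s l (q ^ k * m) =
      \sum_(1 <= m < (N %/ q ^ k).+1) lweight s l m.
    by rewrite !big_nat; apply: eq_bigr => m /andP[m0 _]; exact: lweight_mul_prime.
  apply: le_trans (IH _ pl' ul hH') _; rewrite mulrA ler_wpM2r //.
  have -> : q%:R `^ (- (k%:R * (1 + e))) = ((q ^ k)%N%:R^-1) `^ (1 + e) :> R.
    by rewrite natrX -powR_invn ?(ltW qR) // -powRrM mulNr.
  rewrite -powRM ?invr_ge0 //; apply: ge0_ler_powR; rewrite ?nnegrE ?mulr_ge0 ?invr_ge0 //; first lra.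
  rewrite mulrC ler_pdivlMr ?ltr0n ?expn_gt0 ?q0 // -natrM ler_nat; exact: leq_trunc_div.
have -> : \sum_(k < N.+1) gweight s q k * (q%:R `^ (- (k%:R * (1 + e))) * (N%:R `^ (1 + e) * \prod_(r <- l) H r)) =
    (\sum_(k < N.+1) gweight s q k * q%:R `^ (- (k%:R * (1 + e)))) * (N%:R `^ (1 + e) * \prod_(r <- l) H r).
  by rewrite mulr_suml; apply: eq_bigr => k _; rewrite mulrA.
rewrite [X in _ <= X]mulrCA ler_wpM2r ?mulr_ge0 ?powR_ge0 //.
by apply: hH; rewrite mem_head.
Qed.

Lemma ln1D_ge (y : R) : 0 <= y -> y - y ^+ 2 <= ln (1 + y).
Proof.
move=> y0; have y1 : 0 < 1 + y by lra.
apply: le_trans (_ : y / (1 + y) <= _).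
  rewrite ler_pdivlMr //.
  have -> : (y - y ^+ 2) * (1 + y) = y - y ^+ 3 by ring.
  by rewrite gerBl exprn_ge0.
rewrite -ler_expR lnK ?posrE //.
have h := expR_ge1Dx (- (y / (1 + y))).
have E : 1 + - (y / (1 + y)) = (1 + y)^-1 by field; rewrite gt_eqF.
rewrite E expRN in h.
by rewrite -lef_pV2 ?posrE ?expR_gt0.
Qed.

(** Up to the convergent correction, the series is [1 + (s - 1) * y] with [y = q ^ (- (1 + e))],
    hence the power [s - 1] of the factor of an Euler product. In the constant 31, the terms of
    index [k >= 2] account for [30 = 10 * 3], and the error [y ^ 2] of the logarithm for 1. *)
Lemma gweight_series_le s e q K : 1 < s <= 2 -> 0 < e -> prime q ->
  \sum_(k < K) gweight s q k * q%:R `^ (- (k%:R * (1 + e))) <=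
  (1 + q%:R `^ (- (1 + e))) `^ (s - 1) * expR (31 * s * q%:R `^ (- (4 / 3))).
Proof.
move=> /andP[s1 s2] e0 pq; have q0 := prime_gt0 pq; have q2 := prime_gt1 pq.
have qR : 0 < q%:R :> R by rewrite ltr0n.
have q1R : 1 <= q%:R :> R by rewrite ler1n.
have s0 : 0 < s by lra.
set y := q%:R `^ (- (1 + e)).
have y0 : 0 <= y by exact: powR_ge0.
pose rho : R := q%:R `^ (- (2 / 3)).
have r0 : 0 < rho by rewrite powR_gt0.
have rX n : rho ^+ n = q%:R `^ (- (n%:R * (2 / 3))).
  by rewrite -powR_mulrn ?(ltW r0) // -powRrM; congr (_ `^ _); ring.
have r2 : q%:R `^ (- (4 / 3)) = rho ^+ 2.
  by rewrite rX; congr (_ `^ (- _)); field.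
have r45 : rho <= 2 / 3.
  rewrite -(@ler_pXn2r _ 3) ?nnegrE ?(ltW r0) ?divr_ge0 // rX.
  rewrite (_ : 3%:R * (2 / 3) = 2%:R :> R); last by field.
  rewrite powR_invn ?(ltW qR) //.
  apply: le_trans (_ : 2 ^- 2 <= _); last by rewrite !exprS !expr0; lra.
  by rewrite lef_pV2 ?posrE ?exprn_gt0 // lerXn2r ?nnegrE // ler_nat.
have ysq : y ^+ 2 <= rho ^+ 2.
  rewrite rX -powR_mulrn // -powRrM; apply: ler_powR => //.
  lra.
rewrite r2; clearbody rho.
have tail : \sum_(2 <= k < K) gweight s q k * q%:R `^ (- (k%:R * (1 + e))) <= 30 * s * rho ^+ 2.
  apply: le_trans (_ : \sum_(2 <= k < K) 10 * s * rho ^+ k <= _).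
    rewrite !big_nat; apply: ler_sum => k /andP[k2 _].
    apply: le_trans (_ : pweight s q k * q%:R `^ (- k%:R) <= _).
      apply: ler_pM; rewrite ?powR_ge0 ?gweight_ge0 ?(ltW s1) ?gweight_le //.
      by apply: ler_powR => //; rewrite lerN2 ler_peMr //; lra.
    rewrite /pweight (gtn_eqF (ltnW k2)) (gtn_eqF k2) -mulrA rX -powRD ?(gt_eqF qR) ?implybT //.
    by rewrite (_ : k%:R / 3 + - k%:R = - (k%:R * (2 / 3))) //; field.
  rewrite (big_addn 0 K 2) big_mkord.
  have r1 : rho < 1 by lra.
  have -> : \sum_(i < K - 2) 10 * s * rho ^+ (i + 2) = 10 * s * rho ^+ 2 * \sum_(i < K - 2) rho ^+ i.
    by rewrite mulr_sumr; apply: eq_bigr => i _; rewrite exprD; ring.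
  have h0 : 0 <= 10 * s * rho ^+ 2 by rewrite !mulr_ge0 ?sqr_ge0 // ltW.
  have h3 : (1 - rho)^-1 <= 3 by rewrite -div1r ler_pdivrMr; lra.
  apply: le_trans (ler_wpM2l h0 (le_trans (geom_le _ (ltW r0) r1) h3)) _.
  by rewrite le_eqVlt; apply/orP; left; apply/eqP; ring.
have head : \sum_(k < K) gweight s q k * q%:R `^ (- (k%:R * (1 + e))) <=
    1 + (s - 1) * y + 30 * s * rho ^+ 2.
  rewrite -(big_mkord xpredT (fun k => gweight s q k * q%:R `^ (- (k%:R * (1 + e))))).
  have rho0 : 0 <= 30 * s * rho ^+ 2 by rewrite !mulr_ge0 ?sqr_ge0 // ltW.
  have sy : 0 <= (s - 1) * y by rewrite mulr_ge0 //; lra.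
  have g0 : gweight s q 0 * q%:R `^ (- (0%:R * (1 + e))) = 1 by rewrite mul0r oppr0 powRr0 mulr1.
  have g1 : gweight s q 1 * q%:R `^ (- (1%:R * (1 + e))) = (s - 1) * y by rewrite mul1r.
  case: K tail => [|[|K]] tail.
  - by rewrite big_geq //; lra.
  - by rewrite big_nat1 g0; lra.
  - by rewrite big_ltn // big_ltn // g0 g1; lra.
apply: le_trans head _.
have -> : (1 + y) `^ (s - 1) = expR ((s - 1) * ln (1 + y)).
  by rewrite /powR gt_eqF //; lra.
rewrite -addrA -expRD; apply: le_trans (expR_ge1Dx _) _; rewrite ler_expR.
have sm : 0 <= s - 1 by lra.
have h1 := ler_wpM2l sm (ln1D_ge y0); have h2 := ler_wpM2l sm ysq.
have h3 : 0 <= rho ^+ 2 by exact: sqr_ge0.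
move: (rho ^+ 2) (y ^+ 2) (ln (1 + y)) h1 h2 h3 => a b c h1 h2 h3.
lra.
Qed.

(** The choice [e = 1 / (1 + ln N)] keeps [N ^ e] below [expR 1], while the Euler product is at most
    [1 + 1 / e = 2 + ln N]; its power [s - 1] is the one claimed. *)
Lemma mweight_sum_le s : 1 < s <= 2 -> exists C : R, 0 < C /\ forall N, (0 < N)%N ->
  \sum_(1 <= n < N.+1) mweight s n <= C * N%:R * (1 + ln N%:R) `^ (s - 1).
Proof.
move=> hs; have [s1 s2] := andP hs.
exists (expR 1 * 2 `^ (s - 1) * expR (31 * s * 4)).
split; first by rewrite !mulr_gt0 ?expR_gt0 ?powR_gt0.
move=> N N0; have NR : 0 < N%:R :> R by rewrite ltr0n.
have lN : 0 <= ln N%:R :> R by rewrite ln_ge0 // ler1n.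
set L := 1 + ln N%:R; have L0 : 0 < L by rewrite /L; lra.
pose l := prime_upto N.
have pl : {in l, forall r, prime r} by move=> r; rewrite mem_filter => /andP[].
have ul : uniq l by rewrite filter_uniq // iota_uniq.
have e0 : 0 < L^-1 by rewrite invr_gt0.
pose H (q : nat) : R := (1 + q%:R `^ (- (1 + L^-1))) `^ (s - 1) * expR (31 * s * q%:R `^ (- (4 / 3))).
have -> : \sum_(1 <= n < N.+1) mweight s n = \sum_(1 <= n < N.+1) lweight s l n.
  by rewrite !big_nat; apply: eq_bigr => n /andP[n0 nN]; rewrite lweight_prime_upto.
have := sum_lweight_le (H := H) N (ltW s1) e0 pl ul.
move=> h; apply: le_trans (h _) _ => {h}.
  by move=> q K ql; apply: gweight_series_le => //; exact: pl.
have hH : \prod_(q <- l) H q <= (2 * L) `^ (s - 1) * expR (31 * s * 4).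
  rewrite /H big_split /=.
  have -> : \prod_(q <- l) (1 + q%:R `^ (- (1 + L^-1))) `^ (s - 1) =
      (\prod_(q <- l) (1 + q%:R `^ (- (1 + L^-1)))) `^ (s - 1) :> R.
    elim: (l) => [|q l' IH]; first by rewrite !big_nil powR1.
    rewrite !big_cons IH powRM //.
    by apply: prodr_ge0 => r _; rewrite addr_ge0 // powR_ge0.
  have -> : \prod_(q <- l) expR (31 * s * q%:R `^ (- (4 / 3))) =
      expR (31 * s * \sum_(q <- l) q%:R `^ (- (4 / 3))) :> R.
    by rewrite mulr_sumr (big_morph _ (@expRD R) (@expR0 R)).
  apply: ler_pM; rewrite ?powR_ge0 ?expR_ge0 //.
    apply: ge0_ler_powR; rewrite ?nnegrE ?subr_ge0 ?(ltW s1) //.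
    + by apply: prodr_ge0 => r _; rewrite addr_ge0 // powR_ge0.
    + by rewrite mulr_ge0 // ltW.
    + by apply: le_trans (euler_prod_le_zeta e0 pl ul) _; rewrite invrK /L; lra.
  rewrite ler_expR ler_wpM2l ?mulr_ge0 //; first lra.
  rewrite /l /prime_upto big_filter.
  apply: le_trans (_ : \sum_(1 <= q < N.+1) q%:R `^ (- (1 + 3^-1)) <= _); last first.
    by apply: le_trans (zeta_partial_le _ _) _ => //; rewrite invrK; lra.
  rewrite big_mkcond [X in X <= _]big_ltn //= add0r; apply: ler_sum => q _.
  case: ifP => _; last exact: powR_ge0.
  by rewrite (_ : 4 / 3 = 1 + 3^-1 :> R) //; lra.
have hN : N%:R `^ (1 + L^-1) <= N%:R * expR 1.
  rewrite powRD ?(gt_eqF NR) ?implybT // powRr1 ?(ltW NR) // ler_wpM2l //.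
  rewrite /powR gt_eqF // ler_expR mulrC ler_pdivrMr // mul1r /L; lra.
have p0 : 0 <= \prod_(q <- l) H q.
  by apply: prodr_ge0 => q _; rewrite mulr_ge0 ?powR_ge0 ?expR_ge0.
apply: le_trans (ler_pM (powR_ge0 _ _) p0 hN hH) _.
rewrite powRM ?(ltW L0) // le_eqVlt; apply/orP; left; apply/eqP; ring.
Qed.

End WeightSum.

(** * The embedding *)

Section CauchyKernel.
Variable R : realType.
Implicit Types (z : R[i]) (t T l : R).

Definition ker t : R := (1 + t ^+ 2)^-1.

Lemma sqr1_gt0 t : 0 < 1 + t ^+ 2.
Proof. by rewrite ltr_pwDl // sqr_ge0. Qed.

Lemma ker_gt0 t : 0 < ker t.
Proof. by rewrite invr_gt0 sqr1_gt0. Qed.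

Lemma continuous_ker : continuous ker.
Proof.
move=> t; apply: cvgV; first by rewrite gt_eqF // sqr1_gt0.
by apply: cvgD; [exact: cvg_cst | apply: exprn_continuous].
Qed.

Lemma bmeas_ker : bmeas ker.
Proof.
split; first by apply: continuous_measurable_fun; exact: continuous_ker.
exists 1 => t; rewrite ger0_norm ?(ltW (ker_gt0 t)) // invf_le1 ?sqr1_gt0 //.
by rewrite lerDl sqr_ge0.
Qed.

Lemma Rintegral_ker_le T : 0 < T -> Rintegral lebesgue_measure `[- T, T] ker <= pi.
Proof.
move=> T0; have TT : - T < T by lra.
have dF (x : R) : is_derive x 1 (@atan R) (ker x) by exact: is_derive1_atan.
rewrite (Rintegral_FTC TT dF continuous_ker).
by have := atan_ltpi2 T; have := atan_gtNpi2 (- T); lra.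
Qed.

Lemma Re_cis_le z (x : R) : complex.Re (z * cis x) <= cabs z.
Proof.
apply: le_trans (ler_norm _) _; apply: le_trans (normr_Re_le _) _.
by rewrite cabsM cabs_cis mulr1.
Qed.

Lemma Rintegral_ker_cis_triv z l T : 0 < T ->
  Rintegral lebesgue_measure `[- T, T] (fun t => ker t * complex.Re (z * cis (l * t)))
    <= pi * cabs z.
Proof.
move=> T0; apply: le_trans (_ : Rintegral lebesgue_measure `[- T, T] (fun t => cabs z * ker t) <= _).
  apply: le_Rintegral => //.
  - by apply: bmeas_integrable; apply: bmeasM; [exact: bmeas_ker | exact: bmeas_Re_cis].
  - by apply: bmeas_integrable; apply: bmeasZ; exact: bmeas_ker.
  by move=> t _; rewrite mulrC ler_wpM2r ?(ltW (ker_gt0 t)) // Re_cis_le.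
rewrite RintegralZl //; last by apply: bmeas_integrable; exact: bmeas_ker.
by rewrite mulrC ler_wpM2r ?cabs_ge0 // Rintegral_ker_le.
Qed.

Definition dker t : R := - (2 * t) * ker t ^+ 2.
Definition ddker t : R := (6 * t ^+ 2 - 2) * ker t ^+ 3.

Lemma is_derive_ker t : is_derive t 1 ker (dker t).
Proof.
have n0 : 1 + t ^+ 2 != 0 by rewrite gt_eqF // sqr1_gt0.
have h : is_derive t 1 (fun x : R => 1 + x ^+ 2) (2 * t).
  apply: is_derive_eq; rewrite /GRing.scale /= !mulr1 add0r; ring.
have h4 : is_derive t 1 ker (- (1 + t ^+ 2) ^- 2 *: (2 * t)) by exact: (is_deriveV (f := fun x : R => 1 + x ^+ 2) n0 h).
by apply: is_derive_eq h4 _; rewrite /dker /ker /GRing.scale /=; field.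
Qed.

Lemma is_derive_dker t : is_derive t 1 dker (ddker t).
Proof.
have h := is_derive_ker t; have n0 : 1 + t ^+ 2 != 0 by rewrite gt_eqF // sqr1_gt0.
have h2 : is_derive t 1 (fun x : R => - (2 * x)) (- 2).
  by apply: is_derive_eq; rewrite /GRing.scale /= mulr1.
have h3 := is_deriveM h2 (is_deriveX 2 h).
apply: is_derive_eq h3 _.
have -> : (ker ^+ 2) t = ker t ^+ 2 by [].
by rewrite /ddker /dker /ker /GRing.scale /=; field.
Qed.

Lemma normr_dker_le t : `|dker t| <= ker t.
Proof.
have k0 := ker_gt0 t; rewrite /dker normrM normrX (ger0_norm (ltW k0)) expr2 mulrA.
rewrite -[leRHS]mul1r ler_wpM2r ?(ltW k0) // /ker ler_pdivrMr ?sqr1_gt0 // mul1r normrN.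
by have := sqr_ge0 (t - 1); have := sqr_ge0 (t + 1); rewrite ler_norml => *; apply/andP; split; nra.
Qed.

Lemma normr_ddker_le t : `|ddker t| <= 6 * ker t.
Proof.
have k0 := ker_gt0 t; rewrite /ddker normrM normrX (ger0_norm (ltW k0)) [ker t ^+ 3]exprSr mulrA.
rewrite ler_wpM2r ?(ltW k0) // /ker exprVn ler_pdivrMr ?exprn_gt0 ?sqr1_gt0 //.
by rewrite ler_norml; apply/andP; split; nra.
Qed.

(** Two integrations by parts give a decay in [l ^ (- 2)], enough for summability over blocks. The
    boundary terms are kept as a multiple of [ker T], which vanishes in the limit of large [T]. *)
Lemma Rintegral_ker_cis_le z l T : 0 < T -> 1 <= `|l| ->
  Rintegral lebesgue_measure `[- T, T] (fun t => ker t * complex.Re (z * cis (l * t)))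
    <= cabs z * (4 * ker T + 6 * pi / l ^+ 2).
Proof.
move=> T0 l1; have l0 : l != 0 by apply: contraTneq l1 => ->; rewrite normr0; lra.
have TT : - T < T by lra.
have c0 := cabs_ge0 z.
pose re t := complex.Re z * cos (l * t) - complex.Im z * sin (l * t).
pose im t := complex.Re z * sin (l * t) + complex.Im z * cos (l * t).
have reE t : complex.Re (z * cis (l * t)) = re t by rewrite Re_mul.
have imE t : complex.Im (z * cis (l * t)) = im t by rewrite /im; case: (z) => a b /=; ring.
have re_le t : `|re t| <= cabs z.
  by rewrite -reE; apply: le_trans (normr_Re_le _) _; rewrite cabsM cabs_cis mulr1.
have im_le t : `|im t| <= cabs z.
  by rewrite -imE; apply: le_trans (normr_Im_le _) _; rewrite cabsM cabs_cis mulr1.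
have dl (x : R) : is_derive x 1 (fun t : R => l * t) l.
  by apply: is_derive_eq (is_deriveZ _ _) _; rewrite /GRing.scale /= mulr1.
have dc (x : R) := is_derive1_comp (is_derive_cos (l * x)) (dl x).
have ds (x : R) := is_derive1_comp (is_derive_sin (l * x)) (dl x).
have dre (x : R) : is_derive x 1 re (- l * im x).
  have h := is_deriveB (is_deriveZ (complex.Re z) (dc x)) (is_deriveZ (complex.Im z) (ds x)).
  by apply: is_derive_eq h _; rewrite /im /GRing.scale /=; ring.
have dim (x : R) : is_derive x 1 im (l * re x).
  have h := is_deriveD (is_deriveZ (complex.Re z) (ds x)) (is_deriveZ (complex.Im z) (dc x)).
  by apply: is_derive_eq h _; rewrite /re /GRing.scale /=; ring.
(* [F] comes from integrating by parts twice; its arctangent term makes [F'] dominate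
   the integrand. *)
pose F t := l^-1 * (ker t * im t) + (l ^+ 2)^-1 * (dker t * re t + 6 * cabs z * atan t).
pose f t := ker t * re t + (l ^+ 2)^-1 * (ddker t * re t + 6 * cabs z * ker t).
have dF (x : R) : is_derive x 1 F (f x).
  have h1 := is_deriveZ l^-1 (is_deriveM (is_derive_ker x) (dim x)).
  have h2 := is_deriveD (is_deriveM (is_derive_dker x) (dre x)) (is_deriveZ (6 * cabs z) (is_derive1_atan x)).
  apply: is_derive_eq (is_deriveD h1 (is_deriveZ (l ^+ 2)^-1 h2)) _.
  by rewrite /f /GRing.scale /= -/(ker x); field.
have cont (g dg : R -> R) : (forall x : R, is_derive x 1 g (dg x)) -> continuous g.
  by move=> h x; apply: differentiable_continuous; apply/derivable1_diffP; case: (h x).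
have cre := cont _ _ dre.
have cdd : continuous ddker.
  move=> x; apply: cvgM; last by exact: (@continuous_comp _ _ _ ker (fun y => y ^+ 3) x (@continuous_ker x) (@exprn_continuous _ 3 _)).
  by apply: cvgB; [apply: cvgMr; exact: exprn_continuous | exact: cvg_cst].
have cf : continuous f.
  move=> x; apply: cvgD; first by apply: cvgM; [exact: continuous_ker | exact: cre].
  apply: cvgMr; apply: cvgD; first by apply: cvgM; [exact: cdd | exact: cre].
  by apply: cvgMr; exact: continuous_ker.
have l20 : 0 <= (l ^+ 2)^-1 by rewrite invr_ge0 sqr_ge0.
under eq_Rintegral do rewrite reE.
apply: le_trans (_ : Rintegral lebesgue_measure `[- T, T] f <= _).
  apply: le_Rintegral => //.
  - apply: bmeas_integrable; apply: bmeasM; first exact: bmeas_ker.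
    by have := bmeas_Re_cis z l; under eq_fun do rewrite reE.
  - apply: continuous_compact_integrable; first exact: segment_compact.
    exact: continuous_subspaceT.
  move=> t _; rewrite lerDl mulr_ge0 //.
  have : `|ddker t * re t| <= 6 * ker t * cabs z.
    by rewrite normrM ler_pM // normr_ddker_le.
  by rewrite ler_norml => /andP[h _]; lra.
rewrite (Rintegral_FTC TT dF cf).
have kN : ker (- T) = ker T by rewrite /ker sqrrN.
have k0 := ker_gt0 T.
have li1 : `|l|^-1 <= 1 by rewrite invf_le1 // (lt_le_trans _ l1).
have l21 : (l ^+ 2)^-1 <= 1.
  rewrite invf_le1; last by rewrite lt_def sqrf_eq0 l0 sqr_ge0.
  by rewrite -real_normK ?num_real // -[leLHS](expr1n _ 2) lerXn2r ?nnegrE.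
have hb t : `|l^-1 * (ker t * im t)| <= ker t * cabs z.
  rewrite normrM normfV -[leRHS]mul1r ler_pM ?invr_ge0 //.
  by rewrite normrM (ger0_norm (ltW (ker_gt0 t))) ler_wpM2l ?(ltW (ker_gt0 t)).
have hd t : `|(l ^+ 2)^-1 * (dker t * re t)| <= ker t * cabs z.
  rewrite normrM (ger0_norm l20) -[leRHS]mul1r ler_pM //.
  by rewrite normrM ler_pM // normr_dker_le.
have ha : (l ^+ 2)^-1 * (6 * cabs z * (atan T - atan (- T))) <= (l ^+ 2)^-1 * (6 * cabs z * pi).
  rewrite ler_wpM2l // ler_wpM2l ?mulr_ge0 //.
  by have := atan_ltpi2 T; have := atan_gtNpi2 (- T); lra.
have -> : F T - F (- T) = l^-1 * (ker T * im T) - l^-1 * (ker (- T) * im (- T)) +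
   ((l ^+ 2)^-1 * (dker T * re T) - (l ^+ 2)^-1 * (dker (- T) * re (- T))) +
   (l ^+ 2)^-1 * (6 * cabs z * (atan T - atan (- T))) by rewrite /F; ring.
have := hb T; have := hb (- T); have := hd T; have := hd (- T); rewrite kN !ler_norml.
move=> /andP[h1 h2] /andP[h3 h4] /andP[h5 h6] /andP[h7 h8].
apply: le_trans (lerD (lerD (lerB h8 h5) (lerB h4 h1)) ha) _.
rewrite le_eqVlt; apply/orP; left; apply/eqP; ring.
Qed.

(** Here [d] is the distance between the blocks of two frequencies differing by [l], so [|l|] is at
    least [d - 1]. For [d <= 1] the trivial bound suffices; for [d >= 2] one has
    [1 + d ^ 2 <= 5 * l ^ 2], whence [30 = 6 * 5]. *)
Lemma Rintegral_ker_cis_block z l T (d : R) : 0 < T -> 0 <= d -> (d <= 1 \/ 2 <= d) -> d <= `|l| + 1 ->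
  Rintegral lebesgue_measure `[- T, T] (fun t => ker t * complex.Re (z * cis (l * t)))
    <= cabs z * (4 * ker T + 30 * pi / (1 + d ^+ 2)).
Proof.
move=> T0 d0 hd dl; have c0 := cabs_ge0 z; have k0 := ker_gt0 T; have p0 := @pi_ge0 R.
have D0 : 0 < 1 + d ^+ 2 by rewrite sqr1_gt0.
case: hd => hd.
  apply: le_trans (Rintegral_ker_cis_triv _ _ T0) _; rewrite mulrC ler_wpM2l //.
  rewrite -[leLHS]add0r lerD ?mulr_ge0 ?(ltW k0) // ler_pdivlMr //.
  by rewrite mulrC ler_wpM2r //; nra.
have l1 : 1 <= `|l| by lra.
apply: le_trans (Rintegral_ker_cis_le z T0 l1) _; rewrite ler_wpM2l // lerD2l.
have l20 : 0 < l ^+ 2 by rewrite -real_normK ?num_real // exprn_gt0 //; lra.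
rewrite ler_pdivrMr // mulrAC ler_pdivlMr //.
have : 1 + d ^+ 2 <= 5 * l ^+ 2.
  by rewrite -(@real_normK _ l) ?num_real //; move: (`|l|) l1 dl => x l1 dl; nra.
by move=> h; rewrite mulrAC [leRHS]mulrAC ler_wpM2r //; lra.
Qed.

(** Each term is at most an increment of the bounded function [4 x / (1 + |x|)], and the increments
    telescope to at most 8. *)
Lemma schur_row (k : R) (K : nat) : k \is a Num.int ->
  \sum_(l < K) (1 + (k - l%:R) ^+ 2)^-1 <= 8 :> R.
Proof.
move=> kint.
pose phi (x : R) : R := 4 * (x / (1 + `|x|)).
have phi_le x : `|phi x| <= 4.
  rewrite /phi normrM ger0_norm // -[leRHS]mulr1 ler_wpM2l // normrM normfV.
  have h : 0 < 1 + `|x| by rewrite ltr_pwDl.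
  by rewrite [`|1 + _|]ger0_norm ?(ltW h) // ler_pdivrMr // mul1r lerDr.
have step (l : nat) : (1 + (k - l%:R) ^+ 2)^-1 <= phi (l.+1%:R - k) - phi (l%:R - k).
  have -> : k - l%:R = - (l%:R - k) by ring.
  have -> : l.+1%:R - k = (l%:R - k) + 1 by rewrite -natr1; ring.
  rewrite sqrrN; have : l%:R - k \is a Num.int by rewrite rpredB // natr_int.
  move: (l%:R - k) => x /intrP[m ->]; rewrite /phi.
  (* Integrality of [x] excludes the interval between [- 1] and 0, on which [x] and [x + 1] have
     different signs. *)
  have [m0|m0] := leP 0 m.
    have x0 : 0 <= m%:~R :> R by rewrite ler0z.
    move: (m%:~R : R) x0 => {}x x0.
    rewrite !ger0_norm //; last by lra.
    have -> : 4 * ((x + 1) / (1 + (x + 1))) - 4 * (x / (1 + x)) = 4 / ((1 + (x + 1)) * (1 + x)).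
      by field; apply/andP; split; rewrite gt_eqF //; lra.
    rewrite ler_pdivlMr; last by rewrite mulr_gt0 //; lra.
    by rewrite mulrC ler_pdivrMr ?sqr1_gt0 //; nra.
  have x0 : m%:~R <= -1 :> R by have : (m + 1 <= 0)%R by [lia]; rewrite -(ler_int R) rmorphD /=; lra.
  move: (m%:~R : R) x0 => {}x x0.
  rewrite !ler0_norm //; [|lra|lra].
  have -> : 4 * ((x + 1) / (1 + - (x + 1))) - 4 * (x / (1 + - x)) = 4 / ((1 - (x + 1)) * (1 - x)).
    by field; apply/andP; split; rewrite gt_eqF //; lra.
  rewrite ler_pdivlMr; last by rewrite mulr_gt0 //; lra.
  by rewrite mulrC ler_pdivrMr ?sqr1_gt0 //; nra.
apply: le_trans (ler_sum _ (fun (l : 'I_K) _ => step l)) _.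
rewrite -(big_mkord xpredT (fun l : nat => phi (l.+1%:R - k) - phi (l%:R - k))) telescope_sumr //.
have := phi_le (K%:R - k); have := phi_le (0%:R - k); rewrite !ler_norml => /andP[? ?] /andP[? ?]; lra.
Qed.

Lemma schur_test (K : nat) (b : 'I_K -> R) :
  \sum_k \sum_l b k * b l / (1 + (k%:R - l%:R) ^+ 2) <= 8 * \sum_k b k ^+ 2.
Proof.
pose w (k l : 'I_K) : R := (1 + (k%:R - l%:R) ^+ 2)^-1.
have w0 k j : 0 <= w k j by rewrite invr_ge0 ltW // sqr1_gt0.
apply: le_trans (_ : \sum_k \sum_l (b k ^+ 2 * w k l / 2 + b l ^+ 2 * w k l / 2) <= _).
  apply: ler_sum => k _; apply: ler_sum => l _; rewrite -/(w k l) -!mulrDl [leRHS]mulrAC ler_wpM2r //.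
  by have := sqr_ge0 (b k - b l); nra.
under eq_bigr do rewrite big_split /=.
rewrite big_split /= [X in _ + X]exchange_big /= -big_split /= mulr_sumr.
apply: ler_sum => k _.
have -> : \sum_i b k ^+ 2 * w k i / 2 = b k ^+ 2 * (\sum_i w k i) / 2.
  by rewrite -mulr_suml mulr_sumr.
have -> : \sum_i b k ^+ 2 * w i k / 2 = b k ^+ 2 * (\sum_i w k i) / 2.
  rewrite -mulr_suml mulr_sumr; congr (_ / _); apply: eq_bigr => i _.
  by rewrite /w -[_ - _]opprB sqrrN.
have := @schur_row k%:R K (natr_int _ _); rewrite -/(w k _) => h.
have h2 : \sum_i w k i <= 8 by exact: h.
have := sqr_ge0 (b k); move: (b k ^+ 2) (\sum_i w k i) h2 => x y; nra.
Qed.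

Lemma Rintegral_sum (I : Type) (s : seq I) (F : I -> R -> R) (u v : R) :
  (forall i, bmeas (F i)) ->
  Rintegral lebesgue_measure `[u, v] (fun t => \sum_(i <- s) F i t) =
  \sum_(i <- s) Rintegral lebesgue_measure `[u, v] (F i).
Proof.
move=> hF; elim: s => [|i s IH].
  by under eq_Rintegral do rewrite big_nil; rewrite big_nil Rintegral_cst // mul0r.
under eq_Rintegral do rewrite big_cons.
rewrite big_cons -IH RintegralD //; apply: bmeas_integrable => //.
exact: bmeas_sum.
Qed.

(** The square is expanded and each pair of frequencies bounded by the distance of its blocks;
    Schur's test then leaves the diagonal blocks only, with [240 = 30 * 8]. *)
Lemma Rintegral_ker_trig_le (N K : nat) (z : 'I_N -> R[i]) (l : 'I_N -> R) (B : 'I_N -> 'I_K) T :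
  0 < T -> (forall i, (B i)%:R <= l i < (B i).+1%:R) ->
  Rintegral lebesgue_measure `[- T, T]
      (fun t => ker t * cabs (\sum_i z i * cis (l i * t)) ^+ 2) <=
    240 * pi * \sum_k (\sum_(i | B i == k) cabs (z i)) ^+ 2 +
    4 * ker T * (\sum_i cabs (z i)) ^+ 2.
Proof.
move=> T0 hB.
pose a i := cabs (z i).
pose F (ij : 'I_N * 'I_N) t := ker t * complex.Re ((z ij.1 * conjc (z ij.2)) * cis ((l ij.1 - l ij.2) * t)).
have bF ij : bmeas (F ij) by apply: bmeasM; [exact: bmeas_ker | exact: bmeas_Re_cis].
have sqE t : ker t * cabs (\sum_i z i * cis (l i * t)) ^+ 2 = \sum_ij F ij t.
  rewrite -mulr_sumr -Re_sum; congr (_ * _).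
  have -> : \sum_(i : 'I_N * 'I_N) z i.1 * conjc (z i.2) * cis ((l i.1 - l i.2) * t) =
     (\sum_i z i * cis (l i * t)) * conjc (\sum_i z i * cis (l i * t)).
    rewrite conj_sum mulr_suml; under [RHS]eq_bigr do rewrite mulr_sumr.
    rewrite pair_big /=; apply: eq_bigr => -[i j] _ /=.
    by rewrite conjM mulrBl cisD cisN; ring.
  by rewrite mul_conj_cabs.
under eq_Rintegral do rewrite sqE.
rewrite Rintegral_sum //.
pose w (i j : 'I_N) : R := (1 + ((B i)%:R - (B j)%:R) ^+ 2)^-1.
apply: le_trans (_ : \sum_(ij : 'I_N * 'I_N) a ij.1 * a ij.2 * (4 * ker T + 30 * pi * w ij.1 ij.2) <= _).
  apply: ler_sum => -[i j] _ /=.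
  have -> : a i * a j = cabs (z i * conjc (z j)) by rewrite cabsM cabs_conj.
  have := hB i; have := hB j; rewrite -[(B i).+1%:R]natr1 -[(B j).+1%:R]natr1 => /andP[hj1 hj2] /andP[hi1 hi2].
  have -> : w i j = (1 + `|(B i)%:R - (B j)%:R| ^+ 2)^-1 by rewrite real_normK ?num_real.
  apply: (@Rintegral_ker_cis_block (z i * conjc (z j)) (l i - l j) T) => //.
    have [ij|/ltnW ij] := leqP (B i) (B j).
      rewrite distrC -natrB // ger0_norm // (ler_nat R _ 1) (ler_nat R 2).
      by case: leqP => h; [left|right].
    rewrite -natrB // ger0_norm // (ler_nat R _ 1) (ler_nat R 2).
    by case: leqP => h; [left|right].
  by have := ler_norm (l i - l j); have := ler_norm (l j - l i); rewrite distrC ler_norml => ? ?; apply/andP; split; lra.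
have -> : \sum_(ij : 'I_N * 'I_N) a ij.1 * a ij.2 * (4 * ker T + 30 * pi * w ij.1 ij.2) =
    30 * pi * (\sum_i \sum_j a i * a j * w i j) + 4 * ker T * (\sum_i a i) ^+ 2.
  rewrite expr2 mulr_suml; under [\sum_i a i * \sum_i _]eq_bigr do rewrite mulr_sumr.
  rewrite !pair_big /= !mulr_sumr -big_split /=; apply: eq_bigr => -[i j] _ /=; ring.
rewrite lerD2r -[leRHS]mulrA.
have -> : 240 * (pi * \sum_k (\sum_(i | B i == k) a i) ^+ 2) =
   30 * pi * (8 * \sum_k (\sum_(i | B i == k) a i) ^+ 2) by ring.
rewrite ler_wpM2l ?mulr_ge0 ?pi_ge0 //; apply: le_trans (schur_test _).
rewrite le_eqVlt; apply/orP; left; apply/eqP.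
rewrite (partition_big B xpredT) //=; apply: eq_bigr => k _.
rewrite [RHS](eq_bigr (fun l0 : 'I_K => \sum_(i | B i == k) \sum_(j | B j == l0) a i * a j * w i j)).
  rewrite [RHS]exchange_big /=; apply: eq_bigr => i _.
  by rewrite (partition_big B xpredT).
move=> l0 _; rewrite -mulrA mulr_suml; apply: eq_bigr => i /eqP hi.
rewrite mulr_suml mulr_sumr; apply: eq_bigr => j /eqP hj.
by rewrite /w hi hj mulrA.
Qed.

End CauchyKernel.

(** * Mean squares on vertical lines and their integration *)

Section Slices.
Variable R : realType.
Local Open Scope complex_scope.

Lemma ge0_integral_exhaust_le (F : (set R)^nat) (f : R -> \bar R) (C : \bar R) :
  nondecreasing_seq F -> (forall i, measurable (F i)) ->
  measurable_fun (\bigcup_i F i) f -> (forall x, (0 <= f x)%E) ->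
  (forall i, (\int[lebesgue_measure]_(x in F i) f x <= C)%E) ->
  (\int[lebesgue_measure]_(x in \bigcup_i F i) f x <= C)%E.
Proof.
move=> ndF mF mf f0 hC.
have mfi i : measurable_fun (F i) f.
  by apply: measurable_funS mf => //; [exact: bigcup_measurable | exact: bigcup_sup].
have h := ge0_nondecreasing_set_cvg_integral (mu := lebesgue_measure) ndF mF mfi (fun i x _ => f0 x).
rewrite -(cvg_lim _ h) //; apply: lime_le; first by apply/cvg_ex; eexists; exact: h.
by apply: nearW.
Qed.

Lemma sum_cauchy_schwarz (I : finType) (P : pred I) (x y : I -> R) :
  (\sum_(i | P i) x i * y i) ^+ 2 <= (\sum_(i | P i) x i ^+ 2) * \sum_(i | P i) y i ^+ 2.
Proof.
set A := \sum_(i | P i) x i ^+ 2; set B := \sum_(i | P i) y i ^+ 2; set D := \sum_(i | P i) x i * y i.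
have B0 : 0 <= B by apply: sumr_ge0 => i _; exact: sqr_ge0.
have A0 : 0 <= A by apply: sumr_ge0 => i _; exact: sqr_ge0.
have key (r : R) : 2 * r * D <= A + r ^+ 2 * B.
  rewrite /A /B /D !mulr_sumr -big_split /=; apply: ler_sum => i _.
  by have := sqr_ge0 (x i - r * y i); nra.
have [BE|Bn] := eqVneq B 0.
  suff -> : D = 0 by rewrite expr0n mulr_ge0.
  have := key ((A + 1) / D); have [->//|D0] := eqVneq D 0.
  by rewrite BE mulr0 addr0 -mulrA divfK //; lra.
have B1 : 0 < B by rewrite lt_def Bn.
have := key (D / B); move=> h.
have e1 : 2 * (D / B) * D = 2 * (D ^+ 2 / B) by field.
have e2 : (D / B) ^+ 2 * B = D ^+ 2 / B by field.
move: h; rewrite e1 e2 => h.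
by rewrite -ler_pdivrMr //; lra.
Qed.

Definition blk (n : nat) : nat := Num.truncn (ln n%:R : R).

Lemma blk_itv n : (0 < n)%N -> (blk n)%:R <= (ln n%:R : R) < (blk n).+1%:R.
Proof. by move=> n0; apply: truncn_itv; rewrite ln_ge0 // ler1n. Qed.

Lemma blk_lt n : (0 < n)%N -> (blk n < n)%N.
Proof.
move=> n0; have /andP[h _] := blk_itv n0.
rewrite -(ltr_nat R); apply: le_lt_trans h _.
have h : ln (1 + (n%:R - 1)) <= n%:R - 1 :> R.
  by apply: le_ln1Dx; rewrite ltrBrDl subrr ltr0n.
by move: h; rewrite addrC subrK; lra.
Qed.

Lemma sum_ord_imp_le (F : nat -> R) (N M : nat) (P : pred nat) :
  (forall i, 0 <= F i) -> (forall i, P i -> (i < M)%N) ->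
  \sum_(i < N | P i) F i <= \sum_(i < M) F i.
Proof.
move=> F0 PM; rewrite -(big_mkord P F) -(big_mkord xpredT F).
have [NM|MN] := leqP N M.
  rewrite [leRHS](big_cat_nat _ (n := N)) //= -[leLHS]addr0 lerD ?sumr_ge0 //.
  by rewrite big_mkcond; apply: ler_sum => i _; case: ifP.
rewrite (big_cat_nat (leq0n M) (ltnW MN)) /= [X in _ + X <= _]big_nat_cond [X in _ + X <= _]big1.
  by rewrite addr0 big_mkcond; apply: ler_sum => i _; case: ifP.
by move=> i /andP[/andP[Mi _] /PM]; rewrite ltnNge Mi.
Qed.

(** In block [k] one has [exp k <= n <= exp (k + 1)]: the summatory bound gives
    [exp k * (1 + k) ^ (s - 1)] up to a constant, and [n ^ (- 2 sg)] is at most [exp (- 2 sg k)]. *)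
Lemma block_weight_le (s : R) : 1 < s <= 2 -> exists C : R, 0 < C /\
  forall (N k : nat) (sg : R), 0 <= sg ->
  \sum_(i < N | blk i.+1 == k) mweight s i.+1 * (i.+1%:R `^ (- sg)) ^+ 2 <=
    C * (1 + k%:R) `^ (s - 1) * expR (- (2 * (sg - 2^-1) * k%:R)).
Proof.
move=> hs; have [s1 s2] := andP hs.
have [C [C0 hC]] := mweight_sum_le hs.
exists (2 * C * expR 1); split; first by rewrite !mulr_gt0 // expR_gt0.
move=> N k sg sg0.
have w0 n : 0 <= mweight s n by rewrite ltW // mweight_gt0 //; lra.
set E := expR (k%:R + 1 : R).
have E1 : 1 <= E by rewrite -expR0 ler_expR; have := ler0n R k; lra.
have E0 : 0 < E by exact: expR_gt0.
set M := Num.truncn E.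
have M0 : (0 < M)%N by rewrite truncn_gt0.
have ME : M%:R <= E by rewrite truncn_le ltW.
apply: le_trans (_ : \sum_(i < N | blk i.+1 == k) mweight s i.+1 * expR (- (2 * sg * k%:R)) <= _).
  apply: ler_sum => i /eqP ik; rewrite ler_wpM2l //.
  rewrite -powR_mulrn ?powR_ge0 // -powRrM /powR pnatr_eq0 /= ler_expR.
  have /andP[h _] := blk_itv (ltn0Sn i); rewrite ik in h.
  by move: (ln _) h => L h; nra.
rewrite -mulr_suml.
have h1 : \sum_(i < N | blk i.+1 == k) mweight s i.+1 <= C * M%:R * (1 + ln M%:R) `^ (s - 1).
  apply: le_trans (hC _ M0); rewrite big_add1 /= big_mkord.
  apply: (@sum_ord_imp_le (fun i => mweight s i.+1) N M (fun i => blk i.+1 == k)) => //.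
  move=> i /eqP ik; rewrite truncn_ge_nat ?(ltW E0) //.
  have /andP[_ h] := blk_itv (ltn0Sn i); rewrite ik -[k.+1%:R]natr1 in h.
  by rewrite -[i.+1%:R]lnK ?posrE ?ltr0n // ler_expR ltW.
have h2 : (1 + ln M%:R) `^ (s - 1) <= 2 * (1 + k%:R) `^ (s - 1) :> R.
  have k0 := ler0n R k.
  have lM : ln M%:R <= k%:R + 1 :> R.
    by rewrite -[leRHS]expRK ler_ln ?posrE ?ltr0n.
  have lM0 : 0 <= ln M%:R :> R by rewrite ln_ge0 // ler1n.
  apply: le_trans (_ : (2 * (1 + k%:R)) `^ (s - 1) <= _).
    by apply: ge0_ler_powR; rewrite ?nnegrE; lra.
  rewrite powRM ?addr_ge0 ?ler0n //.
  rewrite ler_wpM2r ?powR_ge0 // -[leRHS]powRr1 //; apply: ler_powR; lra.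
apply: le_trans (_ : C * E * (2 * (1 + k%:R) `^ (s - 1)) * expR (- (2 * sg * k%:R)) <= _).
  rewrite ler_wpM2r ?expR_ge0 //; apply: le_trans h1 _.
  by apply: ler_pM => //; [rewrite mulr_ge0 // ltW | exact: powR_ge0 | rewrite ler_wpM2l // ltW].
have -> : expR (- (2 * (sg - 2^-1) * k%:R)) = expR (k%:R : R) * expR (- (2 * sg * k%:R)).
  by rewrite -expRD; congr expR; field.
rewrite /E expRD le_eqVlt; apply/orP; left; apply/eqP; ring.
Qed.

Definition psum (c : nat -> R[i]) (N : nat) (sg t : R) : R[i] :=
  \sum_(1 <= n < N.+1) c n * npow_s n sg t.

Lemma psum_trig c N sg t : cabs (psum c N sg t) =
  cabs (\sum_(i < N) (conjc (c i.+1) * (i.+1%:R `^ (- sg))%:C) * cis (ln i.+1%:R * t)).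
Proof.
rewrite /psum big_add1 /= big_mkord -cabs_conj conj_sum; congr cabs.
apply: eq_bigr => i _; rewrite npow_sE !conjM cisN [t * _]mulrC.
by rewrite conjcK conjc_real mulrA.
Qed.

Lemma psum_slice_le (c : nat -> R[i]) N sg :
  (\int[lebesgue_measure]_t (ker t * cabs (psum c N sg t) ^+ 2)%:E <=
   (240 * pi * \sum_(k < N) (\sum_(i < N | blk i.+1 == k) cabs (c i.+1) * i.+1%:R `^ (- sg)) ^+ 2)%:E)%E.
Proof.
pose z (i : 'I_N) := conjc (c i.+1) * (i.+1%:R `^ (- sg))%:C.
pose g t := ker t * cabs (psum c N sg t) ^+ 2.
have cz i : cabs (z i) = cabs (c i.+1) * i.+1%:R `^ (- sg).
  by rewrite cabsM cabs_conj cabs_real ger0_norm ?powR_ge0.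
have hB (i : 'I_N) : (blk i.+1 < N)%N by apply: leq_trans (blk_lt (ltn0Sn i)) _.
pose B (i : 'I_N) : 'I_N := Ordinal (hB i).
have g0 t : 0 <= g t by rewrite mulr_ge0 ?sqr_ge0 // ltW // ker_gt0.
have bg : bmeas g.
  apply: bmeasM; first exact: bmeas_ker.
  have -> : (fun t => cabs (psum c N sg t) ^+ 2) = (fun t =>
      (\sum_i complex.Re (z i * cis (ln i.+1%:R * t))) ^+ 2 +
      (\sum_i complex.Re ((z i * Complex 0 (-1)) * cis (ln i.+1%:R * t))) ^+ 2).
    apply/funext => t; rewrite psum_trig cabs_sqr Re_sum Im_sum; congr (_ + _ ^+ 2).
    by apply: eq_bigr => i _; rewrite -/(z i); case: (z i) => a b; rewrite /cis /=; ring.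
  by apply: bmeasD; apply: bmeasX; apply: bmeas_sum => i; exact: bmeas_Re_cis.
set A := 240 * pi * _.
set D := (\sum_i cabs (z i)) ^+ 2.
have D0 : 0 <= D by rewrite sqr_ge0.
have hT T : 0 < T -> Rintegral lebesgue_measure `[- T, T] g <= A + 4 * ker T * D.
  move=> T0; have := @Rintegral_ker_trig_le R N N z (fun i => ln i.+1%:R) B T T0 (fun i => blk_itv (ltn0Sn i)).
  rewrite [X in _ <= 240 * pi * X + _ -> _](_ : _ = \sum_(k < N) (\sum_(i < N | blk i.+1 == k) cabs (c i.+1) * i.+1%:R `^ (- sg)) ^+ 2).
    by have pE t : cabs (psum c N sg t) = cabs (\sum_i z i * cis (ln i.+1%:R * t)) := psum_trig c N sg t;

       have -> : (fun t => ker t * cabs (\sum_i z i * cis (ln i.+1%:R * t)) ^+ 2) = g by apply/funext => t; rewrite /g pE.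
  by apply: eq_bigr => k _; congr (_ ^+ 2); apply: eq_big => // i _; rewrite cz.
have mono S T : 0 < S -> S <= T -> Rintegral lebesgue_measure `[- S, S] g <= Rintegral lebesgue_measure `[- T, T] g.
  move=> S0 ST; rewrite /Rintegral; apply: fine_le.
  - apply: integrable_fin_num => //; exact: bmeas_integrable.
  - apply: integrable_fin_num => //; exact: bmeas_integrable.
  apply: ge0_subset_integral => //.
  - by apply/measurable_EFinP; apply: measurable_funTS; case: bg.
  - by move=> x _; rewrite lee_fin.
  - by apply: subset_itv; rewrite bnd_simp; lra.
have hA T : 0 < T -> Rintegral lebesgue_measure `[- T, T] g <= A.
  move=> T0; apply/ler_addgt0Pr => e e0.
  (* The integrand is nonnegative, so the window may be enlarged at will; beyond [4 D / e] the
     boundary term [4 * ker S * D] is at most [e]. *)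
  pose S := Num.max T (4 * D / e + 1).
  have TS : T <= S by rewrite le_max lexx.
  have S0 : 0 < S by apply: lt_le_trans TS.
  apply: le_trans (mono _ _ T0 TS) (le_trans (hT _ S0) _); rewrite lerD2l.
  have q0 : 0 <= 4 * D / e by apply: divr_ge0 (ltW e0); exact: mulr_ge0.
  have S1 : 1 <= S by rewrite le_max; apply/orP; right; rewrite lerDr.
  have SD : 4 * D / e <= S by rewrite le_max; apply/orP; right; rewrite lerDl.
  rewrite mulrAC /ker ler_pdivrMr ?sqr1_gt0 //.
  by rewrite ler_pdivrMr // in SD; nra.
have -> : [set: R] = \bigcup_n `[- n.+1%:R, n.+1%:R]%classic.
  apply/seteqP; split => // x _; exists (Num.truncn `|x|) => //=.
  have /andP[_ h] := truncn_itv (normr_ge0 x).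
  by rewrite in_itv /= -ler_norml ltW.
apply: ge0_integral_exhaust_le => //.
- move=> m n mn; apply/subsetPset; apply: subset_itv; rewrite bnd_simp ?lerN2 ler_nat //.
- by apply/measurable_EFinP; apply: measurable_funTS; case: bg.
move=> n; have n0 : 0 < n.+1%:R :> R by rewrite ltr0n.
rewrite -[leLHS]fineK ?lee_fin; first exact: hA.
by apply: integrable_fin_num => //; exact: bmeas_integrable.
Qed.

(** In each block the Cauchy-Schwarz inequality is applied after multiplying and dividing by the
    root of [mweight]: one factor is the sum of the coefficient inequality, the other that of
    [block_weight_le]. *)
Lemma psum_slice_weighted_le (s : R) : 1 < s <= 2 -> exists C : R, 0 < C /\
  forall (c : nat -> R[i]) N sg, 0 <= sg ->
  (\int[lebesgue_measure]_t (ker t * cabs (psum c N sg t) ^+ 2)%:E <=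
   (C * \sum_(k < N) (\sum_(i < N | blk i.+1 == k) cabs (c i.+1) ^+ 2 / mweight s i.+1) *
      ((1 + k%:R) `^ (s - 1) * expR (- (2 * (sg - 2^-1) * k%:R))))%:E)%E.
Proof.
move=> hs; have [s1 s2] := andP hs.
have [C [C0 hC]] := block_weight_le hs.
have p0 := @pi_gt0 R.
exists (240 * pi * C); split; first by rewrite !mulr_gt0.
move=> c N sg sg0; apply: le_trans (psum_slice_le _ _ _) _.
rewrite lee_fin -[leRHS]mulrA ler_wpM2l ?mulr_ge0 ?(ltW p0) // mulr_sumr.
apply: ler_sum => k _.
have w0 n : 0 < mweight s n by apply: mweight_gt0; lra.
have w1 n := ltW (w0 n).
have -> : \sum_(i < N | blk i.+1 == k) cabs (c i.+1) * i.+1%:R `^ (- sg) =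
  \sum_(i < N | blk i.+1 == k) (cabs (c i.+1) / Num.sqrt (mweight s i.+1)) *
     (Num.sqrt (mweight s i.+1) * i.+1%:R `^ (- sg)).
  by apply: eq_bigr => i _; rewrite mulrA divfK // gt_eqF // sqrtr_gt0.
apply: le_trans (sum_cauchy_schwarz _ _ _) _.
have -> : \sum_(i < N | blk i.+1 == k) (cabs (c i.+1) / Num.sqrt (mweight s i.+1)) ^+ 2 =
   \sum_(i < N | blk i.+1 == k) cabs (c i.+1) ^+ 2 / mweight s i.+1.
  by apply: eq_bigr => i _; rewrite expr_div_n [Num.sqrt (mweight _ _) ^+ 2]sqr_sqrtr ?w1.
have -> : \sum_(i < N | blk i.+1 == k) (Num.sqrt (mweight s i.+1) * i.+1%:R `^ (- sg)) ^+ 2 =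
   \sum_(i < N | blk i.+1 == k) mweight s i.+1 * (i.+1%:R `^ (- sg)) ^+ 2.
  by apply: eq_bigr => i _; rewrite exprMn [Num.sqrt (mweight _ _) ^+ 2]sqr_sqrtr ?w1.
rewrite mulrCA; apply: ler_wpM2l.
  by apply: sumr_ge0 => i _; rewrite divr_ge0 ?sqr_ge0 // ltW.
by rewrite mulrA; exact: hC.
Qed.

(** The majorant is, up to a constant, the derivative of [- 1 / (1 + v)] with
    [v = (u * (1 + k)) ^ al], so its integral is elementary and no Gamma function is needed. *)
Lemma radial_weight_le (al u k : R) : 0 < al <= 1 -> 0 < u -> 0 <= k ->
  u `^ (al - 1) * (1 + u) `^ (- (2 * al)) * expR (- (2 * u * k)) <=
    4 * u `^ (al - 1) / (1 + (u * (1 + k)) `^ al) ^+ 2.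
Proof.
move=> /andP[a0 a1] u0 k0.
rewrite -mulrA [4 * _]mulrC -[leRHS]mulrA ler_wpM2l ?powR_ge0 //.
have v0 := powR_ge0 (u * (1 + k)) al; set v := _ `^ al in v0 *.
rewrite ler_pdivlMr ?exprn_gt0 //; last by lra.
(* [X] dominates both 1 and [v], so [(1 + v) ^ 2 <= 4 * X ^ 2]; and since [al <= 1], the left side
   is at most [1 / X ^ 2]. *)
set X := (1 + u) `^ al * expR (al * (u * k)).
have X0 : 0 < X by rewrite mulr_gt0 ?expR_gt0 // powR_gt0; lra.
have uk0 : 0 <= u * k by rewrite mulr_ge0 // ltW.
have X1 : 1 <= X.
  rewrite -[leLHS]mulr1 ler_pM //.
    apply: le_trans (_ : 1 `^ al <= _); first by rewrite powR1.
    by apply: ge0_ler_powR; rewrite ?nnegrE; lra.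
  by rewrite -expR0 ler_expR mulr_ge0 // ltW.
have vX : v <= X.
  apply: le_trans (_ : ((1 + u) * expR (u * k)) `^ al <= _).
    apply: ge0_ler_powR; rewrite ?nnegrE; [lra | by rewrite mulr_ge0 //; lra | |].
      by rewrite mulr_ge0 ?expR_ge0 //; lra.
    have : 1 + u * k <= expR (u * k) := expR_ge1Dx _.
    by move: (expR _) => e he; nra.
  rewrite powRM ?expR_ge0 ?addr_ge0 ?(ltW u0) //.
  by rewrite /X ler_wpM2l ?powR_ge0 // /powR gt_eqF ?expR_gt0 // expRK.
have hY : (1 + u) `^ (- (2 * al)) * expR (- (2 * u * k)) <= (X ^+ 2)^-1.
  rewrite exprMn invfM ler_pM ?powR_ge0 ?expR_ge0 //.
    by rewrite -powR_mulrn ?powR_ge0 // -powRrM powRN [al * _]mulrC.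
  by rewrite -expRM_natl -expRN ler_expR; nra.
apply: le_trans (_ : (X ^+ 2)^-1 * (2 * X) ^+ 2 <= _).
  apply: ler_pM => //; [by rewrite mulr_ge0 ?powR_ge0 ?expR_ge0 | by rewrite sqr_ge0 |].
  by rewrite lerXn2r ?nnegrE //; lra.
by rewrite le_eqVlt; apply/orP; left; apply/eqP; clearbody X; field; rewrite gt_eqF.
Qed.

Definition radial (al sg : R) : R := (sg - 2^-1) `^ (al - 1) * (sg + 2^-1) `^ (- (2 * al)).

Lemma measurable_radial_exp (al k : R) :
  measurable_fun setT (fun sg : R => radial al sg * expR (- (2 * (sg - 2^-1) * k))).
Proof.
have lin (a b : R) : measurable_fun setT (fun x : R => a * x + b).
  apply: continuous_measurable_fun => x; apply: cvgD; last exact: cvg_cst.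
  by apply: cvgMr; exact: cvg_id.
apply: measurable_funM; first apply: measurable_funM.
- apply: (measurableT_comp (measurable_powR (al - 1))).
  by have := lin 1 (- 2^-1); under eq_fun do rewrite mul1r.
- apply: (measurableT_comp (measurable_powR (- (2 * al)))).
  by have := lin 1 2^-1; under eq_fun do rewrite mul1r.
apply: (measurableT_comp (@measurable_expR R)).
rewrite [X in measurable_fun _ X](_ : _ = fun x : R => (- (2 * k)) * x + k); first exact: lin.
by apply/funext => x; field.
Qed.

(** The decay [(1 + k) ^ (- al)] cancels exactly the factor [(1 + k) ^ (s - 1)] of the block weights
    when [al = s - 1]; this is what singles out the exponent [s - 2 = 2 / p - 2]. *)
Lemma radial_integral_le (al : R) (k : nat) : 0 < al <= 1 ->
  (\int[lebesgue_measure]_(sg in `]((2 : R)^-1)%R, +oo[%classic)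
     (radial al sg * expR (- (2 * (sg - 2^-1) * k%:R)))%:E <=
   (4 / al * (1 + k%:R) `^ (- al))%:E)%E.
Proof.
move=> hal; have [a0 a1] := andP hal.
set D : R := 1 + k%:R; have D0 : 0 < D by rewrite /D ltr_pwDl.
pose v (x : R) : R := ((x - 2^-1) * D) `^ al.
pose Q := 4 / al * D `^ (- al).
pose F (x : R) : R := - Q * (1 + v x)^-1.
pose f (x : R) : R := 4 * (x - 2^-1) `^ (al - 1) / (1 + v x) ^+ 2.
have v0 x : 0 <= v x := powR_ge0 _ _.
have v1 x : 0 < 1 + v x by rewrite ltr_pwDl.
have Q0 : 0 <= Q by rewrite mulr_ge0 ?powR_ge0 // divr_ge0 // ltW.
have hD : D `^ (- al) * D * D `^ (al - 1) = 1.
  have pD (a b : R) : D `^ a * D `^ b = D `^ (a + b) by rewrite powRD // (gt_eqF D0) implybT.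
  rewrite -{2}(@powRr1 _ D) ?(ltW D0) // !pD.
  by rewrite (_ : - al + 1 + (al - 1) = 0) ?powRr0 //; ring.
have dB (x : R) : is_derive x 1 (fun y : R => y - 2^-1) 1.
  by apply: is_derive_eq (is_deriveB (is_derive_id x 1) (is_derive_cst (2^-1 : R) x 1)) _; rewrite subr0.
have dv (x : R) : 2^-1 < x -> is_derive x 1 v (al * ((x - 2^-1) * D) `^ (al - 1) * D).
  move=> x1; have h1 : is_derive x 1 (fun y : R => (y - 2^-1) * D) D.
    apply: is_derive_eq (is_deriveM (dB x) (is_derive_cst D x 1)) _.
    by rewrite /GRing.scale /= mulr0 add0r mulr1.
  have x2 : 0 < (x - 2^-1) * D by rewrite mulr_gt0 // subr_gt0.
  exact: (is_derive1_comp (g := fun y : R => (y - 2^-1) * D) (is_derive1_powR al x2) h1).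
have dF (x : R) : 2^-1 < x -> is_derive x 1 F (f x).
  move=> x1; have n0 : 1 + v x != 0 by rewrite gt_eqF.
  have h1 := is_deriveD (is_derive_cst (1 : R) x 1) (dv x x1).
  have h2 := is_deriveZ (- Q) (is_deriveV (f := fun y => 1 + v y) n0 h1).
  apply: is_derive_eq h2 _; rewrite /GRing.scale /= add0r /f /Q.
  rewrite powRM ?subr_ge0 ?(ltW x1) ?(ltW D0) //.
  move: (v x) n0 (_ `^ (al - 1)) => w n0 X.
  transitivity (4 * X / (1 + w) ^+ 2 * (D `^ (- al) * D * D `^ (al - 1))).
    by field; rewrite n0 gt_eqF.
  by rewrite hD mulr1.
have dc (h : R -> R) (x d : R) : is_derive x 1 h d -> {for x, continuous h}.
  by move=> [hd _]; apply: differentiable_continuous; apply/derivable1_diffP.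
have cf (x : R) : 2^-1 < x -> {for x, continuous f}.
  move=> x1; apply: cvgM; last first.
    apply: cvgV; first by rewrite expf_neq0 // gt_eqF.
    have h : {for x, continuous (fun y => 1 + v y)}.
      by apply: cvgD; [exact: cvg_cst | exact: dc (dv x x1)].
    exact: (cvgM h h).
  have x2 : 0 < x - 2^-1 by rewrite subr_gt0.
  have h2 := is_derive1_comp (g := fun y : R => y - 2^-1) (is_derive1_powR (al - 1) x2) (dB x).
  by apply: cvgMr; exact: (dc _ _ _ h2).
pose lo (n : nat) : R := 2^-1 + n.+1%:R^-1.
pose hi (n : nat) : R := 2^-1 + n.+2%:R.
have lo1 n : 2^-1 < lo n by rewrite ltrDl invr_gt0 ltr0n.
have lohi n : lo n < hi n.
  rewrite ltrD2l; apply: le_lt_trans (_ : 1 < _); last by rewrite ltr1n.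
  by rewrite invf_le1 ?ltr0n // ler1n.
have -> : `]((2 : R)^-1)%R, +oo[%classic = \bigcup_n `[lo n, hi n]%classic.
  apply/seteqP; split => x /=; rewrite in_itv /= ?andbT.
    move=> x1; have u0 : 0 < x - 2^-1 by rewrite subr_gt0.
    exists (maxn (Num.truncn (x - 2^-1)^-1) (Num.truncn (x - 2^-1))) => //=.
    rewrite in_itv /= /lo /hi; apply/andP; split.
      rewrite -lerBrDl -[leRHS]invrK lef_pV2 ?posrE ?ltr0n ?invr_gt0 //.
      have /andP[_ /ltW h] := truncn_itv (ltW (etrans (invr_gt0 _) u0)).
      by apply: le_trans h _; rewrite ler_nat ltnS leq_maxl.
    rewrite -lerBlDl; have /andP[_ /ltW h] := truncn_itv (ltW u0).
    by apply: le_trans h _; rewrite ler_nat ltnS leqW // leq_maxr.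
  by move=> [n _] /=; rewrite in_itv /= => /andP[h _]; apply: lt_le_trans (lo1 n) h.
apply: ge0_integral_exhaust_le => //.
- move=> m n mn; apply/subsetPset; apply: subset_itv; rewrite bnd_simp lerD2l.
    by rewrite lef_pV2 ?posrE ?ltr0n // ler_nat.
  by rewrite ler_nat.
- by apply/measurable_EFinP; apply: measurable_funTS; exact: measurable_radial_exp.
- by move=> x; rewrite lee_fin !mulr_ge0 ?powR_ge0 ?expR_ge0.
move=> n; have inn x : x \in `[lo n, hi n] -> 2^-1 < x.
  by rewrite in_itv /= => /andP[h _]; apply: lt_le_trans (lo1 n) h.
have cw : {within `[lo n, hi n], continuous f}.
  by apply: continuous_in_subspaceT => x; rewrite inE => /inn /cf.
apply: le_trans (_ : (\int[lebesgue_measure]_(x in `[lo n, hi n]) (f x)%:E <= _)%E).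
  apply: ge0_le_integral => //.
  - by move=> x _; rewrite lee_fin !mulr_ge0 ?powR_ge0 ?expR_ge0.
  - by apply/measurable_EFinP; apply: measurable_funTS; exact: measurable_radial_exp.
  - by apply/measurable_EFinP; apply: subspace_continuous_measurable_fun.
  move=> x /inn x1; rewrite lee_fin /f /radial.
  have u0 : 0 < x - 2^-1 by rewrite subr_gt0.
  have := @radial_weight_le al (x - 2^-1) k%:R hal u0 (ler0n _ _).
  by rewrite (_ : 1 + (x - 2^-1) = x + 2^-1) //; field.
rewrite (@continuous_FTC2 _ f F _ _ (lohi n) cw).
- rewrite -EFinB lee_fin /F.
  have h1 : 0 <= (1 + v (hi n))^-1 by rewrite invr_ge0 ltW.
  have h2 : (1 + v (lo n))^-1 <= 1 by rewrite invf_le1 // lerDl.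
  rewrite -/Q; move: ((1 + v (lo n))^-1) ((1 + v (hi n))^-1) (Q) Q0 h1 h2 => a b q q0 h1 h2; nra.
- have cF x : 2^-1 < x -> {for x, continuous F} by move=> /dF /dc.
  split.
  + by move=> x /subset_itv_oo_cc /inn /dF [].
  + by apply: cvg_at_right_filter; apply: cF.
  + by apply: cvg_at_left_filter; apply: cF; apply: lt_trans (lo1 n) (lohi n).
- by move=> x /subset_itv_oo_cc /inn /dF h; rewrite derive1E; exact: derive_val.
Qed.

End Slices.

(** * From partial sums to the whole space *)

Section Embedding.
Variable R : realType.
Local Notation mu := (@lebesgue_measure R).
Implicit Types (b c : nat -> R[i]) (z : R * R).

Definition right_ray : set R := `]((2 : R)^-1)%R, +oo[%classic.

(** The integrand as a function on the plane, with the domain encoded by an indicator, so that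
    Tonelli and Fatou apply to the product measure. The first variable is [t], the second
    [sigma]. *)
Definition wfun (g : R * R -> R) (gamma delta : R) z : R :=
  \1_right_ray z.2 * (g z * (z.2 - 2^-1) `^ gamma / cabs (Complex (z.2 + 2^-1) z.1) `^ delta).

Lemma wfun_ge0 g gamma delta z : (forall z, 0 <= g z) -> 0 <= wfun g gamma delta z.
Proof. by move=> g0; rewrite mulr_ge0 ?indicE // divr_ge0 ?powR_ge0 // mulr_ge0 ?powR_ge0. Qed.

Lemma measurable_lin_comp (f : R * R -> R) (a b : R) :
  measurable_fun setT f -> measurable_fun setT (fun z => a * f z + b).
Proof.
move=> mf; apply: measurable_funD; last exact: measurable_cst.
by apply: measurable_funM => //; exact: measurable_cst.
Qed.

Lemma measurable_wfun g gamma delta : measurable_fun setT g ->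
  measurable_fun setT (wfun g gamma delta).
Proof.
move=> mg; apply: measurable_funM.
  apply: (measurableT_comp _ measurable_snd); apply: measurable_indic.
  exact: measurable_itv.
apply: measurable_funM; first apply: measurable_funM => //.
  apply: (measurableT_comp (measurable_powR gamma)).
  by have := measurable_lin_comp 1 (- 2^-1) measurable_snd; under eq_fun do rewrite mul1r.
have -> : (fun z => (cabs (Complex (z.2 + 2^-1) z.1) `^ delta)^-1) =
    (fun z => ((1 * z.2 + 2^-1) ^+ 2 + z.1 ^+ 2) `^ (- (delta / 2))).
  by apply/funext => z; rewrite cabs_powR -powRN cabs_sqr mul1r.
apply: (measurableT_comp (measurable_powR _)).
apply: measurable_funD; apply: measurable_funX; last exact: measurable_fst.
exact: measurable_lin_comp measurable_snd.
Qed.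

Lemma measurable_psum c N : measurable_fun setT (fun z => cabs (psum c N z.2 z.1) ^+ 2).
Proof.
pose e (n : nat) (z : R * R) := expR (- ln n%:R * z.2 + 0).
have me n : measurable_fun setT (e n).
  by apply: (measurableT_comp (@measurable_expR R)); exact: measurable_lin_comp measurable_snd.
have mcos (n : nat) : measurable_fun setT (fun z : R * R => cos (ln n%:R * z.1 + 0)).
  apply: (measurableT_comp (continuous_measurable_fun (@continuous_cos R))).
  exact: measurable_lin_comp measurable_fst.
have msin (n : nat) : measurable_fun setT (fun z : R * R => sin (ln n%:R * z.1 + 0)).
  apply: (measurableT_comp (continuous_measurable_fun (@continuous_sin R))).
  exact: measurable_lin_comp measurable_fst.
have -> : (fun z => cabs (psum c N z.2 z.1) ^+ 2) = fun z =>
   (\sum_(1 <= n < N.+1) e n z * (complex.Re (c n) * cos (ln n%:R * z.1 + 0) + complex.Im (c n) * sin (ln n%:R * z.1 + 0))) ^+ 2 +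
   (\sum_(1 <= n < N.+1) e n z * (complex.Im (c n) * cos (ln n%:R * z.1 + 0) - complex.Re (c n) * sin (ln n%:R * z.1 + 0))) ^+ 2.
  apply/funext => z; rewrite cabs_sqr /psum Re_sum Im_sum !big_nat.
  congr (_ ^+ 2 + _ ^+ 2); apply: eq_bigr => n /andP[n0 _];
    rewrite /npow_s /e /powR pnatr_eq0 (gtn_eqF n0) !addr0 mulNr mulNr [z.2 * _]mulrC [z.1 * _]mulrC;
    case: (c n) => x y /=; ring.
apply: measurable_funD; apply: measurable_funX; apply: measurable_sum => n;
  apply: measurable_funM => //; [apply: measurable_funD | apply: measurable_funB];
  by apply: measurable_funM => //; exact: measurable_cst.
Qed.

Lemma weighted_int_product b gamma delta : 
  measurable_fun setT (wfun (fun z => cabs (dseries b z.2 z.1) ^+ 2) gamma delta) ->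
  weighted_int b gamma delta =
  (\int[mu \x mu]_z (wfun (fun z => cabs (dseries b z.2 z.1) ^+ 2) gamma delta z)%:E)%E.
Proof.
move=> mb; rewrite fubini_tonelli1; last 2 first.
- by apply/measurable_EFinP.
- by move=> z; rewrite lee_fin wfun_ge0 // => ?; exact: sqr_ge0.
rewrite /weighted_int /fubini_F; apply: eq_integral => t _.
rewrite [LHS]integral_mkcond; apply: eq_integral => sg _.
rewrite patchE /wfun /= indicE; case: ifP => _ /=; first by rewrite mul1r.
by rewrite mul0r.
Qed.

(** With [X] the squared modulus, the denominator is [X ^ al * X]. The first factor is at least
    [(sg + 1 / 2) ^ (2 al)], and the second at least [1 + t ^ 2] because [sg + 1 / 2 >= 1]. The
    variables are thereby separated. *)
Lemma weight_split_le (al sg t : R) : 0 < al -> 2^-1 < sg ->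
  (sg - 2^-1) `^ (al - 1) / cabs (Complex (sg + 2^-1) t) `^ (2 * al + 2) <= radial al sg * ker t.
Proof.
move=> a0 s1; rewrite /radial -mulrA ler_wpM2l ?powR_ge0 //.
rewrite cabs_powR (_ : (2 * al + 2) / 2 = al + 1); last by field.
rewrite cabs_sqr /=; set X := _ + _; set y := sg + 2^-1.
have y1 : 1 <= y by rewrite /y; lra.
have t0 := sqr_ge0 t.
have X1 : 1 + t ^+ 2 <= X by rewrite /X -/y; nra.
have Xy : y ^+ 2 <= X by rewrite /X -/y; lra.
have X0 : 0 < X by lra.
rewrite powRD; last by rewrite (gt_eqF X0) implybT.
rewrite powRr1 ?(ltW X0) // invfM ler_pM ?invr_ge0 ?powR_ge0 ?(ltW X0) //.
  rewrite powRN lef_pV2 ?posrE ?powR_gt0 //; last by lra.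
  rewrite powRrM powR_mulrn; last by lra.
  by apply: ge0_ler_powR; rewrite ?nnegrE ?sqr_ge0 ?(ltW a0) ?(ltW X0).
by rewrite lef_pV2 ?posrE ?sqr1_gt0.
Qed.

(** Tonelli puts the integral in [t] inside, where the line estimate applies. The integral in [sg]
    then removes the growth [(1 + k) ^ (s - 1)] of block [k], and summing over the blocks restores
    the full coefficient sum. *)
Lemma psum_embedding (s : R) : 1 < s <= 2 -> exists C : R, 0 < C /\
  forall c N,
  (\int[mu \x mu]_z (wfun (fun z => cabs (psum c N z.2 z.1) ^+ 2) (s - 2) (2 * s) z)%:E <=
    (C * \sum_(i < N) cabs (c i.+1) ^+ 2 / mweight s i.+1)%:E)%E.
Proof.
move=> hs; have [s1 s2] := andP hs.
have [C [C0 hC]] := psum_slice_weighted_le hs.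
pose al := s - 1.
have hal : 0 < al <= 1 by rewrite /al; apply/andP; split; lra.
have [a0 a1] := andP hal.
exists (C * (4 / al)); split; first by rewrite mulr_gt0 // divr_gt0.
move=> c N; set W := wfun _ _ _.
have mW : measurable_fun setT (fun z => (W z)%:E).
  by apply/measurable_EFinP; apply: measurable_wfun; exact: measurable_psum.
have W0 z : (0 <= (W z)%:E)%E.
  by rewrite lee_fin wfun_ge0 // => ?; exact: sqr_ge0.
rewrite fubini_tonelli2 //.
pose E (k : 'I_N) := \sum_(i < N | blk R i.+1 == k) cabs (c i.+1) ^+ 2 / mweight s i.+1.
have w0 n : 0 < mweight s n by apply: mweight_gt0; lra.
have E0 k : 0 <= E k by apply: sumr_ge0 => i _; rewrite divr_ge0 ?sqr_ge0 // ltW.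
pose r (k : 'I_N) (sg : R) := (radial al sg * expR (- (2 * (sg - 2^-1) * k%:R)))%:E.
have rw0 sg : 0 <= radial al sg by rewrite mulr_ge0 ?powR_ge0.
have r0 k sg : (0 <= r k sg)%E by rewrite lee_fin mulr_ge0 ?expR_ge0.
have mr k (D : set R) : measurable_fun D (r k).
  by apply/measurable_EFinP; apply: measurable_funTS; exact: measurable_radial_exp.
pose a (k : 'I_N) := C * E k * (1 + k%:R) `^ al.
have a_0 k : 0 <= a k by rewrite mulr_ge0 ?powR_ge0 // mulr_ge0 // ltW.
have mhp : measurable right_ray by exact: measurable_itv.
pose H (sg : R) : \bar R := (\sum_(k < N) (a k)%:E * r k sg)%E.
have mH (D : set R) : measurable_fun D H.
  by apply: emeasurable_sum => k; apply: measurable_funeM.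
have H0 sg : (0 <= H sg)%E by apply: sume_ge0 => k _; rewrite mule_ge0 // lee_fin.
have mslice sg : measurable_fun setT (fun t => ker t * cabs (psum c N sg t) ^+ 2).
  apply: measurable_funM; first by case: (bmeas_ker R).
  exact: (measurableT_comp (measurable_psum c N) (pair2_measurable sg)).
have key sg : (fubini_G mu (fun z => (W z)%:E) sg <= (H \_ right_ray) sg)%E.
  rewrite patchE; case: ifPn => [|/negP] hsg; last first.
    rewrite /fubini_G integral0_eq // => t _ /=.
    by rewrite /W /wfun /= indicE (negbTE (introN idP hsg)) /= mul0r.
  move: hsg; rewrite inE /right_ray /= in_itv /= andbT => hsg.
  apply: le_trans (_ : (\int[mu]_t ((radial al sg)%:E * (ker t * cabs (psum c N sg t) ^+ 2)%:E) <= _)%E).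
    apply: ge0_le_integral => //.
    - exact: (measurableT_comp mW (pair2_measurable sg)).
    - by apply: measurable_funeM; apply/measurable_EFinP; exact: mslice.
    - move=> t _ /=; rewrite -EFinM lee_fin /W /wfun /= indicE mem_set /=; last by rewrite /right_ray /= in_itv /= andbT.
      rewrite mul1r; have := weight_split_le t a0 hsg.
      rewrite (_ : al - 1 = s - 2); last by rewrite /al; ring.
      rewrite (_ : 2 * al + 2 = 2 * s); last by rewrite /al; ring.
      have q0 := sqr_ge0 (cabs (psum c N sg t)); move: (_ ^+ 2) q0 => q q0 h.
      by rewrite -mulrA [leLHS]mulrC mulrA ler_wpM2r.
  rewrite ge0_integralZl_EFin //; last 2 first.
  - by move=> t _; rewrite lee_fin mulr_ge0 ?sqr_ge0 // ltW // ker_gt0.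
  - by apply/measurable_EFinP; exact: mslice.
  have sg0 : 0 <= sg by lra.
  apply: le_trans (lee_wpmul2l _ (hC c N sg sg0)) _; first by rewrite lee_fin.
  rewrite -EFinM /H (eq_bigr (fun k : 'I_N => (a k * (radial al sg * expR (- (2 * (sg - 2^-1) * k%:R))))%:E)) //.
  rewrite sumEFin lee_fin le_eqVlt; apply/orP; left; apply/eqP.
  rewrite !mulr_sumr; apply: eq_bigr => k _; rewrite /a /E /al; ring.
apply: le_trans (_ : (\int[mu]_sg (H \_ right_ray) sg <= _)%E).
  apply: ge0_le_integral => //.
  - by move=> sg _; apply: integral_ge0.
  - exact: measurable_fun_fubini_tonelli_G.
  - by apply/(measurable_restrictT H).
  - by move=> sg _; exact: key.
rewrite -integral_mkcond /H ge0_integral_sum //; last 2 first.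
- by move=> k; apply: measurable_funeM; exact: mr.
- by move=> k sg _; rewrite mule_ge0 // lee_fin.
apply: le_trans (_ : (\sum_(k < N) (C * (4 / al) * E k)%:E <= _)%E).
  apply: lee_sum => k _; rewrite ge0_integralZl_EFin //; last exact: mr.
  apply: le_trans (lee_wpmul2l _ (radial_integral_le k hal)) _; first by rewrite lee_fin.
  rewrite -EFinM lee_fin /a powRN le_eqVlt; apply/orP; left; apply/eqP.
  have p0 : (1 + k%:R) `^ al != 0 by rewrite gt_eqF // powR_gt0 // ltr_pwDl.
  by move: (_ `^ al) p0 => q q0; field; rewrite q0 gt_eqF.
rewrite sumEFin lee_fin -mulr_sumr; rewrite le_eqVlt; apply/orP; left; apply/eqP; congr (_ * _).
have hB (i : 'I_N) : (blk R i.+1 < N)%N by apply: leq_trans (blk_lt R (ltn0Sn i)) _.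
by rewrite [RHS](partition_big (fun i => Ordinal (hB i)) xpredT).
Qed.

Lemma limn_einf_le (u : (\bar R)^nat) (K : \bar R) : (forall n, (u n <= K)%E) -> (limn_einf u <= K)%E.
Proof.
move=> uK; rewrite limn_einf_lim; apply: lime_le; first exact: is_cvg_einfs.
apply: nearW => n; apply: le_trans (uK n).
by apply: ereal_inf_lbound; exists n => /=.
Qed.

Section Limit.
Variables (s : R) (b : nat -> R[i]) (S : R).
Hypothesis hs : 1 < s <= 2.
Hypothesis hS : forall N, \sum_(i < N) cabs (b i.+1) ^+ 2 / mweight s i.+1 <= S.

(** Block [k] decays like [exp (- 2 u k)] with [u = sg - 1 / 2]; half of this rate absorbs the
    polynomial factor [1 + k], the other half gives a geometric series. *)
Lemma mweight_series_bounded (sg : R) : 2^-1 < sg ->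
  exists K, forall N, \sum_(i < N) mweight s i.+1 * (i.+1%:R `^ (- sg)) ^+ 2 <= K.
Proof.
move=> sg1; have [C [C0 hC]] := block_weight_le hs; have [s1 s2] := andP hs.
pose u := sg - 2^-1; have u0 : 0 < u by rewrite subr_gt0.
pose th := expR (- u).
have th0 : 0 <= th := expR_ge0 _.
have th1 : th < 1 by rewrite /th -expR0 ltr_expR; lra.
exists (C * (1 + u^-1) * (1 - th)^-1) => N.
have hB (i : 'I_N) : (blk R i.+1 < N)%N by apply: leq_trans (blk_lt R (ltn0Sn i)) _.
rewrite (partition_big (fun i => Ordinal (hB i)) xpredT) //=.
apply: le_trans (_ : \sum_(k < N) C * (1 + u^-1) * th ^+ k <= _); last first.
  rewrite -mulr_sumr ler_wpM2l //; last exact: geom_le.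
  by rewrite mulr_ge0 ?(ltW C0) // addr_ge0 // invr_ge0 ltW.
apply: ler_sum => k _; have sg0 : 0 <= sg by lra.
apply: le_trans (hC N k sg sg0) _; rewrite -!mulrA ler_wpM2l ?(ltW C0) //.
have k0 := ler0n R k.
have h1 : (1 + k%:R) `^ (s - 1) <= 1 + k%:R :> R.
  by rewrite -[leRHS]powRr1; [apply: ler_powR; lra | lra].
have h2 : 1 + k%:R <= (1 + u^-1) * expR (u * k%:R).
  apply: le_trans (_ : (1 + u^-1) * (1 + u * k%:R) <= _); last first.
    by rewrite ler_wpM2l ?expR_ge1Dx // addr_ge0 // invr_ge0 ltW.
  have ui : u^-1 * u = 1 by rewrite mulVf // gt_eqF.
  have ui0 : 0 < u^-1 by rewrite invr_gt0.
  have -> : (1 + u^-1) * (1 + u * k%:R) = 1 + u^-1 + u * k%:R + (u^-1 * u) * k%:R by ring.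
  rewrite ui; have : 0 <= u * k%:R by rewrite mulr_ge0 // ltW.
  lra.
apply: le_trans (ler_wpM2r _ (le_trans h1 h2)) _; first exact: expR_ge0.
rewrite -mulrA ler_wpM2l ?addr_ge0 ?invr_ge0 ?(ltW u0) //.
by rewrite -expRD /th -expRM_natl ler_expR -/u le_eqVlt; apply/orP; left; apply/eqP; ring.
Qed.

Lemma cvg_series_of_bound (f g : nat -> R) (K : R) : (forall n, `|f n| <= g n) ->
  (forall N, \sum_(i < N) g i <= K) -> cvgn (series f).
Proof.
move=> fg hK; apply: normed_cvg; apply: nondecreasing_is_cvgn.
  by apply/nondecreasing_seqP => n; change (\sum_(0 <= k < n) `|f k| <= \sum_(0 <= k < n.+1) `|f k|); rewrite big_nat_recr //= lerDl.
exists K => _ [N _ <-]; apply: le_trans (hK N).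
by change (\sum_(0 <= k < N) `|f k| <= \sum_(i < N) g i); rewrite big_mkord; apply: ler_sum.
Qed.

(** Absolute convergence follows from [x * y <= x ^ 2 / w + w * y ^ 2] with [x = |b n|],
    [y = n ^ (- sg)] and [w] the weight. In particular the [limn] in [dseries] are genuine limits
    there. *)
Lemma psum_cvg (sg t : R) : 2^-1 < sg ->
  (fun N => cabs (psum b N sg t) ^+ 2) @ \oo --> cabs (dseries b sg t) ^+ 2.
Proof.
move=> sg1; have [s1 s2] := andP hs; have [K hK] := mweight_series_bounded sg1.
have w0 n : 0 < mweight s n by apply: mweight_gt0; lra.
pose a (i : nat) := cabs (b i.+1 * npow_s i.+1 sg t).
pose g (i : nat) := cabs (b i.+1) ^+ 2 / mweight s i.+1 + mweight s i.+1 * (i.+1%:R `^ (- sg)) ^+ 2.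
have ag i : a i <= g i.
  rewrite /a /g npow_sE !cabsM cabs_cis mulr1 cabs_real ger0_norm ?powR_ge0 //.
  have q0 := cabs_ge0 (b i.+1); have p0 := powR_ge0 (i.+1%:R : R) (- sg).
  move: (mweight s i.+1) (w0 i.+1) => w wp.
  move: (cabs _) (_ `^ _) q0 p0 => x y x0 y0.
  have -> : x ^+ 2 / w + w * y ^+ 2 = x * y + (w * (x / w - y) ^+ 2 + x * y).
    by field; rewrite gt_eqF.
  by rewrite lerDl; apply: addr_ge0; [rewrite mulr_ge0 ?sqr_ge0 ?(ltW wp) | exact: mulr_ge0].
have gK N : \sum_(i < N) g i <= S + K by rewrite big_split lerD.
(* [psum] includes the index [N] while the sums in [dseries] stop before it, hence the shift by
   one. *)
have shift (F : nat -> R) : (forall i, `|F i.+1| <= a i) ->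
    (fun N => \sum_(1 <= n < N.+1) F n) @ \oo --> limn (fun N => \sum_(1 <= n < N) F n).
  move=> Fa; have h : cvgn (series (fun i => F i.+1)).
    by apply: (@cvg_series_of_bound _ g (S + K)) => // n; exact: le_trans (Fa n) (ag n).
  have e N : \sum_(1 <= n < N.+1) F n = series (fun i => F i.+1) N.
    by rewrite /series /= big_add1.
  rewrite (cvg_shiftS (fun N => \sum_(1 <= n < N) F n)).
  have : cvgn (fun N => \sum_(1 <= n < N) F n).
    apply/cvg_ex; exists (limn (series (fun i => F i.+1))).
    by rewrite -(cvg_shiftS (fun N => \sum_(1 <= n < N) F n)); under eq_fun do rewrite /= e.
  by [].
have cre := shift (fun n => complex.Re (b n * npow_s n sg t)) (fun i => normr_Re_le _).
have cim := shift (fun n => complex.Im (b n * npow_s n sg t)) (fun i => normr_Im_le _).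
under eq_fun do rewrite cabs_sqr /psum Re_sum Im_sum.
by rewrite cabs_sqr; apply: cvgD; rewrite !expr2; [exact: (cvgM cre cre) | exact: (cvgM cim cim)].
Qed.

End Limit.

(** Fatou's lemma for the partial sums, which converge pointwise on the open half-plane.
    Measurability of the limit comes from the same convergence. *)
Lemma weighted_int_le (s : R) : 1 < s <= 2 -> exists C : R, 0 < C /\
  forall b (S : R), (forall N, \sum_(i < N) cabs (b i.+1) ^+ 2 / mweight s i.+1 <= S) ->
    (weighted_int b (s - 2) (2 * s) <= (C * S)%:E)%E.
Proof.
move=> hs; have [C [C0 hC]] := psum_embedding hs; exists C; split => // b S hS.
pose f N z := (wfun (fun z => cabs (psum b N z.2 z.1) ^+ 2) (s - 2) (2 * s) z)%:E.
pose g z := (wfun (fun z => cabs (dseries b z.2 z.1) ^+ 2) (s - 2) (2 * s) z)%:E.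
have mf N : measurable_fun setT (f N).
  by apply/measurable_EFinP; apply: measurable_wfun; exact: measurable_psum.
have f0 N z : (0 <= f N z)%E by rewrite lee_fin wfun_ge0 // => ?; exact: sqr_ge0.
have fg z : f ^~ z @ \oo --> g z.
  apply: cvg_EFin; first exact: nearW.
  change ((fun N => wfun (fun z => cabs (psum b N z.2 z.1) ^+ 2) (s - 2) (2 * s) z) @ \oo -->
    wfun (fun z => cabs (dseries b z.2 z.1) ^+ 2) (s - 2) (2 * s) z).
  rewrite /wfun indicE; case: (boolP (z.2 \in right_ray)) => hz /=; last first.
    by rewrite mul0r; under eq_fun do rewrite mul0r; exact: cvg_cst.
  apply: cvgMr; apply: cvgMl; apply: cvgMl.
  by apply: (psum_cvg hs hS); move: hz; rewrite inE /right_ray /= in_itv /= andbT.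
have mg : measurable_fun setT g by apply: (emeasurable_fun_cvg f) => // z _; exact: fg.
rewrite weighted_int_product; last by apply/measurable_EFinP.
have -> : (\int[mu \x mu]_z g z = \int[mu \x mu]_z limn_einf (f ^~ z))%E.
  by apply: eq_integral => z _; rewrite (cvg_limn_einf_sup (fg z)).1.
apply: le_trans (fatou _ _ _ _) _ => //.
apply: limn_einf_le => N; apply: le_trans (hC b N) _.
by rewrite lee_fin ler_wpM2l // ltW.
Qed.

(** For a fixed [N] only finitely many coefficients occur, so the inequality for the polynomials
    [Ps k] passes to the limit in [k] on both sides. *)
Lemma coef_sum_le (p : R) : 1 <= p < 2 -> exists C : R, 0 < C /\
  forall b (Ps : nat -> dpoly R), Hp_approx p b Ps ->
  forall N, \sum_(i < N) cabs (b i.+1) ^+ 2 / mweight (2 / p) i.+1 <= C * Hp_norm_lim p Ps ^+ 2.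
Proof.
move=> hp; have [p1 p2] := andP hp; have hp' : 1 <= p <= 2 by rewrite p1 ltW.
have [C [C0 hC]] := coef_ineq hp; exists C; split => // b Ps [hcau hb] N.
have w0 n : 0 < mweight (2 / p) n by apply: mweight_gt0; rewrite divr_gt0 //; lra.
pose F k (i : nat) := cabs (dcoef (Ps k) i.+1) ^+ 2 / mweight (2 / p) i.+1.
have F0 k i : 0 <= F k i by rewrite divr_ge0 ?sqr_ge0 // ltW.
have Fle k : \sum_(i < N) F k i <= C * Hp_norm_poly p (Ps k) ^+ 2.
  apply: le_trans (hC (Ps k)).
  have -> : \sum_(i < (Ps k).1) cabs ((Ps k).2 i.+1) ^+ 2 / mweight (2 / p) i.+1 =
            \sum_(i < (Ps k).1) F k i.
    by apply: eq_bigr => i _; rewrite /F /dcoef /= ltn_ord.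
  rewrite (bigID (fun i : 'I_N => (i < (Ps k).1)%N)) /= [X in _ + X]big1 ?addr0.
    exact: (@sum_ord_imp_le R (F k) N (Ps k).1 (fun i => (i < (Ps k).1)%N)).
  by move=> i /negbTE hi; rewrite /F /dcoef /= hi cabs0 expr0n mul0r.
have cF i : (fun k => F k i) @ \oo --> cabs (b i.+1) ^+ 2 / mweight (2 / p) i.+1.
  have [hre him] := hb i.+1 (ltn0Sn i).
  apply: cvgMl; under eq_fun do rewrite cabs_sqr.
  by rewrite cabs_sqr; apply: cvgD; rewrite !expr2; [exact: (cvgM hre hre) | exact: (cvgM him him)].
have cN : (fun k => C * Hp_norm_poly p (Ps k) ^+ 2) @ \oo --> C * Hp_norm_lim p Ps ^+ 2.
  by have h := Hp_norm_limP hp' hcau; apply: cvgMr; rewrite !expr2; exact: (cvgM h h).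
have cS : (fun k => \sum_(i < N) F k i) @ \oo --> \sum_(i < N) cabs (b i.+1) ^+ 2 / mweight (2 / p) i.+1.
  elim: {+}N => [|M IH].
    by rewrite big_ord0; under eq_fun do rewrite big_ord0; exact: cvg_cst.
  rewrite big_ord_recr /=; under eq_fun do rewrite big_ord_recr /=.
  by apply: cvgD => //; exact: cF.
rewrite -(cvg_lim _ cS) // -(cvg_lim _ cN) //; apply: ler_lim.
- by apply/cvg_ex; eexists; exact: cS.
- by apply/cvg_ex; eexists; exact: cN.
by apply: nearW.
Qed.

Lemma Hp_embedding (p : R) : 1 <= p < 2 -> exists Cp : R, 0 < Cp /\
  forall b (Ps : nat -> dpoly R), Hp_approx p b Ps ->
    (weighted_int b (2 / p - 2) (4 / p) `^ 2^-1 <= (Cp * Hp_norm_lim p Ps)%:E)%E.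
Proof.
move=> hp; have [p1 p2] := andP hp; have p0 : 0 < p by lra.
have hs : 1 < 2 / p <= 2.
  by rewrite ltr_pdivlMr // mul1r p2 /= ler_pdivrMr //; lra.
have [C1 [C10 h1]] := coef_sum_le hp; have [C2 [C20 h2]] := weighted_int_le hs.
exists (Num.sqrt (C2 * C1)); split; first by rewrite sqrtr_gt0 mulr_gt0.
move=> b Ps hb; have := h2 b _ (h1 b Ps hb).
have -> : 2 * (2 / p) = 4 / p by field; rewrite gt_eqF.
have L0 : 0 <= Hp_norm_lim p Ps.
  have hp' : 1 <= p <= 2 by rewrite p1 ltW.
  have h := Hp_norm_limP hp' hb.1.
  rewrite -(cvg_lim _ h) //; apply: limr_ge; first by apply/cvg_ex; eexists; exact: h.
  by apply: nearW => k; exact: Hp_norm_poly_ge0.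
have : (0 <= weighted_int b (2 / p - 2) (4 / p))%E.
  apply: integral_ge0 => t _; apply: integral_ge0 => sg _.
  by rewrite lee_fin divr_ge0 ?powR_ge0 // mulr_ge0 ?powR_ge0 ?sqr_ge0.
move: (weighted_int _ _ _) => x x0 hx; set L := Hp_norm_lim p Ps in L0 hx *.
have e : (C2 * (C1 * L ^+ 2)) `^ 2^-1 = Num.sqrt (C2 * C1) * L.
  rewrite powR12_sqrt; last by rewrite !mulr_ge0 ?sqr_ge0 // ltW.
  by rewrite mulrA sqrtrM ?sqrtr_sqr ?ger0_norm // mulr_ge0 // ltW.
rewrite -e -poweR_EFin.
apply: gt0_ler_poweR => //; rewrite ?invr_ge0 // in_itv /= ?x0 ?leey //= lee_fin.
by rewrite andbT !mulr_ge0 ?sqr_ge0 // ltW.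
Qed.

End Embedding.

(** * Sharpness of the exponent *)

Section EulerLower.
Variable R : realType.
Implicit Types (h y sg : R) (q N : nat) (l : seq nat).

Lemma expR_le1D y : - 2^-1 <= y -> expR (y - 2 * y ^+ 2) <= 1 + y.
Proof.
move=> y1; have y0 : 0 < 1 + y by lra.
apply: le_trans (_ : expR (y / (1 + y)) <= _).
  by rewrite ler_expR ler_pdivlMr //; nra.
rewrite -lef_pV2 ?posrE ?expR_gt0 // -expRN.
apply: le_trans (expR_ge1Dx _); rewrite le_eqVlt; apply/orP; left; apply/eqP.
by field; rewrite gt_eqF.
Qed.

Lemma euler_step_ge sg l q N : prime q -> {in l, forall r, prime r} -> q \notin l ->
  (1 - q%:R `^ (- sg)) * \sum_(1 <= n < N.+1 | coprime_to l n) n%:R `^ (- sg) <=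
  \sum_(1 <= n < N.+1 | coprime_to (q :: l) n) n%:R `^ (- sg) :> R.
Proof.
move=> pq pl ql; have q0 := prime_gt0 pq.
rewrite mulrBl mul1r lerBlDr [leLHS](bigID (fun n => q %| n)%N) /= [leLHS]addrC lerD //.
  by rewrite le_eqVlt; apply/orP; left; apply/eqP; apply: eq_bigl => n; rewrite /coprime_to /= andbC.
have -> : \sum_(1 <= n < N.+1 | coprime_to l n && (q %| n)%N) n%:R `^ (- sg) =
    \sum_(1 <= n < N.+1 | (q %| n)%N) (if coprime_to l n then n%:R `^ (- sg) else 0) :> R.
  by rewrite -big_mkcondr /=; apply: eq_bigl => n; rewrite andbC.
rewrite sum_multiples // mulr_sumr.
rewrite [leRHS]big_mkcond [leRHS](@big_cat_nat _ _ _ (N %/ q).+1) //=; last by rewrite ltnS leq_div.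
rewrite -[leLHS]addr0 lerD //; last first.
  by apply: sumr_ge0 => n _; case: ifP => // _; rewrite mulr_ge0 ?powR_ge0.
apply: ler_sum => n _; rewrite prime_ndvdM //; case: ifP => // _.
by rewrite natrM powRM.
Qed.

(** A finite sieve in place of the infinite Euler product: when the list holds all primes up to [N],
    only [n = 1] survives on the right, and the product is bounded above by the inverse of a partial
    zeta sum. *)
Lemma euler_prod_ge sg l N : 0 < sg -> {in l, forall r, prime r} -> uniq l ->
  \prod_(q <- l) (1 - q%:R `^ (- sg)) * \sum_(1 <= n < N.+1) n%:R `^ (- sg) <=
  \sum_(1 <= n < N.+1 | coprime_to l n) n%:R `^ (- sg) :> R.
Proof.
move=> sg0; elim: l => [|q l IH] pl /=; first by rewrite big_nil mul1r.
move=> /andP[ql ul]; have pq : prime q by apply: pl; rewrite mem_head.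
have pl' : {in l, forall r, prime r} by move=> r rl; apply: pl; rewrite inE rl orbT.
rewrite big_cons -mulrA; apply: le_trans (euler_step_ge sg N pq pl' ql).
apply: ler_wpM2l (IH pl' ul); rewrite subr_ge0 powRN invf_le1 ?powR_gt0 ?ltr0n ?prime_gt0 //.
apply: le_trans (_ : 1 `^ sg <= _); first by rewrite powR1.
by apply: ge0_ler_powR; rewrite ?nnegrE ?ler1n ?prime_gt0 // ltW.
Qed.

Lemma zeta_partial_ge h N : 0 < h ->
  (1 - N.+1%:R `^ (- h)) / h <= \sum_(1 <= n < N.+1) n%:R `^ (- (1 + h)) :> R.
Proof.
move=> h0; rewrite ler_pdivrMr //; elim: N => [|N IH].
  by rewrite big_geq // mul0r powR1 subrr.
rewrite big_nat_recr //= mulrDl; apply: le_trans (lerD IH (lexx _)).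
suff : N.+1%:R `^ (- h) - N.+2%:R `^ (- h) <= N.+1%:R `^ (- (1 + h)) * h :> R by lra.
set x : R := N.+1%:R; have x0 : 0 < x by rewrite ltr0n.
have -> : N.+2%:R = x * (1 + x^-1) by rewrite mulrDr mulr1 mulfV ?gt_eqF // natr1.
clearbody x; have xi0 : 0 < x^-1 by rewrite invr_gt0.
rewrite powRM ?(ltW x0) ?addr_ge0 ?(ltW xi0) //.
have -> : x `^ (- (1 + h)) = x `^ (- h) * x^-1.
  rewrite opprD addrC powRD; last by rewrite (gt_eqF x0) implybT.
  by rewrite powR_inv1 // ltW.
have xh := powR_ge0 x (- h).
have key : 1 - h * x^-1 <= (1 + x^-1) `^ (- h).
  have p1 : 0 < 1 + x^-1 by lra.
  rewrite /powR (gt_eqF p1).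
  apply: le_trans (expR_ge1Dx _); rewrite mulNr lerD2l lerN2 ler_wpM2l ?(ltW h0) //.
  by apply: le_ln1Dx; lra.
by move: (x `^ _) xh (_ `^ (- h)) key => u u0 v key; nra.
Qed.

Lemma sum_list_le (F : nat -> R) l N : (forall n, 0 <= F n) -> uniq l ->
  {in l, forall n, 0 < n <= N}%N -> \sum_(q <- l) F q <= \sum_(1 <= n < N.+1) F n.
Proof.
move=> F0 ul hl; rewrite [leRHS](bigID (mem l)) /=.
rewrite -[leLHS]addr0 lerD ?sumr_ge0 // le_eqVlt; apply/orP; left; apply/eqP.
rewrite -[in RHS]big_filter; apply: perm_big; apply: uniq_perm => //; first by rewrite filter_uniq ?iota_uniq.
by move=> n; rewrite mem_filter mem_index_iota ltnS; case: (boolP (n \in l)) => //= /hl ->.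
Qed.

(* The constant absorbs the primes below [m] and the second-order terms. *)
Lemma prime_sum_large (m : nat) : exists c : R, 0 < c /\ forall h, 0 < h <= 1 ->
  exists l, [/\ {in l, forall q, prime q && (m <= q)%N}, uniq l &
    c / h <= expR (\sum_(q <- l) q%:R `^ (- (1 + h)))].
Proof.
exists (expR (- (m%:R + 4)) / 2); split; first by rewrite divr_gt0 ?expR_gt0.
move=> h /andP[h0 h1].
(* Large enough for [(N + 1) ^ (- h) <= 1 / 2], which makes the partial zeta sum at least
   [1 / (2 h)]. *)
pose N := (Num.truncn ((2 : R) `^ h^-1)).+1.
have hN : N.+1%:R `^ (- h) <= 2^-1 :> R.
  rewrite powRN lef_pV2 ?posrE ?powR_gt0 ?ltr0n //.
  apply: le_trans (_ : ((2 : R) `^ h^-1) `^ h <= _).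
    by rewrite -powRrM mulVf ?gt_eqF // powRr1.
  apply: ge0_ler_powR; rewrite ?nnegrE ?powR_ge0 ?(ltW h0) //.
  have /andP[_ /ltW hh] := truncn_itv (powR_ge0 (2 : R) h^-1).
  by apply: le_trans hh _; rewrite ler_nat /N.
pose L := prime_upto N.
have pL : {in L, forall r, prime r} by move=> r; rewrite mem_filter => /andP[].
have uL : uniq L by rewrite filter_uniq ?iota_uniq.
pose l := [seq q <- L | (m <= q)%N].
exists l; split.
- by move=> q; rewrite mem_filter => /andP[-> /pL ->].
- by rewrite filter_uniq.
pose F (q : nat) : R := q%:R `^ (- (1 + h)).
have F0 q : 0 <= F q by exact: powR_ge0.
have Fh q : (2 <= q)%N -> F q <= q%:R^-1.
  move=> q2; rewrite -(@powR_inv1 _ q%:R) // /F; apply: ler_powR; last by lra.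
  by rewrite ler1n; lia.
have one : \sum_(1 <= n < N.+1 | coprime_to L n) n%:R `^ (- (1 + h)) <= 1 :> R.
  rewrite big_mkcond big_nat_recl //= powR1 /coprime_to.
  rewrite big_nat_cond big1 ?addr0; first by case: ifP.
  move=> n /andP[/andP[n0 nN] _]; case: ifP => // /allP hc.
  have n1 : (1 < n.+1)%N by rewrite ltnS.
  have := hc (pdiv n.+1); rewrite pdiv_dvd => /(_ _)/negP []//.
  rewrite mem_filter pdiv_prime // mem_index_iota /= ltnS.
  by apply: leq_trans (pdiv_leq _) _.
have hz := zeta_partial_ge N h0.
have z0 : (2 * h)^-1 <= \sum_(1 <= n < N.+1) n%:R `^ (- (1 + h)) :> R.
  by apply: le_trans hz; rewrite invfM ler_pM2r ?invr_gt0 //; lra.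
have e0 : 0 < 1 + h by lra.
have hp := le_trans (euler_prod_ge N e0 pL uL) one.
have prodge : expR (- \sum_(q <- L) (F q + 2 * F q ^+ 2)) <= \prod_(q <- L) (1 - F q).
  rewrite -sumrN expR_sum big_seq [leRHS]big_seq; apply: ler_prod => q qL; rewrite expR_ge0 /=.
  have q2 := prime_gt1 (pL _ qL); have Fq := Fh _ q2.
  have q3 : q%:R^-1 <= 2^-1 :> R by rewrite lef_pV2 ?posrE ?ltr0n ?ler_nat // ltnW.
  have := @expR_le1D (- F q); rewrite sqrrN => H.
  by rewrite opprD; apply: H; lra.
have hexp : (2 * h)^-1 <= expR (\sum_(q <- L) (F q + 2 * F q ^+ 2)).
  have E0 := expR_gt0 (\sum_(q <- L) (F q + 2 * F q ^+ 2)).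
  rewrite expRN in prodge.
  have h2 : 0 <= (2 * h)^-1 by rewrite invr_ge0 mulr_ge0 // ltW.
  have : (expR (\sum_(q <- L) (F q + 2 * F q ^+ 2)))^-1 * (2 * h)^-1 <= 1.
    by apply: le_trans hp; apply: ler_pM => //; rewrite invr_ge0 ltW.
  by rewrite ler_pdivrMl // mulr1.
have hL : {in L, forall n, 0 < n <= N}%N.
  by move=> q; rewrite mem_filter mem_index_iota ltnS => /andP[/prime_gt0 -> /andP[_ ->]].
have sq : \sum_(q <- L) F q ^+ 2 <= 2.
  have h2 := @zeta_partial_le R 1 N ltr01; rewrite invr1 in h2.
  apply: le_trans h2; apply: le_trans (_ : \sum_(q <- L) q%:R `^ (- (1 + 1)) <= _).
    rewrite big_seq [leRHS]big_seq; apply: ler_sum => q qL.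
    rewrite -powR_mulrn // /F -powRrM; apply: ler_powR; first by rewrite ler1n prime_gt0 // pL.
    by lra.
  by apply: (@sum_list_le (fun q => q%:R `^ (- (1 + 1)))).
have small : \sum_(q <- L | (q < m)%N) F q <= m%:R.
  rewrite -big_filter; apply: le_trans (_ : \sum_(q <- [seq q <- L | (q < m)%N]) 1 <= _).
    rewrite big_seq [leRHS]big_seq; apply: ler_sum => q.
    rewrite mem_filter => /andP[_ /pL pq]; have q2 := prime_gt1 pq; have q1 := ltnW q2.
    by apply: le_trans (Fh _ q2) _; rewrite invf_le1 ?ltr0n ?ler1n.
  apply: le_trans (@sum_list_le (fun=> 1) _ m _ _ _) _ => //.
  - by rewrite filter_uniq.
  - by move=> q; rewrite mem_filter => /andP[/ltnW -> /pL /prime_gt0 ->].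
  by rewrite big_const_nat iter_addr_0 subSS subn0.
have split : \sum_(q <- L) (F q + 2 * F q ^+ 2) <= \sum_(q <- l) F q + (m%:R + 4).
  rewrite big_split /= -mulr_sumr (bigID (fun q => m <= q)%N) /= /l big_filter.
  have -> : \sum_(q <- L | ~~ (m <= q)%N) F q = \sum_(q <- L | (q < m)%N) F q.
    by apply: eq_bigl => q; rewrite ltnNge.
  lra.
have : (2 * h)^-1 <= expR (\sum_(q <- l) F q) * expR (m%:R + 4).
  by rewrite -expRD; apply: le_trans hexp _; rewrite ler_expR.
rewrite expRN -ler_pdivrMr ?expR_gt0 // => H; apply: le_trans H.
rewrite le_eqVlt; apply/orP; left; apply/eqP; field.
by rewrite !gt_eqF ?expR_gt0.
Qed.

End EulerLower.

(** * Mean values of products over distinct primes *)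

Section TrigProduct.
Variable R : realType.
Local Open Scope complex_scope.

Lemma logn_prod_pow (I : finType) (q a : I -> nat) (j : I) : (forall i, prime (q i)) ->
  injective q -> logn (q j) (\prod_i q i ^ a i)%N = a j.
Proof.
move=> pq iq.
have h (r : seq I) : logn (q j) (\prod_(i <- r) q i ^ a i)%N = (\sum_(i <- r | i == j) a i)%N.
  elim: r => [|i r IH]; first by rewrite !big_nil logn1.
  rewrite !big_cons lognM; last 2 first.
  - by rewrite expn_gt0 prime_gt0.
  - by apply: prodn_gt0 => k; rewrite expn_gt0 prime_gt0.
  rewrite IH lognX logn_prime // (inj_eq iq) [in LHS]eq_sym; case: eqP => _ /=; first by rewrite muln1.
  by rewrite muln0.
by rewrite h big_pred1_eq.
Qed.

Section Prod.
Variables (I : finType) (q : I -> nat) (K : nat) (d : 'I_K) (T : I -> 'I_K -> R[i]).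
Hypotheses (pq : forall i, prime (q i)) (iq : injective q).

(** Exponents are counted from [d], so that the natural indices [k] represent the integers [k - d]
    of either sign and [d] marks the constant term. *)
Let freq (f : {ffun I -> 'I_K}) : R := \sum_i ((f i)%:R - d%:R) * ln (q i)%:R.

Lemma prod_trigE t :
  \prod_i \sum_k T i k * cis ((k%:R - d%:R) * ln (q i)%:R * t) =
  \sum_(f : {ffun I -> 'I_K}) (\prod_i T i (f i)) * cis (freq f * t).
Proof.
rewrite bigA_distr_bigA; apply: eq_bigr => f _.
by rewrite big_split /= /freq mulr_suml cis_sum.
Qed.

(** Unique factorization: after exponentiation a vanishing frequency equates two products of powers
    of distinct primes, whose exponents can be read off by [logn]. *)
Lemma freq_eq0 f : (freq f == 0) = (f == [ffun=> d]).
Proof.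
apply/eqP/eqP => [h|->]; last first.
  by rewrite /freq big1 // => i _; rewrite ffunE subrr mul0r.
have e : \sum_i (f i)%:R * ln (q i)%:R = \sum_i d%:R * ln (q i)%:R :> R.
  by apply/eqP; rewrite -subr_eq0 -sumrB; apply/eqP; rewrite -[RHS]h; apply: eq_bigr => i _; rewrite mulrBl.
have lnE (a : I -> nat) : \sum_i (a i)%:R * ln (q i)%:R = ln ((\prod_i q i ^ a i)%N%:R) :> R.
  rewrite ln_prod_nat; last by move=> i; rewrite expn_gt0 prime_gt0.
  by apply: eq_bigr => i _; rewrite lnX.
rewrite (lnE (fun i => f i)) (lnE (fun=> d)) in e.
have pos (a : I -> nat) : (0 < \prod_i q i ^ a i)%N by apply: prodn_gt0 => i; rewrite expn_gt0 prime_gt0.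
have := ln_nat_inj (pos _) (pos _) e => {}e.
apply/ffunP => i; rewrite ffunE; apply/val_inj => /=.
by rewrite -(logn_prod_pow (fun i => f i) i pq iq) e logn_prod_pow.
Qed.

Lemma bmeas_prod_trig :
  bmeas (fun t => complex.Re (\prod_i \sum_k T i k * cis ((k%:R - d%:R) * ln (q i)%:R * t))).
Proof.
under eq_fun do rewrite prod_trigE Re_sum.
by apply: bmeas_sum => f; exact: bmeas_Re_cis.
Qed.

Lemma has_mean_prod_trig :
  has_mean (fun t => complex.Re (\prod_i \sum_k T i k * cis ((k%:R - d%:R) * ln (q i)%:R * t)))
    (complex.Re (\prod_i T i d)).
Proof.
under eq_fun do rewrite prod_trigE.
have -> : complex.Re (\prod_i T i d) =
   \sum_(f : {ffun I -> 'I_K}) complex.Re (\prod_i T i (f i)) *+ (freq f == 0).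
  rewrite (bigD1 [ffun=> d]) //= freq_eq0 eqxx mulr1n [X in _ = _ + X]big1 ?addr0.
    by congr complex.Re; apply: eq_bigr => i _; rewrite ffunE.
  by move=> f fd; rewrite freq_eq0 (negbTE fd).
exact: has_mean_trig.
Qed.

End Prod.

Lemma quadratic_sqr (x y th : R) :
  (cabs (1 + x%:C * cis (- th) + y%:C * cis (- th) ^+ 2) ^+ 2)%:C =
  \sum_(k < 5) nth 0 [:: y%:C; (x + x * y)%:C; (1 + x ^+ 2 + y ^+ 2)%:C; (x + x * y)%:C; y%:C] k *
     cis ((k%:R - 2) * th).
Proof.
rewrite -mul_conj_cabs !conjD conj1 !conjM !conjc_real -!cisN !opprK.
rewrite !big_ord_recl big_ord0 /= /bump /= addr0.
have -> : (0 - 2) * th = - th - th by ring.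
have -> : (1 - 2) * th = - th by ring.
have -> : (2 - 2) * th = 0 by ring.
have -> : ((1 + 2)%N%:R - 2) * th = th by rewrite natrD; ring.
have -> : ((1 + 3)%N%:R - 2) * th = th + th by rewrite natrD; ring.
rewrite !cisD cis0 !real_complexD !real_complexM.
have -> : (1 : R)%:C = 1 by [].
have e : cis (- th) * cis th = 1 by rewrite -cisD addNr cis0.
move: (cis (- th)) (cis th) e => w v e.
transitivity (y%:C * (w * w) + (x%:C + x%:C * y%:C) * w + (1 + x%:C ^+ 2 + y%:C ^+ 2) + (x%:C + x%:C * y%:C) * v + y%:C * (v * v) +
   (w * v - 1) * (x%:C ^+ 2 + x%:C * y%:C * v + x%:C * y%:C * w + y%:C ^+ 2 * (w * v + 1))); first by ring.
rewrite e; ring.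
Qed.

End TrigProduct.

Section ProductPolynomial.
Variable R : realType.
Local Open Scope complex_scope.

Lemma npow_sM (m n : nat) (sg t : R) : (0 < m)%N -> (0 < n)%N ->
  npow_s (m * n) sg t = npow_s m sg t * npow_s n sg t.
Proof.
move=> m0 n0; rewrite !npow_sE lnM_nat // mulrDr opprD cisD natrM powRM // real_complexM.
by rewrite mulrACA.
Qed.

Lemma npow_s1 (sg t : R) : npow_s 1 sg t = 1.
Proof. by rewrite npow_sE ln1 mulr0 oppr0 cis0 powR1 mulr1. Qed.

Lemma npow_s_prod (I : finType) (A : {pred I}) (q : I -> nat) (sg t : R) : (forall i, 0 < q i)%N ->
  (0 < \prod_(i in A) q i)%N /\
  npow_s (\prod_(i in A) q i)%N sg t = \prod_(i in A) npow_s (q i) sg t.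
Proof.
move=> q0; elim/big_rec2 : _ => [|i y x iA [x0 <-]]; first by rewrite npow_s1.
by rewrite muln_gt0 q0 x0 npow_sM.
Qed.

Lemma dpoly_of_family (I : finType) (n : I -> nat) (c : I -> R[i]) : (forall i, 0 < n i)%N ->
  exists P : dpoly R, forall sg t, deval P sg t = \sum_i c i * npow_s (n i) sg t.
Proof.
move=> n0; exists ((\max_i n i)%N, fun m => \sum_(i | n i == m) c i) => sg t; rewrite /deval /=.
have -> : \sum_i c i * npow_s (n i) sg t =
    \sum_i \sum_(1 <= m < (\max_i n i).+1) if m == n i then c i * npow_s m sg t else 0.
  apply: eq_bigr => i _; rewrite -big_mkcond big_nat1_eq n0 ltnS.
  by rewrite (leq_bigmax i).
rewrite exchange_big /= !big_nat; apply: eq_bigr => m /andP[m0 mM].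
rewrite /dcoef /= m0 -ltnS mM /= mulr_suml big_mkcond; apply: eq_bigr => i _.
by rewrite eq_sym.
Qed.

Lemma dpoly_prod (I : finType) (q : I -> nat) (c : I -> R[i]) : (forall i, 0 < q i)%N ->
  exists P : dpoly R, forall sg t, deval P sg t = \prod_i (1 + c i * npow_s (q i) sg t).
Proof.
move=> q0.
have [P hP] := @dpoly_of_family {set I} (fun A => \prod_(i in A) q i)%N (fun A => \prod_(i in A) c i)
  (fun A => (npow_s_prod (mem A) 0 0 q0).1).
exists P => sg t; rewrite hP.
under [RHS]eq_bigr do rewrite addrC.
rewrite bigA_distr; apply: eq_bigr => A _.
rewrite (npow_s_prod (mem A) sg t q0).2 -big_split /= [LHS]big_mkcond /=.
by apply: eq_bigr => i _.
Qed.

Lemma powR_prod (I : finType) (F : I -> R) (r : R) : (forall i, 0 <= F i) ->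
  (\prod_i F i) `^ r = \prod_i F i `^ r.
Proof.
move=> F0; suff : 0 <= \prod_i F i /\ (\prod_i F i) `^ r = \prod_i F i `^ r by case.
elim/big_rec2 : _ => [|i y x _ [x0 <-]]; first by rewrite powR1.
by rewrite powRM // mulr_ge0.
Qed.

(** A noninteger power of a factor is replaced by the square of a trigonometric polynomial, whose
    mean is computable, at a third-order cost. The binomial series is cut at degree 2 with
    [th = 1 / 2], whose error bound is [4 * 2 ^ 5 * 3 * c ^ 3 = 384 * c ^ 3]; the passage to an
    exponential doubles it. *)
Lemma factor_upper (g c : R) (w : R[i]) : 0 <= g <= 1 -> cabs w = c -> c <= 10^-1 ->
  (cabs (1 + w) ^+ 2) `^ g <=
  cabs (1 + g%:C * w + (g * (g - 1) / 2)%:C * w ^+ 2) ^+ 2 * expR (768 * c ^+ 3).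
Proof.
move=> /andP[g0 g1] wc c1.
have c0 : 0 <= c by rewrite -wc cabs_ge0.
have hg : `|g| <= 1 by rewrite ger0_norm.
have hw : cabs w <= 2^-1 by rewrite wc; lra.
have h12 : (2^-1 : R) < 1 by lra.
have := binpoly_approx 2 hg hw h12.
have -> : binpoly g 2 w = 1 + g%:C * w + (g * (g - 1) / 2)%:C * w ^+ 2.
  rewrite /binpoly !big_ord_recl big_ord0 /= /bump /= gbin0 gbin1 addr0 addrA.
  have -> : gbin g (1 + 1) = g * (g - 1) / 2.
    by have := gbinS g 1; rewrite gbin1 => h; apply: (mulfI (_ : (2 : R) != 0)) => //; rewrite h; field.
  by rewrite expr0 mulr1 expr1.
move: (_ + _ * _ ^+ 2) => B; rewrite wc => h.
have a0 : 0 < cabs (1 + w) ^+ 2 by rewrite exprn_gt0 // cabs_add1_gt0 // wc; lra.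
set X := _ ^+ 2 in a0 *; set Y := cabs B ^+ 2 in h *.
pose a := 384 * c ^+ 3.
have c3 : 0 <= c ^+ 3 by rewrite exprn_ge0.
have ea : 4 * (1 - 2^-1) ^- 5 * 3 * c ^+ 3 = a by rewrite /a; field.
rewrite ea in h.
(* This is where [c <= 1 / 10] is used: [384 / 1000 <= 1 / 2]. *)
have a2 : a <= 2^-1.
  rewrite /a; have : c ^+ 3 <= 10^-1 ^+ 3 by rewrite lerXn2r ?nnegrE.
  by rewrite (_ : 10^-1 ^+ 3 = 1000^-1 :> R); [lra | field].
have a00 : 0 <= a by rewrite /a mulr_ge0.
have h1 : expR (- (2 * a)) <= Y * X `^ (- g).
  apply: le_trans (_ : 1 - a <= _); last by move: h; rewrite ler_norml => /andP[]; lra.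
  apply: le_trans (@expR_le1D R (- a) _); last by lra.
  by rewrite ler_expR sqrrN; nra.
have Xg : 0 < X `^ g by rewrite powR_gt0.
rewrite powRN ler_pdivlMr // expRN mulrC ler_pdivrMr ?expR_gt0 // in h1.
by apply: le_trans h1 _; rewrite (_ : 768 * c ^+ 3 = 2 * a) // /a; ring.
Qed.

(** After [factor_upper] the mean of the product is the product of the constant terms
    [1 + x ^ 2 + y ^ 2]. The linear terms vanish, and [x = (p / 2) * c] yields the second-order
    coefficient [(p / 2) ^ 2]. *)
Lemma Hp_mean_prod_le (I : finType) (q : I -> nat) (c : I -> R) (p : R) (P : dpoly R) :
  0 < p <= 2 -> (forall i, prime (q i)) -> injective q -> (forall i, 0 <= c i <= 10^-1) ->
  (forall t, deval P 0 t = \prod_i (1 + (c i)%:C * npow_s (q i) 0 t)) ->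
  Hp_mean p P <= expR (\sum_i ((p / 2) ^+ 2 * c i ^+ 2 + c i ^+ 4 + 768 * c i ^+ 3)).
Proof.
move=> hp pq iq hc hP; have [p0 p2] := andP hp.
pose g := p / 2; have hg : 0 <= g <= 1.
  by rewrite /g; apply/andP; split; lra.
have [g0 g1] := andP hg.
pose x i := g * c i; pose y i := g * (g - 1) / 2 * c i ^+ 2.
pose th (i : I) (t : R) := ln (q i)%:R * t.
pose B i t := 1 + (x i)%:C * cis (- th i t) + (y i)%:C * cis (- th i t) ^+ 2.
pose T i (k : 'I_5) := nth 0 [:: (y i)%:C; (x i + x i * y i)%:C; (1 + x i ^+ 2 + y i ^+ 2)%:C; (x i + x i * y i)%:C; (y i)%:C] k.
pose d : 'I_5 := inord 2.
have dE : d = 2%N :> nat by rewrite /d inordK.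
pose E := expR (\sum_i 768 * c i ^+ 3).
pose G t := complex.Re (\prod_i \sum_k T i k * cis ((k%:R - d%:R) * ln (q i)%:R * t)).
have GE t : G t = \prod_i cabs (B i t) ^+ 2.
  rewrite /G (eq_bigr (fun i => (cabs (B i t) ^+ 2)%:C)); last first.
    move=> i _; rewrite quadratic_sqr; apply: eq_bigr => k _.
    by congr (_ * cis _); rewrite dE /th mulrA.
  by rewrite -(big_morph _ (@real_complexM R) (erefl : (1 : R)%:C = 1)).
have le t : cabs (deval P 0 t) `^ p <= E * G t.
  rewrite cabs_powR -/g hP cabs_prod -prodrXl powR_prod; last by move=> i; exact: sqr_ge0.
  rewrite GE /E expR_sum mulrC -big_split /=; apply: ler_prod => i _; rewrite powR_ge0 /=.
  have [c0 c1] := andP (hc i).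
  have := @factor_upper g (c i) ((c i)%:C * npow_s (q i) 0 t) hg.
  rewrite npow0E cabsM cabs_cis cabs_real mulr1 ger0_norm // => /(_ erefl c1) H.
  apply: le_trans H _; rewrite le_eqVlt; apply/orP; left; apply/eqP; congr (cabs _ ^+ 2 * _).
  rewrite /B /x /y /th !real_complexM !(mulrC t); ring.
have bG : bmeas (fun t => E * G t) by apply: bmeasZ; exact: bmeas_prod_trig.
have mG := @has_meanZ R E G _ (bmeas_prod_trig q d T) (@has_mean_prod_trig R I q 5 d T pq iq).
apply: le_trans (le_has_mean (bmeas_cabs_powR P (ltW p0)) bG le (@Hp_meanP R p P hp) mG) _.
have -> : complex.Re (\prod_i T i d) = \prod_i (1 + x i ^+ 2 + y i ^+ 2).
  rewrite (eq_bigr (fun i => (1 + x i ^+ 2 + y i ^+ 2)%:C)); last by move=> i _; rewrite /T dE.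
  by rewrite -(big_morph _ (@real_complexM R) (erefl : (1 : R)%:C = 1)).
rewrite /E !expR_sum mulrC -big_split /=; apply: ler_prod => i _.
have s0 := sqr_ge0 (x i); have s1 := sqr_ge0 (y i).
rewrite mulr_ge0 ?expR_ge0 //=; last by lra.
rewrite expRD ler_wpM2r ?expR_ge0 //.
apply: le_trans (expR_ge1Dx _); rewrite -addrA lerD2l lerD //; first by rewrite /x exprMn.
rewrite /y exprMn -exprM; rewrite -[leRHS]mul1r ler_wpM2r ?exprn_even_ge0 //.
have [h1 h2] : -1 <= g * (g - 1) / 2 /\ g * (g - 1) / 2 <= 0 by split; nra.
by move: (_ / 2) h1 h2 => v h1 h2; nra.
Qed.

Lemma cos_ge_quadratic (x : R) : 0 <= x -> 1 - x ^+ 2 / 2 <= cos x.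
Proof.
have mono (f g : R -> R) (y : R) : (forall u : R, is_derive u 1 f (g u)) -> continuous g ->
    (forall u, 0 <= u -> 0 <= g u) -> 0 <= y -> f 0 <= f y.
  move=> fg cg g0; rewrite le_eqVlt => /orP[/eqP <- //|y0].
  rewrite -subr_ge0 -(Rintegral_FTC y0 fg cg); apply: Rintegral_ge0 => u /=.
  by rewrite in_itv /= => /andP[u0 _]; exact: g0.
have csin (u : R) : is_derive u 1 (fun v : R => v - sin v) (1 - cos u).
  exact: is_deriveB.
have sin_le (y : R) : 0 <= y -> sin y <= y.
  move=> y0; have := mono _ _ y csin _ _ y0; rewrite sin0 subr0 subr_ge0; apply.
    by move=> u; apply: cvgB; [exact: cvg_cst | exact: continuous_cos].
  by move=> u _; rewrite subr_ge0 cos_le1.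
move=> x0.
have cc (u : R) : is_derive u 1 (fun v : R => cos v + 2^-1 * v ^+ 2) (u - sin u).
  by apply: is_derive_eq; rewrite /GRing.scale /=; field.
have := mono _ _ x cc _ _ x0; rewrite cos0 expr0n mulr0 addr0 => H.
suff : 1 <= cos x + 2^-1 * x ^+ 2 by lra.
apply: H; last by move=> u u0; rewrite subr_ge0 sin_le.
by move=> u; apply: cvgB; [exact: cvg_id | exact: continuous_sin].
Qed.

(** From [|1 + z| ^ 2 >= 1 + 2 * Re z] with [Re z = w * cos th]. The phase costs [w * th ^ 2], with
    [th] at most [kap * e * ln q]; this must remain comparable to [q ^ (- (1 + e))] for the sum over
    primes to be only logarithmic in [1 / e]. *)
Lemma factor_lower (s e kap sg t : R) (q : nat) : 1 <= s <= 2 -> 0 < e -> 0 <= kap ->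
  (16 <= q)%N -> 2^-1 + e / 2 <= sg <= 2^-1 + e -> 0 <= t <= kap * e ->
  expR (2 * s * q%:R `^ (- (1 + 2 * e)) - 16 * kap ^+ 2 * q%:R `^ (- (1 + e))
        - 32 * q%:R `^ (- (1 + 1))) <=
  cabs (1 + (s * q%:R `^ (- (2^-1 + e)))%:C * npow_s q sg t) ^+ 2.
Proof.
move=> /andP[s1 s2] e0 k0 q16 /andP[sg1 sg2] /andP[t0 t1].
set Q : R := q%:R; have Q16 : 16 <= Q by rewrite /Q (ler_nat R 16).
have Q1 : 1 <= Q by lra.
have Q0 : 0 < Q by lra.
have pD (a b : R) : Q `^ a * Q `^ b = Q `^ (a + b) by rewrite powRD // (gt_eqF Q0) implybT.
have pM (a b : R) : a <= b -> Q `^ a <= Q `^ b by move=> ab; apply: ler_powR.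
pose th := t * ln Q; pose w := s * Q `^ (- (2^-1 + e)) * Q `^ (- sg).
have L0 : 0 <= ln Q by rewrite ln_ge0.
have wE : w = s * Q `^ (- (2^-1 + e) - sg) by rewrite /w -mulrA pD.
have w_ge : s * Q `^ (- (1 + 2 * e)) <= w.
  by rewrite wE ler_wpM2l //; [lra | apply: pM; lra].
have w_le : w <= 2 * (Q `^ (- (1 + e)) * Q `^ (- (e / 2))).
  rewrite wE pD; apply: le_trans (_ : s * Q `^ (- (1 + e) - e / 2) <= _).
    by rewrite ler_wpM2l //; [lra | apply: pM; lra].
  by rewrite ler_wpM2r ?powR_ge0.
have w_le2 : w <= 2 * Q^-1.
  rewrite wE -(@powR_inv1 _ Q) ?(ltW Q0) //; apply: le_trans (_ : s * Q `^ (-1) <= _).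
    by rewrite ler_wpM2l //; [lra | apply: pM; lra].
  by rewrite ler_wpM2r ?powR_ge0.
have Qi : Q^-1 <= 16^-1 by rewrite lef_pV2 ?posrE.
have w0 : 0 <= w by rewrite !mulr_ge0 ?powR_ge0 //; lra.
have e2 : Q `^ (- (1 + 1)) = Q^-1 ^+ 2.
  by rewrite opprD -pD powR_inv1 ?(ltW Q0).
have th0 : 0 <= th by rewrite mulr_ge0.
have cosx := cos_ge_quadratic th0; have c1 := cos_le1 th; have c2 := cos_geN1 th.
have sq : 1 + 2 * w * cos th <= cabs (1 + (s * Q `^ (- (2^-1 + e)))%:C * npow_s q sg t) ^+ 2.
  rewrite cabs_sqr /npow_s /= -/Q -/th.
  set a := s * _; rewrite -/a in w wE w_ge w_le w_le2 w0 *.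
  have -> : (1 + (a * (Q `^ (- sg) * cos th) - 0 * - (Q `^ (- sg) * sin th))) ^+ 2 +
    (0 + (a * - (Q `^ (- sg) * sin th) + 0 * (Q `^ (- sg) * cos th))) ^+ 2 =
    1 + 2 * w * cos th + ((w * cos th) ^+ 2 + (w * sin th) ^+ 2) by rewrite /w; ring.
  by rewrite lerDl addr_ge0 ?sqr_ge0.
apply: le_trans sq; apply: le_trans (@expR_le1D R (2 * w * cos th) _); last by nra.
rewrite ler_expR e2.
have h1 : 2 * (2 * w * cos th) ^+ 2 <= 32 * Q^-1 ^+ 2.
  have -> : 2 * (2 * w * cos th) ^+ 2 = 8 * (w ^+ 2 * cos th ^+ 2) by ring.
  have cc : cos th ^+ 2 <= 1 by nra.
  have ww : w ^+ 2 <= 4 * Q^-1 ^+ 2 by nra.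
  have := sqr_ge0 w; have := sqr_ge0 (cos th); nra.
(* As [sg >= 1 / 2 + e / 2], the bound on [w] contains a spare factor [q ^ (- e / 2)], which pays
   for [(e * ln q) ^ 2 <= 8 * q ^ (e / 2)]. *)
have h2 : w * th ^+ 2 <= 16 * kap ^+ 2 * Q `^ (- (1 + e)).
  have thk : th ^+ 2 <= kap ^+ 2 * (e * ln Q) ^+ 2.
    by rewrite -exprMn lerXn2r ?nnegrE // ?mulr_ge0 ?(ltW e0) // /th mulrA ler_wpM2r.
  have eL : (e * ln Q) ^+ 2 <= 8 * Q `^ (e / 2).
    have u0 : 0 <= e / 2 * ln Q by rewrite mulr_ge0 // divr_ge0 // ltW.
    have := expR_ge1Dxn 1 u0; rewrite /powR (gt_eqF Q0) => h.
    have -> : (e * ln Q) ^+ 2 = 8 * ((e / 2 * ln Q) ^+ 2 / 2) by field.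
    by rewrite ler_wpM2l //; apply: le_trans h; rewrite lerDr.
  have p1 := powR_ge0 Q (- (1 + e)).
  have pp : Q `^ (- (e / 2)) * Q `^ (e / 2) = 1 by rewrite pD addNr powRr0.
  have k2 := sqr_ge0 kap.
  apply: le_trans (ler_pM w0 (sqr_ge0 th) w_le (le_trans thk (ler_wpM2l k2 eL))) _.
  rewrite le_eqVlt; apply/orP; left; apply/eqP.
  transitivity (16 * kap ^+ 2 * Q `^ (- (1 + e)) * (Q `^ (- (e / 2)) * Q `^ (e / 2))); first ring.
  by rewrite pp mulr1.
nra.
Qed.

End ProductPolynomial.

Section TestPolynomial.
Variable R : realType.
Local Open Scope complex_scope.
Local Notation mu := (@lebesgue_measure R).

Lemma sum_powR_list_le (l : seq nat) (h : R) : 0 < h -> uniq l -> {in l, forall q, 0 < q}%N ->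
  \sum_(q <- l) q%:R `^ (- (1 + h)) <= 1 + h^-1.
Proof.
move=> h0 ul l0; apply: le_trans (zeta_partial_le (\max_(q <- l) q) h0).
apply: (@sum_list_le R (fun q => q%:R `^ (- (1 + h)))) => //.
by move=> q ql; rewrite l0 //=; exact: (@leq_bigmax_seq _ l xpredT id).
Qed.

(** An upper bound for the sum over primes, used to control the loss from the phases in the box;
    [prime_sum_large] gives the lower bound for the main term. *)
Lemma sum_prime_powR_le (l : seq nat) (e : R) : 0 < e -> uniq l -> {in l, forall q, prime q} ->
  expR (\sum_(q <- l) q%:R `^ (- (1 + e))) <= (1 + e^-1) * expR 2.
Proof.
move=> e0 ul pl; apply: le_trans (ler_wpM2r (expR_ge0 2) (euler_prod_le_zeta e0 pl ul)).
have q2 : \sum_(q <- l) (q%:R `^ (- (1 + e))) ^+ 2 <= 2 :> R.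
  have h := sum_powR_list_le ltr01 ul (fun q ql => prime_gt0 (pl q ql)).
  rewrite invr1 in h; apply: le_trans h; rewrite big_seq [leRHS]big_seq; apply: ler_sum => q ql.
  rewrite -powR_mulrn ?powR_ge0 // -powRrM; apply: ler_powR; first by rewrite ler1n prime_gt0 // pl.
  lra.
apply: le_trans (_ : expR (\sum_(q <- l) (q%:R `^ (- (1 + e)) - (q%:R `^ (- (1 + e))) ^+ 2)) * expR 2 <= _).
  by rewrite -expRD ler_expR sumrB; lra.
rewrite ler_wpM2r ?expR_ge0 // expR_sum; apply: ler_prod => q _; rewrite expR_ge0 /=.
have y0 := powR_ge0 (q%:R : R) (- (1 + e)).
by rewrite -[leRHS]lnK ?posrE; [rewrite ler_expR ln1D_ge | lra].
Qed.

(** The coefficient of [q ^ (- z)] is [c = s * q ^ (- 1 / 2 - e)], for which [(p / 2) ^ 2 * c ^ 2]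
    is exactly [q ^ (- 1 - 2 e)]. The squared norm raises the mean to the power [2 / p = s], while
    on the box each factor contributes [2 s q ^ (- 1 - 2 e)] to the exponent: twice as much. *)
Lemma test_polynomial (p : R) : 1 <= p < 2 ->
  exists K : R, forall (e : R) (l : seq nat), 0 < e ->
  {in l, forall q, prime q && (400 <= q)%N} -> uniq l ->
  exists P : dpoly R,
    Hp_norm_poly p P ^+ 2 <= expR (2 / p * (\sum_(q <- l) q%:R `^ (- (1 + 2 * e)) + K)) /\
    forall kap sg t, 0 <= kap -> 2^-1 + e / 2 <= sg <= 2^-1 + e -> 0 <= t <= kap * e ->
      expR (2 * (2 / p) * (\sum_(q <- l) q%:R `^ (- (1 + 2 * e)))
            - 16 * kap ^+ 2 * (\sum_(q <- l) q%:R `^ (- (1 + e))) - 64) <=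
      cabs (deval P sg t) ^+ 2.
Proof.
move=> /andP[p1 p2]; 
(* 18464 = 16 * 2 + 768 * 8 * 3, from the three series in [Hp_mean_prod_le]. *)
exists 18464 => e l e0 hl ul; have p0 : 0 < p by lra.
pose s := 2 / p.
have hs : 1 <= s <= 2.
  by rewrite /s ler_pdivlMr // ler_pdivrMr //; apply/andP; split; lra.
have [s1 s2] := andP hs.
pose I := 'I_(size l); pose q (i : I) := tnth (in_tuple l) i.
have ql i : q i \in l by exact: mem_tnth.
have pq i : prime (q i) by have /andP[] := hl _ (ql i).
have q400 i : (400 <= q i)%N by have /andP[] := hl _ (ql i).
have q0 i : (0 < q i)%N by exact: prime_gt0.
have iq : injective q by apply/tuple_uniqP.
have sumE (F : nat -> R) : \sum_i F (q i) = \sum_(r <- l) F r by rewrite [RHS]big_tnth.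
pose c (i : I) := s * (q i)%:R `^ (- (2^-1 + e)).
have [P hP] := dpoly_prod (fun i => (c i)%:C) q0.
have pl : {in l, forall r, 0 < r}%N by move=> r /hl /andP[/prime_gt0].
have S2 : \sum_(r <- l) r%:R `^ (- (1 + 1)) <= 2 :> R.
  by have := sum_powR_list_le ltr01 ul pl; rewrite invr1.
have S32 : \sum_(r <- l) r%:R `^ (- (1 + 2^-1)) <= 3 :> R.
  have h2 : (0 : R) < 2^-1 by lra.
  by have := sum_powR_list_le h2 ul pl; rewrite invrK; lra.
exists P; split.
  have hp : 0 < p <= 2 by rewrite p0 ltW.
  have hp1 : 1 <= p <= 2 by rewrite p1 ltW.
  have c_le i : c i <= 2 * (q i)%:R `^ (- 2^-1).
    rewrite /c ler_pM ?powR_ge0 //; first by lra.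
    by apply: ler_powR; [rewrite ler1n | lra].
  have c0 i : 0 <= c i by rewrite /c mulr_ge0 ?powR_ge0 //; lra.
  (* The threshold 400 is chosen for this: [2 / sqrt 400 = 1 / 10]. *)
  have c10 i : 0 <= c i <= 10^-1.
    rewrite c0 /=; apply: le_trans (c_le i) _.
    have : (q i)%:R `^ (- 2^-1) <= 20^-1 :> R.
      rewrite powRN lef_pV2 ?posrE ?powR_gt0 ?ltr0n //.
      rewrite powR12_sqrt // -[leLHS]ger0_norm // -sqrtr_sqr ler_wsqrtr //.
      by rewrite -natrX ler_nat.
    lra.
  have := Hp_mean_prod_le hp pq iq c10 (hP 0).
  set X := \sum_i _ => hX.
  have XS : X <= \sum_(r <- l) r%:R `^ (- (1 + 2 * e)) + 18464.
    apply: le_trans (_ : \sum_i ((q i)%:R `^ (- (1 + 2 * e)) + 16 * (q i)%:R `^ (- (1 + 1)) +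
        768 * (8 * (q i)%:R `^ (- (1 + 2^-1)))) <= _); last first.
      rewrite !big_split /= -!mulr_sumr (sumE (fun r => r%:R `^ (- (1 + 2 * e)))).
      rewrite (sumE (fun r => r%:R `^ (- (1 + 1)))) (sumE (fun r => r%:R `^ (- (1 + 2^-1)))).
      lra.
    apply: ler_sum => i _; have z0 := powR_ge0 ((q i)%:R : R) (- 2^-1).
    have e1 : (p / 2) ^+ 2 * c i ^+ 2 = (q i)%:R `^ (- (1 + 2 * e)).
      have -> : (q i)%:R `^ (- (1 + 2 * e)) = ((q i)%:R `^ (- (2^-1 + e))) ^+ 2 :> R.
        by rewrite -powR_mulrn ?powR_ge0 // -powRrM; congr powR; field.
      by rewrite /c /s; move: (_ `^ _) => w; field; rewrite gt_eqF.
    have e2 : c i ^+ 4 <= 16 * (q i)%:R `^ (- (1 + 1)).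
      apply: le_trans (_ : (2 * (q i)%:R `^ (- 2^-1)) ^+ 4 <= _).
        by rewrite lerXn2r ?nnegrE // mulr_ge0.
      rewrite exprMn -[(_ `^ _) ^+ 4]powR_mulrn // -powRrM.
      rewrite (_ : - 2^-1 * 4%:R = - (1 + 1) :> R); last by field.
      by rewrite (_ : 2 ^+ 4 = 16 :> R) //; ring.
    have e3 : c i ^+ 3 <= 8 * (q i)%:R `^ (- (1 + 2^-1)).
      apply: le_trans (_ : (2 * (q i)%:R `^ (- 2^-1)) ^+ 3 <= _).
        by rewrite lerXn2r ?nnegrE // mulr_ge0.
      rewrite exprMn -[(_ `^ _) ^+ 3]powR_mulrn // -powRrM.
      rewrite (_ : - 2^-1 * 3%:R = - (1 + 2^-1) :> R); last by field.
      by rewrite (_ : 2 ^+ 3 = 8 :> R) //; ring.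
    by rewrite e1; lra.
  rewrite Hp_norm_polyE // -powR_mulrn ?powR_ge0 // -powRrM.
  apply: le_trans (_ : expR X `^ (p^-1 * 2%:R) <= _).
    apply: ge0_ler_powR => //; rewrite ?nnegrE ?expR_ge0 //.
      by rewrite mulr_ge0 // invr_ge0 ltW.
    exact: Hp_mean_ge0.
  have -> : expR X `^ (p^-1 * 2%:R) = expR (s * X).
    by rewrite /powR gt_eqF ?expR_gt0 // expRK; congr expR; rewrite /s; ring.
  by rewrite ler_expR ler_wpM2l // (le_trans _ s1).
move=> kap sg t k0 hsg ht.
rewrite hP cabs_prod -prodrXl.
apply: le_trans (_ : expR (\sum_i (2 * s * (q i)%:R `^ (- (1 + 2 * e)) -
    16 * kap ^+ 2 * (q i)%:R `^ (- (1 + e)) - 32 * (q i)%:R `^ (- (1 + 1)))) <= _).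
  rewrite ler_expR !sumrB -!mulr_sumr (sumE (fun r => r%:R `^ (- (1 + 2 * e)))).
  rewrite (sumE (fun r => r%:R `^ (- (1 + 1)))) (sumE (fun r => r%:R `^ (- (1 + e)))) -/s.
  lra.
rewrite expR_sum; apply: ler_prod => i _; rewrite expR_ge0 /=.
by apply: (@factor_lower R s e kap sg t (q i)) => //; apply: leq_trans (q400 i).
Qed.

End TestPolynomial.

(** * The contradiction on a small box *)

Section Sharpness.
Variable R : realType.
Local Open Scope complex_scope.
Local Notation mu := (@lebesgue_measure R).

Lemma Hp_norm_poly_dsub_self (p : R) (P : dpoly R) : 1 <= p <= 2 -> Hp_norm_poly p (dsub P P) = 0.
Proof.
move=> hp; have [p1 p2] := andP hp; have p0 : 0 < p by lra.
have hp0 : 0 < p <= 2 by rewrite p0.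
rewrite Hp_norm_polyE // (_ : Hp_mean _ _ = 0) ?powR0 ?invr_eq0 ?gt_eqF //.
have h := @Hp_meanP R p (dsub P P) hp0.
apply: (has_mean_unique h).
have -> : (fun t => cabs (deval (dsub P P) 0 t) `^ p) = fun=> 0.
  by apply/funext => t; rewrite deval_dsub subrr cabs0 powR0 // gt_eqF.
exact: has_mean_cst.
Qed.

Lemma Hp_approx_const (p : R) (P : dpoly R) : 1 <= p <= 2 -> Hp_approx p (dcoef P) (fun=> P).
Proof.
move=> hp; split; last by move=> n _; split; exact: cvg_cst.
by move=> e e0; exists 0%N => k l _ _; rewrite Hp_norm_poly_dsub_self.
Qed.

Lemma dseries_dcoef (P : dpoly R) (sg t : R) : dseries (dcoef P) sg t = deval P sg t.
Proof.
have lim_fin (F : nat -> R) : (forall n, (P.1 < n)%N -> F n = 0) ->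
    limn (fun N => \sum_(1 <= n < N) F n) = \sum_(1 <= n < P.1.+1) F n.
  move=> F0; apply: cvg_lim => //; apply: cvg_near_cst.
  exists P.1.+1 => // N /= PN; rewrite (big_cat_nat _ (n := P.1.+1)) //=.
  rewrite [X in _ + X]big_nat_cond [X in _ + X]big1 ?addr0 // => n /andP[/andP[Pn _] _].
  exact: F0.
have d0 n : (P.1 < n)%N -> dcoef P n = 0 by move=> hn; rewrite /dcoef [(n <= _)%N]leqNgt hn andbF.
rewrite /dseries !lim_fin; last 2 first.
- by move=> n /d0 ->; rewrite mul0r.
- by move=> n /d0 ->; rewrite mul0r.
by rewrite -Re_sum -Im_sum /deval; case: (\sum_(_ <= _ < _) _).
Qed.

Lemma weighted_int_box_ge (beta kap e m : R) (P : dpoly R) :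
  0 < beta <= 1 -> 0 < e <= 2^-1 -> 0 < kap <= 1 -> 0 <= m ->
  (forall sg t, 2^-1 + e / 2 <= sg <= 2^-1 + e -> 0 <= t <= kap * e -> m <= cabs (deval P sg t) ^+ 2) ->
  ((kap * e * (e / 2) * (m * e `^ (beta - 1) / 81))%:E <=
    weighted_int (dcoef P) (beta - 1) (2 * beta + 2))%E.
Proof.
move=> /andP[b0 b1] /andP[e0 e1] /andP[k0 k1] m0 hm.
pose W := wfun (fun z => cabs (dseries (dcoef P) z.2 z.1) ^+ 2) (beta - 1) (2 * beta + 2).
have mW : measurable_fun setT W.
  apply: measurable_wfun; under eq_fun do rewrite dseries_dcoef.
  exact: (measurable_psum (dcoef P) P.1).
have W0 z : 0 <= W z by rewrite wfun_ge0 // => ?; exact: sqr_ge0.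
rewrite weighted_int_product // -/W.
pose J1 : set R := `[0, kap * e]%classic; pose J2 : set R := `[2^-1 + e / 2, 2^-1 + e]%classic.
pose M := m * e `^ (beta - 1) / 81.
have M0 : 0 <= M by rewrite divr_ge0 // mulr_ge0 // powR_ge0.
have mJ : measurable (J1 `*` J2) by apply: measurableX; exact: measurable_itv.
have mI : measurable_fun setT (fun z : R * R => (\1_(J1 `*` J2) z : R)%:E).
  by apply/measurable_EFinP; exact: measurable_indic.
apply: le_trans (_ : (\int[mu \x mu]_z (M%:E * (\1_(J1 `*` J2) z)%:E) <= _)%E).
  rewrite ge0_integralZl_EFin // integral_indic // setIT.
  have mE (a b : R) : a < b -> mu `[a, b]%classic = (b - a)%:E.
    by move=> ab; rewrite lebesgue_measure_itv /= lte_fin ab -EFinB.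
  have ke0 : 0 < kap * e by rewrite mulr_gt0.
  have box : ((mu \x mu) (J1 `*` J2) = (kap * e)%:E * (e / 2)%:E)%E.
    transitivity (mu J1 * mu J2)%E; first by apply: product_measure1E; exact: measurable_itv.
    rewrite /J1 /J2 !mE //; last by lra.
    by congr (_%:E * _%:E)%E; lra.
  rewrite [X in (_ <= _ * X)%E]box -!EFinM lee_fin le_eqVlt; apply/orP; left; apply/eqP.
  by rewrite /M; ring.
apply: ge0_le_integral => //.
- by move=> z _; rewrite mule_ge0 // lee_fin.
- exact: measurable_funeM.
- by apply/measurable_EFinP.
move=> [t sg] _ /=; rewrite -EFinM lee_fin indicE.
case: (boolP ((t, sg) \in _)) => [|_] /=; last by rewrite mulr0.
rewrite inE => -[/=]; rewrite /J1 /J2 /= !in_itv /= => ht hsg.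
rewrite mulr1 /W /wfun /= dseries_dcoef indicE mem_set /=; last first.
  by rewrite /right_ray /= in_itv /= andbT; have /andP[] := hsg; lra.
rewrite mul1r /M -mulrA -[leRHS]mulrA.
have [sg1 sg2] := andP hsg; have [t0 t1] := andP ht.
apply: ler_pM => //; first by rewrite divr_ge0 // powR_ge0.
  exact: hm.
have u0 : 0 < sg - 2^-1 by lra.
apply: ler_pM => //; rewrite ?powR_ge0 ?invr_ge0 //.
  have -> : beta - 1 = - (1 - beta) by ring.
  rewrite !powRN lef_pV2 ?posrE ?powR_gt0 //.
  by apply: ge0_ler_powR; rewrite ?nnegrE ?(ltW u0) ?(ltW e0) //; lra.
rewrite lef_pV2 ?posrE //; last by rewrite cabs_powR cabs_sqr /= powR_gt0 //; nra.
rewrite cabs_powR cabs_sqr /= (_ : (2 * beta + 2) / 2 = beta + 1); last by field.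
(* On the box the squared modulus is at most [4 + 1 <= 9], and [beta + 1 <= 2], whence the constant
   81. *)
apply: le_trans (_ : 9 `^ (beta + 1) <= _).
  have ke : kap * e <= 1 * e by rewrite ler_wpM2r // ltW.
  have q1 : (sg + 2^-1) ^+ 2 <= 2 ^+ 2 by rewrite lerXn2r ?nnegrE //; lra.
  have q2 : t ^+ 2 <= 1 ^+ 2 by rewrite lerXn2r ?nnegrE //; lra.
  by apply: ge0_ler_powR; rewrite ?nnegrE ?addr_ge0 ?sqr_ge0 //; lra.
apply: le_trans (_ : 9 `^ 2 <= _); first by apply: ler_powR; lra.
by rewrite powR_mulrn //; lra.
Qed.

Lemma no_smaller_exponent (p beta : R) : 1 <= p < 2 -> 0 < beta < 2 / p - 1 ->
  ~ exists C : R, 0 < C /\ forall P : dpoly R,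
    (weighted_int (dcoef P) (beta - 1) (2 * beta + 2) <= (C * Hp_norm_poly p P ^+ 2)%:E)%E.
Proof.
move=> hp /andP[b0 b1] [C [C0 hC]]; have [p1 p2] := andP hp; have p0 : 0 < p by lra.
set s := 2 / p in b1 *.
have s2 : s <= 2 by rewrite /s ler_pdivrMr //; lra.
(* With this value the loss [e ^ (16 * kap ^ 2)] from the phases uses up half of the gap
   [s - 1 - beta]; the other half is [dl]. *)
have [kap k0 kk] : exists2 kap : R, 0 < kap & kap ^+ 2 = (s - 1 - beta) / 32.
  exists (Num.sqrt ((s - 1 - beta) / 32)); first by rewrite sqrtr_gt0 divr_gt0 //; lra.
  by rewrite sqr_sqrtr // divr_ge0 //; lra.
have kap1 : kap <= 1 by rewrite -(expr1n _ 2) -(@ler_pXn2r _ 2) ?nnegrE ?(ltW k0) // kk ?expr1n; lra.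
have [dl dlE] : exists dl, dl = (s - 1 - beta) / 2 by eexists.
have dl0 : 0 < dl by lra.
have [c [c0 hc]] := prime_sum_large R 400.
have [k1 hk1] := test_polynomial hp.
have [a1 a1E] : exists a1, a1 = (2 * expR 2) `^ (- (16 * kap ^+ 2)) by eexists.
have a10 : 0 < a1 by rewrite a1E powR_gt0 // mulr_gt0 // expR_gt0.
have [K KE] : exists K, K = C * expR (k1 * s + 64) * 162 / kap by eexists.
have [a2 a2E] : exists a2, a2 = (c / 2) `^ s * a1 by eexists.
have a20 : 0 < a2 by rewrite a2E mulr_gt0 // powR_gt0 // divr_gt0.
have s0 : 0 <= s by lra.
have hb : 0 < beta <= 1 by apply/andP; split; lra.
have key (e : R) : 0 < e <= 2^-1 -> a2 * e `^ (- dl) <= K.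
  move=> /andP[e0 e1].
  have he : 0 < 2 * e <= 1 by apply/andP; split; lra.
  have e12 : 1 <= e^-1 by rewrite invf_ge1 // (le_trans e1) // invf_le1 // ler1n.
  have [l [hl ul hS]] := hc _ he.
  have [P [hP1 hP2]] := hk1 e l e0 hl ul.
  rewrite -/s in hP1 hP2.
  move: (\sum_(q <- l) q%:R `^ (- (1 + 2 * e))) hS hP1 hP2 => S hS hP1 hP2.
  have hT := sum_prime_powR_le e0 ul (fun q ql => (andP (hl q ql)).1).
  move: (\sum_(q <- l) q%:R `^ (- (1 + e))) hP2 hT => T hP2 hT.
  have {}hP2 sg t := hP2 kap sg t (ltW k0).
  have [m mE] : exists m, m = expR (2 * s * S - 16 * kap ^+ 2 * T - 64) by eexists.
  rewrite -mE in hP2.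
  have he2 : 0 < e <= 2^-1 by rewrite e0.
  have hk : 0 < kap <= 1 by rewrite k0.
  have m0 : 0 <= m by rewrite mE expR_ge0.
  have := @weighted_int_box_ge beta kap e m P hb he2 hk m0 hP2.
  move=> /le_trans /(_ (hC P)); rewrite lee_fin => H.
  have {}H := le_trans H (ler_wpM2l (ltW C0) hP1).
  have pe (a b : R) : e `^ a * e `^ b = e `^ (a + b) by rewrite powRD // (gt_eqF e0) implybT.
  have eS : expR (s * (S + k1)) = expR (s * S) * expR (k1 * s).
    by rewrite -expRD; congr expR; ring.
  have em : m = expR (s * S) ^+ 2 * expR (- (16 * kap ^+ 2 * T)) * (expR 64)^-1.
    by rewrite mE -expRM_natl -expRN -!expRD; congr expR; ring.
  have ee : e * e * e `^ (beta - 1) = e `^ (1 + beta).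
    rewrite -{1}(powRr1 (ltW e0)) -{2}(powRr1 (ltW e0)) !pe; congr powR; ring.
  have X0 : 0 < expR (s * S) := expR_gt0 _.
  have E64 := expR_gt0 (64 : R).
  (* One factor [expR (s * S)] cancels between the squared modulus on the box and the squared norm.
     The power [1 + beta] collects the area of the box and the weight; [162 = 2 * 81]. *)
  have H1 : e `^ (1 + beta) * expR (s * S) * expR (- (16 * kap ^+ 2 * T)) <= K.
    rewrite KE expRD ler_pdivlMr // -(ler_pM2r X0).
    move: H; rewrite em eS => H.
    have := ler_wpM2r (ltW E64) H.
    have -> : kap * e * (e / 2) * (expR (s * S) ^+ 2 * expR (- (16 * kap ^+ 2 * T)) / expR 64 *
        e `^ (beta - 1) / 81) * expR 64 =
      (e * e * e `^ (beta - 1)) * expR (s * S) ^+ 2 * expR (- (16 * kap ^+ 2 * T)) * kap / 162.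
      by move: (expR 64) E64 => E E0; field; rewrite gt_eqF.
    rewrite ee ler_pdivrMr // => {}H; apply: le_trans (_ : _ <= _) (le_trans H _);
      rewrite le_eqVlt; apply/orP; left; apply/eqP; ring.
  have H2 : a1 * e `^ (16 * kap ^+ 2) <= expR (- (16 * kap ^+ 2 * T)).
    have -> : a1 * e `^ (16 * kap ^+ 2) = (2 * expR 2 / e) `^ (- (16 * kap ^+ 2)).
      rewrite powRM ?mulr_ge0 ?expR_ge0 ?invr_ge0 ?(ltW e0) // -a1E; congr (_ * _).
      by rewrite -(powR_inv1 (ltW e0)) -powRrM mulN1r opprK.
    have -> : expR (- (16 * kap ^+ 2 * T)) = (expR T) `^ (- (16 * kap ^+ 2)).
      by rewrite /powR gt_eqF ?expR_gt0 // expRK mulNr.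
    rewrite !powRN lef_pV2 ?posrE ?powR_gt0 ?expR_gt0 //; last first.
      by rewrite divr_gt0 // mulr_gt0 // expR_gt0.
    apply: ge0_ler_powR; rewrite ?nnegrE ?expR_ge0 ?invr_ge0 ?(ltW e0) ?mulr_ge0 ?expR_ge0 ?invr_ge0 ?(ltW k0) ?(ltW e0) //.
    apply: le_trans hT _; rewrite [leRHS]mulrAC ler_wpM2r ?expR_ge0 // (_ : 2 / e = e^-1 + e^-1) ?lerD2r //; ring.
  have H3 : (c / 2) `^ s * e `^ (- s) <= expR (s * S).
    have -> : (c / 2) `^ s * e `^ (- s) = (c / (2 * e)) `^ s.
      rewrite -(mulN1r s) [e `^ _]powRrM (powR_inv1 (ltW e0)) -powRM ?invr_ge0 ?(ltW e0) //.
        by congr powR; field; rewrite gt_eqF.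
      by rewrite divr_ge0 // ltW.
    have -> : expR (s * S) = (expR S) `^ s by rewrite /powR gt_eqF ?expR_gt0 // expRK.
    apply: (ge0_ler_powR s0 _ _ hS); rewrite nnegrE ?expR_ge0 //.
    by apply: divr_ge0 (ltW c0) _; exact: ltW (andP he).1.
  apply: le_trans H1.
  have -> : a2 * e `^ (- dl) = e `^ (1 + beta) * ((c / 2) `^ s * e `^ (- s)) * (a1 * e `^ (16 * kap ^+ 2)).
    have -> : - dl = 1 + beta + - s + 16 * kap ^+ 2 by rewrite kk dlE; field.
    rewrite -!pe a2E; ring.
  apply: ler_pM => //; first by rewrite !mulr_ge0 ?powR_ge0.
    by rewrite mulr_ge0 ?powR_ge0 // ltW.
  by rewrite ler_wpM2l ?powR_ge0.
have K0 : 0 < K by rewrite KE divr_gt0 // !mulr_gt0 // expR_gt0.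
(* The point [e] is defined by [e ^ (- dl) = M]. The first summand makes [a2 * M] exceed [K], the
   second ensures [e <= 1 / 2]. *)
pose M := K / a2 + 2 `^ dl.
have M2 : 2 `^ dl <= M by rewrite lerDr divr_ge0 // ltW.
have M0 : 0 < M by apply: lt_le_trans M2; rewrite powR_gt0.
pose e := M `^ (- dl^-1).
have e0 : 0 < e by rewrite powR_gt0.
have e1 : e <= 2^-1.
  rewrite /e powRN lef_pV2 ?posrE ?powR_gt0 //.
  have -> : 2 = (2 `^ dl) `^ dl^-1 :> R by rewrite -powRrM mulfV ?gt_eqF // powRr1.
  by apply: ge0_ler_powR; rewrite ?nnegrE ?invr_ge0 ?powR_ge0 ?(ltW dl0) ?(ltW M0).
have he : 0 < e <= 2^-1 by rewrite e0.
have := key e he.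
have -> : e `^ (- dl) = M by rewrite /e -powRrM mulrNN mulVf ?gt_eqF // powRr1 // ltW.
rewrite /M mulrDr mulrCA mulfV ?gt_eqF // mulr1 leNgt ltrDl.
by rewrite mulr_gt0 // powR_gt0.
Qed.

End Sharpness.

Theorem theorem1p1 (R : realType) (p : R) (hp1 : 1 <= p) (hp2 : p < 2) :
  (exists Cp : R, 0 < Cp /\
     forall (b : nat -> R[i]) (Ps : nat -> dpoly R), Hp_approx p b Ps ->
       (weighted_int b (2 / p - 2) (4 / p) `^ 2^-1 <= (Cp * Hp_norm_lim p Ps)%:E)%E)
  /\
  (forall beta : R, 0 < beta -> beta < 2 / p - 1 ->
     ~ (exists C : R, 0 < C /\
          forall (b : nat -> R[i]) (Ps : nat -> dpoly R), Hp_approx p b Ps ->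
            (weighted_int b (beta - 1) (2 * beta + 2) <= (C * Hp_norm_lim p Ps ^+ 2)%:E)%E)).
Proof.
have hp : 1 <= p < 2 by rewrite hp1.
have hp' : 1 <= p <= 2 by rewrite hp1 ltW.
split; first exact: Hp_embedding.
move=> beta b0 b1 [C [C0 hC]].
(* Constant sequences represent Dirichlet polynomials, and those already violate the estimate. *)
apply: (@no_smaller_exponent R p beta hp _); first by rewrite b0.
exists C; split => // P; have := hC _ _ (Hp_approx_const P hp').
by rewrite (_ : Hp_norm_lim p (fun=> P) = Hp_norm_poly p P) // /Hp_norm_lim lim_cst.
Qed.
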